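(* Let $u$ be a positive integer. There is an algorithm that, given a set $S \subseteq [u]$ of $n$ elements, computes in $O\bigl(\sqrt{n \log n}\, u \log u\bigr)$ time the set $\mathcal{S}_u(S) = \{\, \sum_{y \in Y} y \mid Y \subseteq S \,\} \cap [u]$ of all subset sums of $S$ up to $u$.
   Context: For a real number $u \ge 0$, $[u]$ denotes the set of integers $\{0, 1, \ldots, \lceil u \rceil\}$. For a finite set $X \subset \mathbb{N}$, $\Sigma X = \sum_{x \in X} x$ (with $\Sigma \emptyset = 0$), and $\mathcal{S}_u(X) = \{\Sigma Y \mid Y \subseteq X\} \cap [u]$ is the set of all subset sums of $X$ that are at most $u$. Running times are measured in the standard RAM model of computation with arithmetic on integers of the relevant size in constant time. *)

(* Defs.v *)
(* A word-RAM cost model, defined honestly so that "an algorithm running in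
   time T" has intrinsic meaning: a fixed program, unit cost per instruction,
   word values bounded by a polynomial in the input size (words of O(log u)
   bits), arithmetic (+, truncated -, *, div, mod) in constant time. *)
From mathcomp Require Import all_boot.
Set Implicit Arguments. Unset Strict Implicit. Unset Printing Implicit Defensive.

Definition memory := nat -> nat.

Definition upd (m : memory) (a v : nat) : memory :=
  fun x => if x == a then v else m x.

Inductive instr :=
| IConst of nat & nat
| IAdd   of nat & nat & nat
| ISub   of nat & nat & nat  (* truncated subtraction                  *)
| IMul   of nat & nat & nat
| IDiv   of nat & nat & nat  (* M[d] := M[a] %/ M[b]  (x %/ 0 = 0)     *)
| IMod   of nat & nat & nat  (* M[d] := M[a] %% M[b]  (x %% 0 = x)     *)
| ILoad  of nat & nat
| IStore of nat & nat
| IJz    of nat & nat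
| IJmp   of nat
| IHalt.

Inductive outcome :=
| OHalt of memory
| OStuck
| ONext of nat & memory.

(* One step of program [P] with word bound [W]: writing a value >= W makes
   the machine crash (word overflow is not allowed).  A program counter
   outside the program halts. *)
Definition step (P : seq instr) (W : nat) (pc : nat) (m : memory) : outcome :=
  let wr a v := if v < W then ONext pc.+1 (upd m a v) else OStuck in
  match nth IHalt P pc with
  | IConst d c => wr d c
  | IAdd d a b => wr d (m a + m b)
  | ISub d a b => wr d (m a - m b)
  | IMul d a b => wr d (m a * m b)
  | IDiv d a b => wr d (m a %/ m b)
  | IMod d a b => wr d (m a %% m b)
  | ILoad d a => wr d (m (m a))
  | IStore a s => wr (m a) (m s)
  | IJz r l => ONext (if m r == 0 then l else pc.+1) m
  | IJmp l => ONext l m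
  | IHalt => OHalt m
  end.

(* [run P W k pc m = Some m'] : started at [pc] with memory [m], the
   program halts after executing at most [k] (non-halt) instructions,
   with final memory [m']. *)
Fixpoint run (P : seq instr) (W k pc : nat) (m : memory) : option memory :=
  match step P W pc m with
  | OHalt m' => Some m'
  | OStuck => None
  | ONext pc' m' => if k is k'.+1 then run P W k' pc' m' else None
  end.

(* Input encoding: M[0] = u, M[1] = n = |S|, M[2..n+1] = elements of S
   (in the order of the list), all other cells 0. *)
Definition init_mem (u : nat) (s : seq nat) : memory :=
  fun x => if x == 0 then u else if x == 1 then size s else
           if 2 <= x then nth 0 s (x - 2) else 0.

Definition in_subset_sums (S : seq nat) (u x : nat) : Prop :=
  x <= u /\ exists Y : seq nat, [/\ uniq Y, {subset Y <= S} & sumn Y = x].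

(* Main.v *)
(* With b about sqrt(n log n), an element of residue l modulo b is b * y + l with
   y <= u / b, so a subset of the class of l is determined, up to its sum, by the
   sum z <= u / b of its quotients and its cardinality c. The attainable codes
   z + c * Q, with Q > 2u / b, are found by divide and conquer on the class, each
   merge being a Boolean convolution that drops the codes with z > u / b; the sets
   of sums of the b classes are then merged by b convolutions of length O(u).
   Convolutions use a fixed-point complex FFT whose Gaussian integers are stored
   as words modulo H^2 + 1, where H plays the role of i. *)

(* The choice of b balances two costs. A class with n_l elements needs about log n levels of
   convolutions, each level of total length O((u / b) n_l), so all classes together cost O((u / b) n
   log n log u); the b merges cost O(b u log u). Both are O(b u log u) once b^2 is about n log n.
   The cardinality c has to be part of the code because a subset of the class of l sums to b z + c
   l, which z alone does not determine. Dropping z > u / b loses no sum up to u, since b z is at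
   most the sum.

   A number-theoretic transform would oblige the machine to find a prime with a suitable root of
   unity; complex roots come from integer square roots by the half-angle formulas. Only the
   vanishing of a coefficient matters, so an error below one unit is enough, and a scale polynomial
   in the transform length achieves it: every quantity stays polynomial in u and fits a word. The
   price is an explicit error analysis, carried out over an arbitrary real closed field. *)
Require Import Defs.
From mathcomp Require Import all_boot all_order all_algebra.
From mathcomp Require Import complex realalg.
From mathcomp Require Import zify ring lra.
Set Implicit Arguments. Unset Strict Implicit. Unset Printing Implicit Defensive.

(** * Word-RAM programs and their compilation *)

Section Language.

Definition store := nat -> nat.

Inductive binop := Oadd | Osub | Omul | Odiv | Omod.

Definition opv o x y := match o with
  | Oadd => x + y | Osub => x - y | Omul => x * y
  | Odiv => x %/ y | Omod => x %% y end.

Inductive exp :=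
| Cst of nat
| Var of nat
| Deref of exp
| Bin of binop & exp & exp.

Inductive com :=
| Skip
| Asn of nat & exp
| Sto of exp & exp
| Seq of com & com
| If of exp & com & com
| While of exp & com.

Fixpoint ev e (s h : store) : nat := match e with
  | Cst n => n
  | Var x => s x
  | Deref e => h (ev e s h)
  | Bin o e1 e2 => opv o (ev e1 s h) (ev e2 s h) end.

Variable B : nat.

(* Big-step execution with abstract time; every stored value must be below
   [B], while intermediate values of expressions are not bounded here. *)
Inductive exec : com -> store -> store -> nat -> store -> store -> Prop :=
| XSkip s h : exec Skip s h 0 s h
| XAsn x e s h : ev e s h < B -> exec (Asn x e) s h 1 (upd s x (ev e s h)) h
| XSto e1 e2 s h : ev e1 s h < B -> ev e2 s h < B ->
    exec (Sto e1 e2) s h 1 s (upd h (ev e1 s h) (ev e2 s h))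
| XSeq c1 c2 s h t1 s1 h1 t2 s2 h2 : exec c1 s h t1 s1 h1 ->
    exec c2 s1 h1 t2 s2 h2 -> exec (Seq c1 c2) s h (t1 + t2) s2 h2
| XIf e c1 c2 s h t s1 h1 : exec (if ev e s h == 0 then c2 else c1) s h t s1 h1 ->
    exec (If e c1 c2) s h t.+1 s1 h1
| XWhile0 e c s h : ev e s h = 0 -> exec (While e c) s h 1 s h
| XWhileS e c s h t1 s1 h1 t2 s2 h2 : ev e s h != 0 -> exec c s h t1 s1 h1 ->
    exec (While e c) s1 h1 t2 s2 h2 ->
    exec (While e c) s h (t1 + t2).+1 s2 h2.

(* Registers: [nvar] program variables, then [ntmp] temporaries; heap cell
   [a] lives at address [hbase + a]. *)
Definition nvar := 60.
Definition ntmp := 20.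
Definition hbase := 80.

Definition iop o := match o with
  | Oadd => IAdd | Osub => ISub | Omul => IMul | Odiv => IDiv | Omod => IMod end.

(** The temporaries form a stack: the result goes to temporary [d] and those below [d] survive. The
    machine has no move instruction, so a register is copied by adding a zero to it. *)
Fixpoint cexp e d : seq instr := match e with
  | Cst n => [:: IConst (nvar + d) n]
  | Var x => [:: IConst (nvar + d) 0; IAdd (nvar + d) x (nvar + d)]
  | Deref e => cexp e d ++ [:: IConst (nvar + d.+1) hbase;
      IAdd (nvar + d) (nvar + d) (nvar + d.+1); ILoad (nvar + d) (nvar + d)]
  | Bin o e1 e2 => cexp e1 d ++ cexp e2 d.+1 ++
      [:: iop o (nvar + d) (nvar + d) (nvar + d.+1)] end.

Fixpoint csize c := match c with
  | Skip => 0
  | Asn x e => size (cexp e 0) + 2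
  | Sto e1 e2 => size (cexp e1 0) + 2 + size (cexp e2 1) + 1
  | Seq c1 c2 => csize c1 + csize c2
  | If e c1 c2 => size (cexp e 0) + 2 + csize c1 + csize c2
  | While e c => size (cexp e 0) + 2 + csize c end.

Fixpoint ccom c p : seq instr := match c with
  | Skip => [::]
  | Asn x e => cexp e 0 ++ [:: IConst (nvar + 1) 0; IAdd x nvar (nvar + 1)]
  | Sto e1 e2 => cexp e1 0 ++
     [:: IConst (nvar + 1) hbase; IAdd nvar nvar (nvar + 1)] ++
     cexp e2 1 ++ [:: IStore nvar (nvar + 1)]
  | Seq c1 c2 => ccom c1 p ++ ccom c2 (p + csize c1)
  | If e c1 c2 => let p1 := p + size (cexp e 0) + 1 in
     let p2 := p1 + csize c1 + 1 in
     cexp e 0 ++ [:: IJz nvar p2] ++ ccom c1 p1 ++ [:: IJmp (p2 + csize c2)] ++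
     ccom c2 p2
  | While e c => let p1 := p + size (cexp e 0) + 1 in
     cexp e 0 ++ [:: IJz nvar (p1 + csize c + 1)] ++ ccom c p1 ++ [:: IJmp p] end.

(** Serves twice. Each operation on values below B^i and B^j stays below B^(i+j), so an expression
    with k leaves is below B^k and 15 leaves fit a word of size B^16; the number of leaves also
    bounds the depth of the stack of temporaries. *)
Fixpoint leaves e := match e with
  | Cst _ | Var _ => 1 | Deref e => leaves e
  | Bin _ e1 e2 => leaves e1 + leaves e2 end.

Fixpoint wfe e := match e with
  | Cst n => n < B
  | Var x => x < nvar
  | Deref e => wfe e
  | Bin _ e1 e2 => wfe e1 && wfe e2 end.

Definition oke e := wfe e && (leaves e <= 15).

Fixpoint okc c := match c with
  | Skip => true
  | Asn x e => (x < nvar) && oke e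
  | Sto e1 e2 => oke e1 && oke e2
  | Seq c1 c2 => okc c1 && okc c2
  | If e c1 c2 => [&& oke e, okc c1 & okc c2]
  | While e c => oke e && okc c end.

Lemma size_ccom c p : size (ccom c p) = csize c.
Proof.
elim: c p => //= [x e|e1 e2|c1 IH1 c2 IH2|e c1 IH1 c2 IH2|e c IH] p;
  rewrite ?size_cat /= ?size_cat ?IH1 ?IH2 ?IH /= ?size_cat ?IH2 /=; lia.
Qed.

Variables (P : seq instr) (W : nat).
Hypothesis B2 : hbase < B.
Hypothesis WB : B ^ 16 <= W.

Inductive steps : nat -> nat -> memory -> nat -> memory -> Prop :=
| steps0 p m : steps 0 p m p m
| stepsS k p m p1 m1 p2 m2 : step P W p m = ONext p1 m1 ->
   steps k p1 m1 p2 m2 -> steps k.+1 p m p2 m2.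

Lemma steps_trans k1 p m p1 m1 k2 p2 m2 : steps k1 p m p1 m1 ->
  steps k2 p1 m1 p2 m2 -> steps (k1 + k2) p m p2 m2.
Proof.
move=> H; elim: H => // k p' m' q1 n1 q2 n2 st _ IH H2.
by rewrite addSn; apply: stepsS st (IH H2).
Qed.

Lemma steps1 p m p1 m1 : step P W p m = ONext p1 m1 -> steps 1 p m p1 m1.
Proof. by move=> H; apply: (stepsS H); constructor. Qed.

Lemma steps_run k p m p1 m1 T : steps k p m p1 m1 -> nth IHalt P p1 = IHalt ->
  k <= T -> run P W T p m = Some m1.
Proof.
move=> H; elim: H T => [{}p {}m|{}k {}p {}m q1 n1 q2 n2 st _ IH] T hlt kT.
  by case: T kT => [|T] _ /=; rewrite /step hlt.
by case: T kT => [|T] // kT /=; rewrite st; apply: IH.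
Qed.

Definition code_at p c := forall i, i < size c -> nth IHalt P (p + i) = nth IHalt c i.

Lemma code_at_cat p c1 c2 :
  code_at p (c1 ++ c2) -> code_at p c1 /\ code_at (p + size c1) c2.
Proof.
move=> H; split=> i Hi.
  by rewrite H ?nth_cat ?Hi // size_cat ltn_addr.
by rewrite -addnA H ?nth_cat ?size_cat ?ltn_add2l // ltnNge leq_addr /= addKn.
Qed.

Lemma code_at_cons p i c : code_at p (i :: c) ->
  nth IHalt P p = i /\ code_at p.+1 c.
Proof.
move=> H; split; first by have := H 0 isT; rewrite addn0.
by move=> j Hj; rewrite addSnnS H.
Qed.

Definition bounded (s h : store) := (forall x, s x < B) /\ (forall a, h a < B).

Definition matches (m : memory) (s h : store) :=
  (forall x, x < nvar -> m x = s x) /\ (forall a, m (hbase + a) = h a).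

Lemma leaves_gt0 e : 0 < leaves e.
Proof. by elim: e => //= *; lia. Qed.

Lemma ev_bound s h e : bounded s h -> wfe e -> ev e s h < B ^ leaves e.
Proof.
move=> [bs bh]; elim: e => [n|x|e IH|o e1 IH1 e2 IH2] /=.
- by rewrite expn1.
- by rewrite expn1 => _; apply: bs.
- move=> _; apply: leq_trans (bh _) _; rewrite -{1}(expn1 B) leq_pexp2l ?leaves_gt0 //.
  by move: B2; rewrite /hbase; lia.
case/andP=> /IH1 H1 /IH2 H2; rewrite expnD.
have [p1 p2] : 0 < B ^ leaves e1 /\ 0 < B ^ leaves e2 by split; lia.
have B1 : forall e, 1 < B ^ leaves e.
  move=> e; apply: (@leq_trans (B ^ 1)); first by rewrite expn1; move: B2; rewrite /hbase; lia.
  by rewrite leq_pexp2l ?leaves_gt0 //; lia.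
move: (B1 e1) (B1 e2) H1 H2 => {IH1 IH2}.
move: (B ^ _) (B ^ _) (ev e1 s h) (ev e2 s h) => X Y x y X1 Y1 H1 H2.
case: o => /=; try nia.
Qed.

Lemma ltW x k : x < B ^ k -> k <= 15 -> x < W.
Proof.
move=> H1 H2; apply: leq_trans H1 (leq_trans _ WB).
by rewrite leq_pexp2l //; lia.
Qed.

(** The sixteenth factor [B] of the word bound absorbs the offset [hbase] of heap addresses. *)
Lemma ltW_heap x k : x < B ^ k -> k <= 15 -> hbase + x < W.
Proof.
move=> H1 H2; apply: leq_trans WB.
have H3 : x < B ^ 15 by apply: leq_trans H1 _; rewrite leq_pexp2l //; lia.
by rewrite expnSr; move: B2 H3; move: (B ^ 15) => X; rewrite /hbase; nia.
Qed.

Lemma upd_neq m a v x : x != a -> upd m a v x = m x.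
Proof. by rewrite /upd => /negbTE ->. Qed.

Lemma upd_eq m a v : upd m a v a = v.
Proof. by rewrite /upd eqxx. Qed.

Lemma matches_tmp m s h d v : matches m s h -> d < ntmp ->
  matches (upd m (nvar + d) v) s h.
Proof.
rewrite /matches /nvar /hbase /ntmp => -[m1 m2] Hd.
by split=> [x Hx|a]; [rewrite upd_neq ?m1 //|rewrite upd_neq ?m2 //]; lia.
Qed.

Lemma cexp_ok s h e d p m : bounded s h -> matches m s h -> wfe e ->
  leaves e + d <= 18 -> leaves e <= 15 -> code_at p (cexp e d) ->
  exists m', [/\ steps (size (cexp e d)) p m (p + size (cexp e d)) m',
    matches m' s h, m' (nvar + d) = ev e s h &
    forall j, j < d -> m' (nvar + j) = m (nvar + j)].
Proof.
move=> bd; elim: e d p m => [n|x|e IH|o e1 IH1 e2 IH2] d p m mt /= wf dl ll ca.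
- have [c1 _] := code_at_cons ca.
  exists (upd m (nvar + d) n); split.
  + rewrite addn1; apply: steps1; rewrite /step c1.
    by rewrite (@ltW _ 1) // expn1.
  + by apply: matches_tmp => //; rewrite /ntmp; lia.
  + by rewrite upd_eq.
  + by move=> j Hj; rewrite upd_neq //; lia.
- have [c1 /code_at_cons[c2 _]] := code_at_cons ca.
  have xd : x != nvar + d by lia.
  exists (upd (upd m (nvar + d) 0) (nvar + d) (s x)); split.
  + rewrite addn2; apply: (@stepsS _ _ _ p.+1 (upd m (nvar + d) 0)).
      by rewrite /step c1 (@ltW _ 1) // expn1; lia.
    apply: steps1; rewrite /step c2 upd_neq // upd_eq addn0 mt.1 //.
    by rewrite (@ltW _ 1) // expn1; apply: bd.1.
  + by do 2 (apply: matches_tmp; last (rewrite /ntmp; lia)).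
  + by rewrite upd_eq.
  + by move=> j Hj; rewrite !upd_neq //; lia.
- have [c0 /code_at_cons[c1 /code_at_cons[c2 /code_at_cons[c3 _]]]] := code_at_cat ca.
  have [m1 [s1 mt1 v1 f1]] := IH d p m mt wf dl ll c0.
  set m2 := upd m1 (nvar + d.+1) hbase.
  set m3 := upd m2 (nvar + d) (hbase + ev e s h).
  have mt3 : matches m3 s h.
    by do 2 (apply: matches_tmp; last (rewrite /ntmp; lia)).
  exists (upd m3 (nvar + d) (h (ev e s h))); split.
  + rewrite size_cat /= ; apply: (steps_trans s1).
    apply: (@stepsS _ _ _ _ m2).
      by rewrite /step c1 (@ltW _ 1) // expn1.
    apply: (@stepsS _ _ _ _ m3).
      have e2 : m2 (nvar + d) = ev e s h by rewrite /m2 upd_neq //; lia.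
      have e3 : m2 (nvar + d.+1) = hbase by rewrite /m2 upd_eq.
      rewrite /step c2 e2 e3 [_ + hbase]addnC (@ltW_heap _ (leaves e)) //.
      exact: ev_bound.
    have e4 : m3 (nvar + d) = hbase + ev e s h by rewrite /m3 upd_eq.
    apply: steps1; rewrite /step c3 e4 mt3.2.
    by rewrite !addnS addn0 (@ltW _ 1) // expn1; apply: bd.2.
  + by apply: matches_tmp => //; rewrite /ntmp; lia.
  + by rewrite upd_eq.
  + by move=> j Hj; rewrite /m3 /m2 !upd_neq ?f1 //; lia.
case/andP: wf => wf1 wf2.
have [c1 /code_at_cat[c2 /code_at_cons[c3 _]]] := code_at_cat ca.
have g1 := leaves_gt0 e1; have g2 := leaves_gt0 e2.
have [||m1 [s1 mt1 v1 f1]] := IH1 d p m mt wf1 _ _ c1; try lia.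
have [||m2 [s2 mt2 v2 f2]] := IH2 d.+1 _ m1 mt1 wf2 _ _ c2; try lia.
set v := opv o (ev e1 s h) (ev e2 s h).
exists (upd m2 (nvar + d) v); split.
+ rewrite !size_cat /= !addnA; apply: (steps_trans (steps_trans s1 s2)).
  apply: steps1; rewrite addn1 /step c3.
  have vW : v < W.
    apply: (@ltW _ (leaves e1 + leaves e2)); last lia.
    by have := @ev_bound s h (Bin o e1 e2) bd; rewrite /= wf1 wf2 => /(_ isT).
  rewrite /v in vW *.
  by case: o vW {ca c3} @v; rewrite /= f2 // v1 v2 => ->.
+ by apply: matches_tmp => //; rewrite /ntmp; lia.
+ by rewrite upd_eq.
+ by move=> j Hj; rewrite upd_neq ?f2 ?f1 //; lia.
Qed.

Lemma exec_bounded c s h t s' h' : exec c s h t s' h' -> bounded s h -> bounded s' h'.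
Proof.
move=> H; elim: H => //; try by auto.
  move=> x e {}s {}h lt [b1 b2]; split=> // y.
  by rewrite /upd; case: ifP.
move=> e1 e2 {}s {}h _ lt [b1 b2]; split=> // y.
by rewrite /upd; case: ifP.
Qed.

Lemma cexp0_ok s h e p m : bounded s h -> matches m s h -> oke e ->
  code_at p (cexp e 0) ->
  exists m', [/\ steps (size (cexp e 0)) p m (p + size (cexp e 0)) m',
    matches m' s h & m' nvar = ev e s h].
Proof.
move=> bd mt /andP[wf ll] ca.
have [||m' [H1 H2 H3 _]] := cexp_ok bd mt wf _ _ ca; try lia.
by exists m'; rewrite addn0 in H3.
Qed.

(** One unit of abstract time pays for one passage through the code of an assignment, a store or a
    test with its jumps, which is no longer than the command itself. Sequencing costs nothing and
    emits nothing. *)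
Lemma ccom_ok K c s h t s' h' p m : exec c s h t s' h' -> okc c -> csize c <= K ->
  bounded s h -> matches m s h -> code_at p (ccom c p) ->
  exists k m', [/\ steps k p m (p + csize c) m', matches m' s' h' & k <= t * K].
Proof.
move=> H; elim: H p m => {c s h t s' h'}.
- move=> s h p m _ _ _ mt _; exists 0, m; split=> //.
  by rewrite addn0; constructor.
- move=> x e s h lt p m /= /andP[xv oe] le bd mt.
  case/code_at_cat=> ca /code_at_cons[c1 /code_at_cons[c2 _]].
  have [m1 [s1 mt1 v1]] := cexp0_ok bd mt oe ca.
  set m2 := upd m1 (nvar + 1) 0.
  exists (size (cexp e 0) + 2), (upd m2 x (ev e s h)); split.
  + rewrite addnA; apply: (steps_trans s1); apply: (@stepsS _ _ _ _ m2).
      by rewrite /step c1 (@ltW _ 1) // expn1; lia.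
    apply: steps1; rewrite /step c2 !addn2.
    have -> : m2 nvar = ev e s h by rewrite /m2 upd_neq.
    have -> : m2 (nvar + 1) = 0 by rewrite /m2 upd_eq.
    by rewrite addn0 (@ltW _ 1) // expn1.
  + have [n1 n2] := matches_tmp 0 mt1 (isT : 1 < ntmp); split=> [y yv|a].
      by rewrite /upd; case: eqP => // _; apply: n1.
    by rewrite upd_neq ?n2 // /hbase; rewrite /nvar in xv; lia.
  + by rewrite mul1n.
- move=> e1 e2 s h lt1 lt2 p m /= /andP[oe1 oe2] le bd mt.
  case/code_at_cat=> ca1 /code_at_cons[c1 /code_at_cons[c2]].
  case/code_at_cat=> ca2 /code_at_cons[c3 _].
  have [m1 [s1 mt1 v1]] := cexp0_ok bd mt oe1 ca1.
  set m2 := upd m1 (nvar + 1) hbase.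
  set m3 := upd m2 nvar (hbase + ev e1 s h).
  have mt3 : matches m3 s h.
    have := matches_tmp (hbase + ev e1 s h) (matches_tmp hbase mt1 (isT : 1 < ntmp)) (isT : 0 < ntmp).
    by rewrite addn0.
  case/andP: oe2 => wf2 ll2.
  have [||m4 [s4 mt4 v4 f4]] := cexp_ok bd mt3 wf2 _ _ ca2; try lia.
  have := f4 0 isT; rewrite addn0 [m3 nvar]upd_eq => v5.
  exists (size (cexp e1 0) + 2 + (size (cexp e2 1) + 1)),
    (upd m4 (hbase + ev e1 s h) (ev e2 s h)); split.
  + apply: (@steps_trans _ _ _ (p + size (cexp e1 0)).+2 m3).
      apply: (steps_trans s1); apply: (@stepsS _ _ _ _ m2).
        by rewrite /step c1 (@ltW _ 1) // expn1.
      have g1 : m2 nvar = ev e1 s h by rewrite /m2 upd_neq.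
      have g2 : m2 (nvar + 1) = hbase by rewrite /m2 upd_eq.
      apply: steps1; rewrite /step c2 g1 g2 addnC (@ltW_heap _ 1) ?expn1 //.
    apply: (steps_trans s4); apply: steps1.
    rewrite /step c3 v5 v4 (@ltW _ 1) ?expn1 //.
    by congr ONext; lia.
  + have [n1 n2] := mt4; split=> [y yv|a].
      by rewrite upd_neq ?n1 // /hbase; rewrite /nvar in yv; lia.
    by rewrite /upd eqn_add2l; case: eqP.
  + by rewrite mul1n; lia.
- move=> c1 c2 s h t1 s1 h1 t2 s2 h2 E1 IH1 E2 IH2 p m /= /andP[o1 o2] le bd mt.
  case/code_at_cat=> ca1; rewrite size_ccom => ca2.
  have [|k1 [m1 [S1 M1 T1]]] := IH1 p m o1 _ bd mt ca1; first by lia.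
  have [|k2 [m2 [S2 M2 T2]]] := IH2 _ m1 o2 _ (exec_bounded E1 bd) M1 ca2; first by lia.
  exists (k1 + k2), m2; split=> //; last by rewrite mulnDl leq_add.
  by rewrite addnA; apply: steps_trans S1 S2.
- move=> e c1 c2 s h t s1 h1 E1 IH p m /= /and3P[oe o1 o2] le bd mt.
  case/code_at_cat=> ca /code_at_cons[cj].
  case/code_at_cat; rewrite -[X in code_at X _]addn1 => ca1.
  case/code_at_cons; rewrite size_ccom -[X in nth _ _ (X + _)]addn1.
  rewrite -[X in code_at X _]addn1 -[X in code_at (X + _ + _) _]addn1 => cj2 ca2.
  have [m1 [S1 mt1 v1]] := cexp0_ok bd mt oe ca.
  case: eqP E1 IH => [e0|/eqP e0] E1 IH.
    have [|k [m2 [S2 M2 T2]]] := IH _ m1 o2 _ bd mt1 ca2; first by lia.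
    exists (size (cexp e 0) + 1 + k), m2; split; [|by []|by rewrite mulSn; lia].
    apply: (@steps_trans _ _ _ (p + size (cexp e 0) + 1 + csize c1 + 1) m1).
      apply: (steps_trans S1); apply: steps1.
      by rewrite /step cj v1 e0.
    have -> // : p + (size (cexp e 0) + 2 + csize c1 + csize c2) =
      p + size (cexp e 0) + 1 + csize c1 + 1 + csize c2 by lia.
  have [|k [m2 [S2 M2 T2]]] := IH _ m1 o1 _ bd mt1 ca1; first by lia.
  exists (size (cexp e 0) + 1 + k + 1), m2; split; [|by []|by rewrite mulSn; lia].
  apply: (@steps_trans _ _ _ (p + size (cexp e 0) + 1 + csize c1) m2).
    apply: (@steps_trans _ _ _ (p + size (cexp e 0) + 1) m1) => //.
    apply: (steps_trans S1); apply: steps1.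
    by rewrite /step cj v1 (negbTE e0) addn1.
  apply: steps1; rewrite /step cj2; congr ONext; lia.
- move=> e c s h e0 p m /= /andP[oe o1] le bd mt.
  case/code_at_cat=> ca /code_at_cons[cj _].
  have [m1 [S1 mt1 v1]] := cexp0_ok bd mt oe ca.
  exists (size (cexp e 0) + 1), m1; split=> //; last by lia.
  apply: (steps_trans S1); apply: steps1.
  rewrite /step cj v1 e0; congr ONext; lia.
move=> e c s h t1 s1 h1 t2 s2 h2 e0 E1 IH1 E2 IH2 p m ok le bd mt caw.
have /= /andP[oe o1] := ok.
have /= /code_at_cat[ca /code_at_cons[cj]] := caw.
case/code_at_cat; rewrite -[X in code_at X _]addn1 => ca1.
case/code_at_cons; rewrite size_ccom -[X in nth _ _ (X + _)]addn1 => cj2 _.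
have [m1 [S1 mt1 v1]] := cexp0_ok bd mt oe ca.
rewrite /= in le.
have [|k1 [m2 [S2 M2 T1]]] := IH1 _ m1 o1 _ bd mt1 ca1; first by lia.
have [//|k2 [m3 [S3 M3 T2]]] := IH2 _ m2 ok _ (exec_bounded E1 bd) M2 caw.
exists (size (cexp e 0) + 1 + k1 + 1 + k2), m3; split=> //; last first.
  by rewrite mulSn mulnDl; lia.
apply: (steps_trans _ S3).
apply: (@steps_trans _ _ _ (p + size (cexp e 0) + 1 + csize c) m2).
  apply: (@steps_trans _ _ _ (p + size (cexp e 0) + 1) m1) => //.
  apply: (steps_trans S1); apply: steps1.
  by rewrite /step cj v1 (negbTE e0) addn1.
by apply: steps1; rewrite /step cj2.
Qed.

End Language.

(** * Weakest preconditions *)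

Section WeakestPre.

Variable B : nat.

(** Total correctness within a time budget. Existence of a run is enough, since [ccom_ok] turns any
    run of the source into a run of the machine. *)
Definition wp c (t : nat) (Q : store -> store -> Prop) s h :=
  exists t' s' h', [/\ exec B c s h t' s' h', t' <= t & Q s' h'].

Lemma wp_conseq c t t' (Q Q' : store -> store -> Prop) s h :
  wp c t Q s h -> t <= t' -> (forall s' h', Q s' h' -> Q' s' h') -> wp c t' Q' s h.
Proof.
move=> [t1 [s1 [h1 [E le q]]]] tt QQ.
by exists t1, s1, h1; split; [|apply: leq_trans le tt|apply: QQ].
Qed.

Lemma wp_time c t t' Q s h : wp c t Q s h -> t <= t' -> wp c t' Q s h.
Proof. by move=> H le; apply: wp_conseq H le _. Qed.

Lemma wp_skip t (Q : store -> store -> Prop) s h : Q s h -> wp Skip t Q s h.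
Proof. by move=> q; exists 0, s, h; split=> //; constructor. Qed.

Lemma wp_seq c1 c2 t1 t2 t Q s h : wp c1 t1 (wp c2 t2 Q) s h -> t1 + t2 <= t ->
  wp (Seq c1 c2) t Q s h.
Proof.
move=> [t1' [s1 [h1 [E1 l1 [t2' [s2 [h2 [E2 l2 q]]]]]]]] le.
exists (t1' + t2'), s2, h2; split=> //; first exact: XSeq E1 E2.
by apply: leq_trans le; apply: leq_add.
Qed.

Lemma wp_asn x e t (Q : store -> store -> Prop) s h : ev e s h < B ->
  (forall v, v = ev e s h -> Q (upd s x v) h) -> wp (Asn x e) t.+1 Q s h.
Proof.
by move=> lt q; exists 1, (upd s x (ev e s h)), h; split=> //; [constructor|apply: q].
Qed.

Lemma wp_sto e1 e2 t (Q : store -> store -> Prop) s h : ev e1 s h < B -> ev e2 s h < B ->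
  Q s (upd h (ev e1 s h) (ev e2 s h)) -> wp (Sto e1 e2) t.+1 Q s h.
Proof.
by move=> l1 l2 q; exists 1, s, (upd h (ev e1 s h) (ev e2 s h)); split=> //; constructor.
Qed.

Lemma wp_seq_asn x e c t Q s h : ev e s h < B ->
  (forall v, v = ev e s h -> wp c t Q (upd s x v) h) ->
  wp (Seq (Asn x e) c) t.+1 Q s h.
Proof. by move=> lt H; apply: (@wp_seq _ _ 1 t) => //; apply: wp_asn. Qed.

Lemma wp_if e c1 c2 t Q s h :
  (ev e s h != 0 -> wp c1 t Q s h) -> (ev e s h = 0 -> wp c2 t Q s h) ->
  wp (If e c1 c2) t.+1 Q s h.
Proof.
move=> H1 H2.
have [t' [s1 [h1 [E le q]]]] : wp (if ev e s h == 0 then c2 else c1) t Q s h.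
  by case: eqP => [/H2//|/eqP/H1].
by exists t'.+1, s1, h1; split=> //; constructor.
Qed.

Lemma wp_while e c t (I : nat -> store -> store -> Prop) (Q : store -> store -> Prop)
    k s h :
  I k s h -> (forall j s h, I j s h -> ev e s h = 0 -> Q s h) ->
  (forall j s h, I j s h -> ev e s h != 0 ->
     exists2 j', j = j'.+1 & wp c t (I j') s h) ->
  wp (While e c) (k * t.+1 + 1) Q s h.
Proof.
move=> Hi HQ HS; elim/ltn_ind: k s h Hi => k IH s h Hi.
case: (eqVneq (ev e s h) 0) => e0.
  by exists 1, s, h; split; [exact: XWhile0|lia|apply: HQ Hi e0].
have [j' kj [t1 [s1 [h1 [E1 l1 q1]]]]] := HS _ _ _ Hi e0.
have [|t2 [s2 [h2 [E2 l2 q2]]]] := IH j' _ s1 h1 q1; first by rewrite kj.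
exists (t1 + t2).+1, s2, h2; split=> //; first exact: XWhileS e0 E1 E2.
by rewrite kj mulSn; lia.
Qed.

(** Truncated subtraction replaces comparison throughout: [e -e x] is nonzero exactly when x < e,
    and [e +e Cst 1 -e x] exactly when x <= e. *)
Definition For x e c :=
  Seq (Asn x (Cst 0)) (While (Bin Osub e (Var x))
    (Seq c (Asn x (Bin Oadd (Var x) (Cst 1))))).

Lemma wp_for x e c n (t : nat -> nat) (I : nat -> store -> store -> Prop)
    (Q : store -> store -> Prop) s h :
  n < B -> I 0 (upd s x 0) h ->
  (forall i s h, i <= n -> I i s h -> s x = i -> ev e s h = n) ->
  (forall i s h, i < n -> I i s h -> s x = i ->
     wp c (t i) (fun s' h' => s' x = i /\ I i.+1 (upd s' x i.+1) h') s h) ->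
  (forall s h, I n s h -> Q s h) ->
  wp (For x e c) (\sum_(i < n) (t i + 2) + 2) Q s h.
Proof.
move=> nB I0 He Hc HQ.
pose J i (s h : store) := I i s h /\ s x = i.
have main : forall k i s h, i + k = n -> J i s h ->
    exists t' s' h', [/\ exec B (While (Bin Osub e (Var x))
      (Seq c (Asn x (Bin Oadd (Var x) (Cst 1))))) s h t' s' h',
      t' <= \sum_(i <= j < n) (t j + 2) + 1 & Q s' h'].
  elim=> [|k IH] i s1 h1 ik [Hi xi].
    rewrite addn0 in ik; rewrite ik in Hi xi; exists 1, s1, h1.
    split; [|lia|exact: HQ].
    by apply: XWhile0; rewrite /= (He n) // xi subnn.
  have iltn : i < n by lia.
  have [t1 [s2 [h2 [E1 l1 [x2 I2]]]]] := Hc _ _ _ iltn Hi xi.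
  have [||t2 [s3 [h3 [E2 l2 q]]]] := IH i.+1 (upd s2 x i.+1) h2; first lia.
    by split=> //; rewrite /upd eqxx.
  exists (t1 + 1 + t2).+1, s3, h3; split=> //.
    apply: XWhileS E2; first by rewrite /= (He i) ?xi //; lia.
    apply: (XSeq E1).
    have /= -> : upd s2 x i.+1 = upd s2 x (ev (Bin Oadd (Var x) (Cst 1)) s2 h2).
      by rewrite /= x2 addn1.
    by constructor; rewrite /= x2; lia.
  by rewrite big_ltn //; lia.
have J0 : J 0 (upd s x 0) h by split=> //; rewrite /upd eqxx.
have [//|t' [s' [h' [E le q]]]] := main n 0 _ _ _ J0.
exists (1 + t'), s', h'; split=> //; last by rewrite big_mkord in le; lia.
by apply: XSeq E; apply: (@XAsn _ _ (Cst 0)); apply: leq_ltn_trans nB.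
Qed.

Lemma wp_for_unif x e c n (t : nat) (I : nat -> store -> store -> Prop)
    (Q : store -> store -> Prop) s h :
  n < B -> I 0 (upd s x 0) h ->
  (forall i s h, i <= n -> I i s h -> s x = i -> ev e s h = n) ->
  (forall i s h, i < n -> I i s h -> s x = i ->
     wp c t (fun s' h' => s' x = i /\ I i.+1 (upd s' x i.+1) h') s h) ->
  (forall s h, I n s h -> Q s h) ->
  wp (For x e c) (n * (t + 2) + 2) Q s h.
Proof.
move=> nB I0 He Hc HQ; have := wp_for nB I0 He Hc HQ.
by rewrite sum_nat_const card_ord.
Qed.

End WeakestPre.

(** * Freeing the registers from the input *)

Section Prologue.

(* Only cells 0 and 1 are free at the start: the first elements of the input
   are moved to the cells from [80 * (u + n) - 1] on, which frees the registers. *)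
Definition prologue_head := [:: IAdd 1 1 0; IStore 1 2; IConst 2 80; IMul 2 2 1;
  IStore 2 3; IConst 3 1; ISub 2 2 3; ILoad 3 1; IStore 2 3; IConst 3 0;
  IStore 1 3; IConst 3 1; IAdd 2 2 3].

Definition prologue_tail k :=
  flatten [seq [:: IAdd 2 2 3; IStore 2 (j + 4)] | j <- iota 0 k].

Definition prologue := prologue_head ++ prologue_tail 76.

Variables (P : seq instr) (W u : nat) (s : seq nat).
Hypotheses (u2 : 2 <= u) (n2 : 2 <= size s) (su : all (leq^~ u) s).
Hypothesis HW : 80 * (u + size s) + 200 < W.
Hypothesis HP : code_at P 0 prologue.

Let n := size s.
Let base := 80 * (u + n) - 1.

Definition relocated k (m : memory) := [/\ m 0 = u, m 1 = n + u, m 2 = base + 1 + k, m 3 = 1 &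
  forall x, 4 <= x -> m x = if base <= x <= base + 1 + k then nth 0 s (x - base)
    else init_mem u s x].

Lemma nth_le j : nth 0 s j <= u.
Proof.
by case: (ltnP j (size s)) => H; [apply: (allP su); rewrite mem_nth|rewrite nth_default].
Qed.

(** Cell [n + u] lies past the input because u >= 2, so it can park the first element while cell 2
    becomes a pointer. It is cleared afterwards, which restores the 0 that the input encoding has
    there. *)
Lemma prologue_head_ok : exists2 m, steps P W 13 0 (init_mem u s) 13 m & relocated 0 m.
Proof.
have cc : forall i, i < 13 -> nth IHalt P i = nth IHalt prologue_head i.
  move=> i Hi; have := @HP i; rewrite add0n /prologue nth_cat Hi => -> //.
  by rewrite size_cat ltn_addr.
have i0 : init_mem u s 0 = u by [].
have i1 : init_mem u s 1 = n by [].
have ix x : 2 <= x -> init_mem u s x = nth 0 s (x - 2) by case: x => [|[|x]].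
have Lu : u < W by lia. have Ln : n + u < W by rewrite /n; lia.
have L0 : forall j, nth 0 s j < W by move=> j; apply: leq_ltn_trans (nth_le j) Lu.
have Lb : 80 * (n + u) < W by rewrite /n; lia.
have Lb1 : 80 * (n + u) - 1 < W by rewrite /n; lia.
have h80 : 80 < W by lia. have h1 : 1 < W by lia. have h0 : 0 < W by lia.
have nu4 : 4 <= n + u by rewrite /n; lia.
pose b := 80 * (n + u).
have Ltb : b - 1 + 1 < W by rewrite /b /n; lia.
have Eb : b - 1 = base by rewrite /b /base /n; lia.
pose m1 := upd (init_mem u s) 1 (n + u).
pose m2 := upd m1 (n + u) (nth 0 s 0).
pose m3 := upd m2 2 80.
pose m4 := upd m3 2 b.
pose m5 := upd m4 b (nth 0 s 1).
pose m6 := upd m5 3 1.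
pose m7 := upd m6 2 (b - 1).
pose m8 := upd m7 3 (nth 0 s 0).
pose m9 := upd m8 (b - 1) (nth 0 s 0).
pose m10 := upd m9 3 0.
pose m11 := upd m10 (n + u) 0.
pose m12 := upd m11 3 1.
pose m13 := upd m12 2 (b - 1 + 1).
have nb k : k <= 3 -> ((k == n + u) = false) * ((k == b) = false) * ((k == b - 1) = false).
  by rewrite /b => k3; split; [split|]; apply/negbTE/eqP; lia.
have nbn : ((n + u == b) = false) * ((n + u == b - 1) = false).
  by rewrite /b; split; apply/negbTE/eqP; lia.
have x2 : init_mem u s 2 = nth 0 s 0 by [].
have x3 : init_mem u s 3 = nth 0 s 1 by [].
have n1n : (n + u == 1) = false by apply/negbTE/eqP; lia.
have n2n : (n + u == 2) = false by apply/negbTE/eqP; lia.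
have n3n : (n + u == 3) = false by apply/negbTE/eqP; lia.
pose simpl_upd := (nb 0 isT, nb 1 isT, nb 2 isT, nb 3 isT, nbn, n1n, n2n, n3n, eqxx).
exists m13; last first.
  split; try by rewrite /m13 /m12 /m11 /m10 /m9 /m8 /m7 /m6 /m5 /m4 /m3 /m2 /m1 /upd
    !simpl_upd /= ?simpl_upd ?addn0 ?Eb.
  move=> x x4.
  rewrite /m13 /m12 /m11 /m10 /m9 /m8 /m7 /m6 /m5 /m4 /m3 /m2 /m1 /upd.
  have -> : (x == 1) = false by apply/negbTE/eqP; lia.
  have -> : (x == 2) = false by apply/negbTE/eqP; lia.
  have -> : (x == 3) = false by apply/negbTE/eqP; lia.
  case: (eqVneq x (n + u)) => [->|_].
    have -> : (base <= n + u <= base + 1 + 0) = false.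
      by rewrite /base /n; apply/negbTE/negP; lia.
    by rewrite ix ?nth_default; rewrite /n in nu4 *; lia.
  rewrite addn0 Eb; case: (eqVneq x base) => [->|xb].
    by rewrite subnn ifT //; lia.
  case: (eqVneq x b) => [->|xb'].
    by rewrite ifT -Eb; [congr (nth _ _ _)|]; rewrite /b; lia.
  by rewrite ifF //; apply/negbTE/negP; rewrite -Eb in xb *; move: xb xb'; rewrite /b; lia.
have st p (q m' : memory) : step P W p q = ONext p.+1 m' -> step P W p q = ONext p.+1 m' by [].
apply: (@stepsS _ _ _ _ _ 1 m1); first by rewrite /step cc //= i0 i1 Ln.
apply: (@stepsS _ _ _ _ _ 2 m2).
  by rewrite /step cc //= /m1 /upd /= L0.
apply: (@stepsS _ _ _ _ _ 3 m3); first by rewrite /step cc //= h80.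
apply: (@stepsS _ _ _ _ _ 4 m4).
  have g1 : m3 1 = n + u by rewrite /m3 /m2 /m1 /upd /= !simpl_upd.
  by rewrite /step cc //= g1 (_ : m3 2 = 80) // Lb.
apply: (@stepsS _ _ _ _ _ 5 m5).
  have g1 : m4 3 = nth 0 s 1 by rewrite /m4 /m3 /m2 /m1 /upd /= !simpl_upd.
  by rewrite /step cc //= g1 (_ : m4 2 = b) // L0.
apply: (@stepsS _ _ _ _ _ 6 m6); first by rewrite /step cc //= h1.
apply: (@stepsS _ _ _ _ _ 7 m7).
  rewrite /step cc //=.
  have -> : m6 2 = b by rewrite /m6 /m5 /m4 /upd /= !simpl_upd.
  by have -> : m6 3 = 1 by []; rewrite Lb1.
apply: (@stepsS _ _ _ _ _ 8 m8).
  rewrite /step cc //=.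
  have -> : m7 1 = n + u by rewrite /m7 /m6 /m5 /m4 /m3 /m2 /m1 /upd /= !simpl_upd.
  have -> : m7 (n + u) = nth 0 s 0.
    by rewrite /m7 /m6 /m5 /m4 /m3 /m2 /m1 /upd /= !simpl_upd.
  by rewrite L0.
apply: (@stepsS _ _ _ _ _ 9 m9).
  rewrite /step cc //=.
  have -> : m8 2 = b - 1 by [].
  have -> : m8 3 = nth 0 s 0 by [].
  by rewrite L0.
apply: (@stepsS _ _ _ _ _ 10 m10); first by rewrite /step cc //= h0.
apply: (@stepsS _ _ _ _ _ 11 m11).
  rewrite /step cc //=.
  have -> : m10 3 = 0 by [].
  have -> : m10 1 = n + u.
    by rewrite /m10 /m9 /m8 /m7 /m6 /m5 /m4 /m3 /m2 /m1 /upd /= !simpl_upd.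
  by rewrite h0.
apply: (@stepsS _ _ _ _ _ 12 m12); first by rewrite /step cc //= h1.
apply: steps1; rewrite /step cc //=.
have -> : m12 3 = 1 by [].
have -> : m12 2 = b - 1.
  by rewrite /m12 /m11 /m10 /m9 /m8 /m7 /upd /= !simpl_upd.
by rewrite Ltb.
Qed.

Lemma size_tail k : size (prologue_tail k) = 2 * k.
Proof.
have H a : size (flatten [seq [:: IAdd 2 2 3; IStore 2 (j + 4)] | j <- iota a k]) = 2 * k.
  by elim: k a => //= k IH a; rewrite IH; lia.
exact: H.
Qed.

Lemma prologue_tail_ok k : k <= 76 -> forall m, relocated 0 m ->
  exists2 m', steps P W (2 * k) 13 m (13 + 2 * k) m' & relocated k m'.
Proof.
elim: k => [|k IH] k76 m r0; first by exists m => //; constructor.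
have [m1 S1 [a0 a1 a2 a3 ax]] := IH (ltnW k76) m r0.
have [|_ ct] := @code_at_cat P 0 prologue_head (prologue_tail 76); first exact: HP.
have e76 : prologue_tail 76 = prologue_tail k ++ [:: IAdd 2 2 3; IStore 2 (k + 4)] ++
    flatten [seq [:: IAdd 2 2 3; IStore 2 (j + 4)] | j <- iota k.+1 (75 - k)].
  rewrite /prologue_tail -[[:: _; _]]/(flatten [seq [:: IAdd 2 2 3; IStore 2 (j + 4)] | j <- [:: k]]).
  rewrite -!flatten_cat -!map_cat; congr (flatten (map _ _)).
  have -> : 76 = k + (1 + (75 - k)) by lia.
  by rewrite iotaD /= add0n; congr (_ ++ _ :: iota _ _); lia.
rewrite e76 in ct; have [_ /code_at_cat[]] := code_at_cat ct.
rewrite size_tail => /code_at_cons[c1 /code_at_cons[c2 _]] _.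
rewrite add0n in c1 c2.
have bn : n + u + 80 < base by rewrite /base /n; lia.
set m2 := upd m1 2 (base + 1 + k.+1).
exists (upd m2 (base + 1 + k.+1) (nth 0 s k.+2)).
  rewrite mulnS addnC; apply: (steps_trans S1); apply: (@stepsS _ _ _ _ _ (13 + 2 * k).+1 m2).
    rewrite /step c1 a2 a3 (_ : base + 1 + k + 1 = base + 1 + k.+1); last by lia.
    by rewrite ifT // /base /n; lia.
  apply: steps1; rewrite /step c2.
  have -> : m2 2 = base + 1 + k.+1 by [].
  have -> : m2 (k + 4) = nth 0 s k.+2.
    rewrite /m2 upd_neq; last by lia.
    rewrite ax; last by lia.
    rewrite ifF; last by apply/negbTE/negP; lia.
    have -> : k + 4 = k.+2.+2 by lia.
    by [].
  have -> : nth 0 s k.+2 < W by apply: leq_ltn_trans (nth_le _) _; lia.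
  congr ONext; lia.
have fr x : x < 4 -> upd m2 (base + 1 + k.+1) (nth 0 s k.+2) x = m2 x.
  by move=> x4; rewrite upd_neq //; lia.
split; rewrite ?fr //.
move=> x x4; rewrite /upd; case: (eqVneq x (base + 1 + k.+1)) => [->|xn].
  by rewrite ifT; [congr nth|]; lia.
rewrite /m2 upd_neq ?ax //; last by lia.
have -> : (base <= x <= base + 1 + k.+1) = (base <= x <= base + 1 + k) by lia.
by [].
Qed.

Lemma prologue_ok : exists2 m, steps P W 165 0 (init_mem u s) 165 m & relocated 76 m.
Proof.
have [m S R] := prologue_head_ok.
have [//|m' S' R'] := @prologue_tail_ok 76 _ m R.
by exists m' => //; apply: (steps_trans S S').
Qed.

End Prologue.

(** Element j starts in machine cell j + 2 and the heap starts at cell 80. Elements from 78 on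
    therefore stay in place as heap cells j - 78, while the first 78, which occupied registers, are
    found in the relocated block. *)
Lemma compile_run (main : com) : exists (P : seq instr) (K : nat), forall B W u s t Q,
  okc B main -> 80 * (u + u + 1) + 200 < B -> B ^ 16 <= W ->
  2 <= u -> 2 <= size s -> size s <= u.+1 -> all (leq^~ u) s ->
  (forall s0 h0, s0 0 = u -> s0 1 = u + size s ->
     (forall j, j < size s -> h0 (if j < 78 then 80 * (u + size s) - 81 + j else j - 78)
          = nth 0 s j) -> wp B main t Q s0 h0) ->
  exists m' s' h', [/\ run P W (t.+1 * K) 0 (init_mem u s) = Some m', Q s' h',
     m' 0 = s' 0 & forall a, m' (hbase + a) = h' a].
Proof.
(* The extra unit in [t.+1] pays for the 165 = 13 + 2 * 76 instructions of the prologue. *)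
exists (prologue ++ ccom main 165), (165 + csize main) => B W u s t Q ok HB WB u2 n2 nu su Hw.
set P := prologue ++ _.
have szp : size prologue = 165 by [].
have BW : B <= W by apply: leq_trans WB; rewrite -{1}(expn1 B) leq_pexp2l //; lia.
have HP : code_at P 0 prologue by move=> i Hi; rewrite add0n nth_cat Hi.
have [|m0 S0 [a0 a1 a2 a3 ax]] := @prologue_ok P W u s u2 n2 su _ HP; first by lia.
have hbB : hbase < B by rewrite /hbase; lia.
have HC : code_at P 165 (ccom main 165).
  by move=> i Hi; rewrite /P nth_cat szp (_ : (165 + i < 165) = false) ?addKn //; lia.
pose s0 x := if x < nvar then m0 x else 0.
pose h0 a := m0 (hbase + a).
have base_gt : 200 + u + size s < 80 * (u + size s) - 1 by lia.
have init_le x : init_mem u s x < B.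
  rewrite /init_mem; case: ifP => _; first lia.
  case: ifP => _; first lia.
  by case: ifP => _; [apply: leq_ltn_trans (nth_le su _) _|]; lia.
have m0B x : m0 x < B.
  case: (ltnP x 4) => x4; last first.
    by rewrite ax //; case: ifP => _ //; apply: leq_ltn_trans (nth_le su _) _; lia.
  by case: x x4 => [|[|[|[|//]]]] _; lia.
have bd : bounded B s0 h0.
  by split=> x; rewrite /s0 /h0 //; case: ifP => // _; lia.
have mt : matches m0 s0 h0 by split=> // x Hx; rewrite /s0 Hx.
have [||j Hj|t' [s' [h' [E le q]]]] := Hw s0 h0.
- by rewrite /s0 a0.
- by rewrite /s0 a1 addnC.
- rewrite /h0 /hbase ax; last by lia.
  case: (ltnP j 78) => j78.
    by rewrite ifT; [congr nth|]; lia.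
  rewrite ifF; last by apply/negbTE/negP; lia.
  have -> : 80 + (j - 78) = j.+2 by lia.
  by rewrite /init_mem /= !subSS subn0.
have [k [m' [S1 [M1 M2] le1]]] := @ccom_ok B P W hbB WB (csize main) _ _ _ _ _ _ _ _ E ok (leqnn _) bd mt HC.
exists m', s', h'; split=> //; last by rewrite M1.
(* The program stops by running off its end, where the default of [nth] is [IHalt]. *)
apply: (steps_run (steps_trans S0 S1)).
  by rewrite nth_default // size_cat szp size_ccom.
rewrite mulSn; apply: leq_trans (leq_add (leqnn _) le1) _.
have : t' * csize main <= t * (165 + csize main) by apply: leq_mul => //; lia.
lia.
Qed.

(** * The discrete Fourier transform *)

(* The butterfly at offset [h] pairs [a*2h + t] with [a*2h + t + h]. *)
Lemma half_split h p : (0 < h)%N -> exists a t, [/\ (t < h)%N,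
  p = (a * (h * 2) + odd (p %/ h) * h + t)%N, (p %/ (h * 2))%N = a &
  (p %/ h = a * 2 + odd (p %/ h))%N].
Proof.
move=> h0; exists (p %/ (h * 2))%N, (p %% h)%N; split=> //; first exact: ltn_pmod.
  rewrite {1}(divn_eq p h) {1}(divn_eq (p %/ h) 2) -modn2 -divnMA; nia.
by rewrite divnMA -modn2 -divn_eq.
Qed.

Lemma divh a b t h : (t < h)%N -> ((a * (h * 2) + b * h + t) %/ h = a * 2 + b)%N.
Proof.
move=> th; rewrite (_ : (a * (h * 2) + b * h + t = (a * 2 + b) * h + t)%N); last by nia.
by rewrite divnMDl ?divn_small ?addn0 //; case: h th.
Qed.

Lemma div2h a (b : bool) t h : (t < h)%N -> ((a * (h * 2) + b * h + t) %/ (h * 2) = a)%N.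
Proof.
move=> th; rewrite -addnA divnMDl; last by lia.
by rewrite divn_small ?addn0 //; case: b; lia.
Qed.

Lemma oddh a (b : bool) t h : (t < h)%N -> odd ((a * (h * 2) + b * h + t) %/ h) = b.
Proof. by move=> th; rewrite divh // oddD oddM andbF /=; case: b. Qed.

Lemma mod2h a (b : bool) t h : (t < h)%N ->
  ((a * (h * 2) + b * h + t) %% (h * 2) = b * h + t)%N.
Proof. by move=> th; rewrite -addnA modnMDl modn_small //; case: b; lia. Qed.

Lemma modh a b t h : (t < h)%N -> ((a * (h * 2) + b * h + t) %% h = t)%N.
Proof.
move=> th; rewrite (_ : (a * (h * 2) + b * h + t = (a * 2 + b) * h + t)%N); last by nia.
by rewrite modnMDl modn_small.
Qed.

Lemma block_lt M p h : (0 < h)%N -> (h * 2 %| M)%N -> (p < M)%N ->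
  ((p %/ (h * 2)).+1 * (h * 2) <= M)%N.
Proof.
move=> h0 /dvdnP[q ->] pM; rewrite leq_mul2r ltn_divLR ?pM ?orbT //; lia.
Qed.

Section ExactFFT.
Local Open Scope ring_scope.
Import GRing.Theory.

Variables (C : comNzRingType) (m : nat) (z y : nat -> C).
Let M := (2 ^ m)%N.

(** Splits a remainder modulo x^(2h) - z^2 into those modulo x^h - z and x^h + z. The root depends
    only on the number of the block, neither on the stage nor on the length, so one table serves all
    transforms. The output order is bit-reversed, which is harmless: squaring is pointwise and the
    inverse stages undo the order. *)
Definition fwd_stage h (X : nat -> C) p :=
  if odd (p %/ h) then X (p - h)%N - z (p %/ (h * 2)) * X p
  else X p + z (p %/ (h * 2)) * X (p + h)%N.

Definition inv_stage h (X : nat -> C) p :=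
  if odd (p %/ h) then y (p %/ (h * 2)) * (X (p - h)%N - X p)
  else X p + X (p + h)%N.

Fixpoint fwd k f := if k is k'.+1 then fwd_stage (2 ^ (m - k)) (fwd k' f) else f.

Fixpoint bwd k X := if k is k'.+1 then inv_stage (2 ^ k') (bwd k' X) else X.

Lemma inv_stage_ext h X X' : (0 < h)%N -> (h * 2 %| M)%N ->
  (forall p, (p < M)%N -> X p = X' p) ->
  forall p, (p < M)%N -> inv_stage h X p = inv_stage h X' p.
Proof.
move=> h0 hM XX p pM; rewrite /inv_stage; have := block_lt h0 hM pM.
have [a [t [th ep ea _]]] := half_split p h0.
rewrite ea mulSn => lt; case: ifP => od; rewrite od in ep;
  by rewrite !XX //; lia.
Qed.

(** The butterfly is inverted without halving. The accumulated factor 2^m is never removed, because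
    only zero and nonzero have to be told apart. *)
Lemma inv_stageK h X p : (0 < h)%N -> z (p %/ (h * 2)) * y (p %/ (h * 2)) = 1 ->
  inv_stage h (fwd_stage h X) p = X p *+ 2.
Proof.
move=> h0 zy; rewrite /inv_stage /fwd_stage.
have [a [t [th ep ea _]]] := half_split p h0.
case: ifP => od; rewrite od in ep.
  rewrite !ea in zy *.
  have -> : (p - h = a * (h * 2) + false * h + t)%N by lia.
  rewrite !oddh // !div2h //.
  have -> : (a * (h * 2) + false * h + t + h = p)%N by lia.
  transitivity ((z a * y a) * (X p *+ 2)); last by rewrite zy mul1r.
  by rewrite od mulr2n; ring.
rewrite od !ea.
have -> : (p + h = a * (h * 2) + true * h + t)%N by lia.
rewrite !oddh // !div2h //.
have -> : (a * (h * 2) + true * h + t - h = p)%N by lia.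
by rewrite mulr2n; ring.
Qed.

Lemma inv_stageMn h X c p :
  inv_stage h (fun p => X p *+ c) p = inv_stage h X p *+ c.
Proof. by rewrite /inv_stage; case: ifP; rewrite -?mulrnBl -?mulrnDl ?mulrnAr. Qed.

Variable w : nat -> C.
Hypothesis zw : forall j, (j < 2 ^ m.-1)%N -> z j ^+ 2 = w j.
Hypothesis w0 : forall j, (j < 2 ^ m.-1)%N -> w (j * 2)%N = z j.
Hypothesis w1 : forall j, (j < 2 ^ m.-1)%N -> w (j * 2).+1 = - z j.
Hypothesis zy : forall j, (j < 2 ^ m.-1)%N -> z j * y j = 1.

Lemma big_ord_pairs n (g : nat -> C) :
  \sum_(r < n * 2) g r = \sum_(r < n) (g (r * 2)%N + g (r * 2).+1).
Proof.
elim: n => [|n IH]; first by rewrite !big_ord0.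
by rewrite mulSn add2n !big_ord_recr /= IH addrA.
Qed.

Lemma node_lt k p : (k < m)%N -> (p < M)%N -> (p %/ (2 ^ (m - k.+1) * 2) < 2 ^ m.-1)%N.
Proof.
move=> km pM; rewrite -expnSr ltn_divLR ?expn_gt0 //.
apply: leq_trans pM _; rewrite -expnD leq_exp2l //; lia.
Qed.

(** After k stages, block a of length h = 2^(m-k) holds the remainder of [f] modulo x^h - w a; there
    x^h = w a, so the coefficient of index t + r h contributes with factor (w a)^r. For k = m this
    is evaluation at [w p]. *)
Lemma fwdE k f p : (k <= m)%N -> (p < M)%N -> fwd k f p =
  \sum_(r < 2 ^ k) f (p %% 2 ^ (m - k) + r * 2 ^ (m - k))%N * w (p %/ 2 ^ (m - k)) ^+ r.
Proof.
elim: k p => [|k IH] p km pM.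
  by rewrite subn0 big_ord_recl big_ord0 /= mul0n !addn0 modn_small // expr0 mulr1 addr0.
rewrite /= /fwd_stage; set h := (2 ^ (m - k.+1))%N.
have h0 : (0 < h)%N by rewrite expn_gt0.
have hM : (h * 2 %| M)%N by rewrite /h -expnSr dvdn_exp2l //; lia.
have hk : (2 ^ (m - k) = h * 2)%N by rewrite /h -expnSr; congr expn; lia.
have := block_lt h0 hM pM; have := node_lt km pM; rewrite -/h.
have [a [t [th ep ea eh]]] := half_split p h0.
rewrite ea mulSn => am lt.
have bM (b : bool) : (a * (h * 2) + b * h + t < M)%N.
  by move: lt th; clear; case: b; lia.
have Fh (b : bool) : fwd k f (a * (h * 2) + b * h + t)%N =
    \sum_(r < 2 ^ k) f (t + (r * 2 + b) * h)%N * z a ^+ (r * 2).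
  rewrite IH ?bM ?(ltnW km) // hk mod2h // div2h //.
  apply: eq_bigr => r _; rewrite -zw // -exprM [(2 * r)%N]mulnC; congr (f _ * _).
  by clear; nia.
have pt : (p %% h = t)%N by rewrite ep modh.
move: (odd (p %/ h)) ep eh => b ep eh.
rewrite pt eh expnSr (big_ord_pairs _ (fun r => f (t + r * h)%N * w (a * 2 + b)%N ^+ r)).
case: b ep eh => ep eh.
  have -> : (p - h = a * (h * 2) + false * h + t)%N by move: ep; clear; lia.
  rewrite {1}ep !Fh addn1 w1 // mulr_sumr -sumrB.
  apply: eq_bigr => r _; rewrite exprS [(r * 2)%N]mulnC !exprM sqrrN.
  by rewrite addn0 addn1 [(2 * r)%N]mulnC; ring.
have -> : (p + h = a * (h * 2) + true * h + t)%N by move: ep; clear; lia.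
rewrite {1}ep !Fh addn0 w0 // mulr_sumr -big_split.
by apply: eq_bigr => r _; rewrite /= exprS addn0 addn1; ring.
Qed.

Definition sqconv (f : nat -> C) p := \sum_(j < p.+1) f j * f (p - j)%N.

(** As [f] vanishes on the upper half, its square still has degree below the transform length, and
    both sides evaluate the same polynomial at [w p]. *)
Lemma fwd_sqconv f p : (0 < m)%N -> (forall i, (2 ^ m.-1 <= i)%N -> f i = 0) -> (p < M)%N ->
  fwd m (sqconv f) p = fwd m f p ^+ 2.
Proof.
move=> m0 f0 pM; rewrite !fwdE // subnn expn0 divn1 modn1.
pose P := \poly_(i < 2 ^ m.-1) f i.
have cP i : P`_i = f i by rewrite coef_poly; case: ltnP => // /f0.
have M2 : M = (2 ^ m.-1 + 2 ^ m.-1)%N by rewrite /M -{1}(prednK m0) expnS; lia.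
have ev (g : nat -> C) (Q : {poly C}) : (forall i, Q`_i = g i) -> (size Q <= 2 ^ m)%N ->
    \sum_(r < 2 ^ m) g (0 + r * 1)%N * w p ^+ r = Q.[w p].
  move=> Qg sQ; rewrite (horner_coef_wide _ sQ).
  by apply: eq_bigr => i _; rewrite Qg muln1 add0n.
have sP : (size P <= 2 ^ m.-1)%N := size_poly _ _.
rewrite (ev f P) //; last by rewrite -/M; lia.
rewrite (ev (sqconv f) (P * P)) ?hornerM ?expr2 //.
  by move=> i; rewrite coefM; apply: eq_bigr => j _; rewrite !cP.
by apply: leq_trans (size_mul_leq _ _) _; rewrite -/M; lia.
Qed.

(** The inverse stages undo the forward ones from the last to the first, each leaving a factor 2. *)
Lemma bwd_fwd g X k : (k <= m)%N -> (forall p, (p < M)%N -> X p = fwd m g p) ->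
  forall p, (p < M)%N -> bwd k X p = fwd (m - k) g p *+ (2 ^ k).
Proof.
move=> + XF; elim: k => [|k IH] km p pM; first by rewrite /= subn0 mulr1n XF.
have hM : (2 ^ k * 2 %| M)%N by rewrite -expnSr dvdn_exp2l.
have mk : (m - k = (m - k.+1).+1)%N by lia.
have e2 : (2 ^ (m - (m - k.+1).+1) = 2 ^ k)%N by congr expn; lia.
rewrite /= (@inv_stage_ext _ _ (fun p => fwd (m - k) g p *+ (2 ^ k))) ?expn_gt0 //;
  last by move=> q qM; apply: IH => //; lia.
rewrite inv_stageMn mk /= e2 inv_stageK ?expn_gt0 //.
  by rewrite -mulrnA expnS.
apply: zy; have := @node_lt (m - k.+1) p; rewrite e2; apply=> //.
by move: km; clear; lia.
Qed.

Lemma fft_square f X p : (0 < m)%N -> (forall i, (2 ^ m.-1 <= i)%N -> f i = 0) ->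
  (forall p, (p < M)%N -> X p = fwd m f p ^+ 2) -> (p < M)%N ->
  bwd m X p = sqconv f p *+ (2 ^ m).
Proof.
move=> m0 f0 HX pM; rewrite (@bwd_fwd (sqconv f)) ?subnn //.
by move=> q qM; rewrite HX // fwd_sqconv.
Qed.

End ExactFFT.

Lemma stage_pos m k p : (k < m)%N -> (p < 2 ^ m)%N -> [/\ (p %/ (2 ^ k * 2) < 2 ^ m.-1)%N,
  (p - 2 ^ k < 2 ^ m)%N & ~~ odd (p %/ 2 ^ k) -> (p + 2 ^ k < 2 ^ m)%N].
Proof.
move=> km pM; have h0 : (0 < 2 ^ k)%N by rewrite expn_gt0.
have hM : (2 ^ k * 2 %| 2 ^ m)%N by rewrite -expnSr dvdn_exp2l.
split.
- have := @node_lt m (m - k.+1) p; rewrite (_ : m - (m - k.+1).+1 = k)%N; last by lia.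
  by apply=> //; lia.
- by move: pM; clear; lia.
move=> od; have := block_lt h0 hM pM; have [a [t [th ep ea _]]] := half_split p h0.
by rewrite (negbTE od) in ep; rewrite ea mulSn; move: ep th; clear; lia.
Qed.

(** * Fixed-point arithmetic on Gaussian integers *)

Section Gauss.
Local Open Scope ring_scope.
Import Order.TTheory GRing.Theory Num.Theory.

Definition gint := (int * int)%type.
Definition gadd (a b : gint) : gint := (a.1 + b.1, a.2 + b.2).
Definition gsub (a b : gint) : gint := (a.1 - b.1, a.2 - b.2).
Definition gmul (a b : gint) : gint := (a.1 * b.1 - a.2 * b.2, a.1 * b.2 + a.2 * b.1).
Definition gdiv (D : nat) (a : gint) : gint := ((a.1 %/ D%:Z)%Z, (a.2 %/ D%:Z)%Z).

Definition gfwd (D : nat) (zt : nat -> gint) h (X : nat -> gint) p :=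
  if odd (p %/ h) then gsub (X (p - h)%N) (gdiv D (gmul (zt (p %/ (h * 2))%N) (X p)))
  else gadd (X p) (gdiv D (gmul (zt (p %/ (h * 2))%N) (X (p + h)%N))).

Definition ginv (D : nat) (yt : nat -> gint) h (X : nat -> gint) p :=
  if odd (p %/ h) then gdiv D (gmul (yt (p %/ (h * 2))%N) (gsub (X (p - h)%N) (X p)))
  else gadd (X p) (X (p + h)%N).

Variable R : rcfType.
Local Notation C := R[i].

Definition toC (a : gint) : C := (a.1%:~R +i* a.2%:~R)%C.
(** The l1 norm is submultiplicative like the modulus but free of square roots, so that the error
    bounds remain within reach of [lra]. *)
Definition n1 (x : C) : R := `|complex.Re x| + `|complex.Im x|.
Definition rC (x : R) : C := (x +i* 0)%C.

Lemma toC_add a b : toC (gadd a b) = toC a + toC b.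
Proof. by apply/eqP; rewrite eq_complex /= !rmorphD !eqxx. Qed.
Lemma toC_sub a b : toC (gsub a b) = toC a - toC b.
Proof. by apply/eqP; rewrite eq_complex /= !rmorphB !eqxx. Qed.
Lemma toC_mul a b : toC (gmul a b) = toC a * toC b.
Proof. by apply/eqP; rewrite eq_complex /= !rmorphB !rmorphD !rmorphM /= !eqxx. Qed.

Lemma n1_ge0 x : 0 <= n1 x.
Proof. by rewrite addr_ge0. Qed.
Lemma n1D x y : n1 (x + y) <= n1 x + n1 y.
Proof.
case: x y => [a b] [c d]; rewrite /n1 /=.
have := ler_normD a c; have := ler_normD b d; lra.
Qed.
Lemma n1N x : n1 (- x) = n1 x.
Proof. by case: x => a b; rewrite /n1 /= !normrN. Qed.
Lemma n1B x y : n1 (x - y) <= n1 x + n1 y.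
Proof. by rewrite -(n1N y) n1D. Qed.
Lemma n1M x y : n1 (x * y) <= n1 x * n1 y.
Proof.
case: x y => [a b] [c d]; rewrite /n1 /=.
have := ler_normB (a * c) (b * d); have := ler_normD (a * d) (b * c).
rewrite !normrM mulrDl !mulrDr; lra.
Qed.
Lemma n1_rC x y : n1 (rC x * y) = `|x| * n1 y.
Proof. by case: y => c d; rewrite /n1 /= !mul0r subr0 addr0 !normrM mulrDr. Qed.
Lemma n1_Im x : `|complex.Im x| <= n1 x.
Proof. by rewrite lerDr. Qed.
Lemma n1_Re x : `|complex.Re x| <= n1 x.
Proof. by rewrite lerDl. Qed.

Variable D : nat.
Hypothesis D0 : (0 < D)%N.
Let d : R := D%:R.

Lemma d_gt0 : 0 < d.
Proof. by rewrite ltr0n. Qed.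

Lemma divz_err (a : int) : `|d * (a %/ D%:Z)%Z%:~R - a%:~R| <= d :> R.
Proof.
have e := divz_eq a D%:Z; have := ltz_pmod a (d := D%:Z) D0.
have := modz_ge0 a (d := D%:Z); rewrite -lt0n D0 => /(_ isT).
move: e; set q := (a %/ _)%Z; set r := (a %% _)%Z => e r0 rD.
have -> : a%:~R = q%:~R * d + r%:~R :> R by rewrite e rmorphD rmorphM.
have r0' : 0 <= r%:~R :> R by rewrite ler0z.
have rD' : r%:~R <= d :> R by rewrite /d -[D%:R]/((D%:Z)%:~R) ler_int ltW.
rewrite (_ : _ - _ = - r%:~R); last by ring.
by rewrite normrN ger0_norm.
Qed.

Lemma gdiv_err g : n1 (rC d * toC (gdiv D g) - toC g) <= 2 * d.
Proof.
rewrite /n1 /= !mul0r subr0 addr0.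
by have := divz_err g.1; have := divz_err g.2; lra.
Qed.

Lemma div_le (x b : R) : d * x <= d * b -> x <= b.
Proof. by rewrite ler_pM2l // d_gt0. Qed.

(* [zt / d] and [xt / d] approximate [z] and [x]. *)
Lemma gdiv_mul_err zt xt (z x : C) ez e v :
  n1 (toC zt) <= 3 * d -> n1 (toC zt - rC d * z) <= ez -> n1 (toC xt - rC d * x) <= e ->
  n1 x <= v -> n1 (toC (gdiv D (gmul zt xt)) - rC d * (z * x)) <= 3 * e + ez * v + 2.
Proof.
move=> z3 hz hx hv; apply: div_le.
have -> : d * n1 (toC (gdiv D (gmul zt xt)) - rC d * (z * x)) =
    n1 ((rC d * toC (gdiv D (gmul zt xt)) - toC (gmul zt xt)) +
     (toC zt * (toC xt - rC d * x) + (toC zt - rC d * z) * (rC d * x))).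
  rewrite -{1}(ger0_norm (ltW d_gt0)) -n1_rC toC_mul; congr n1; ring.
apply: le_trans (n1D _ _) _.
have H1 := gdiv_err (gmul zt xt).
have H2 := n1D (toC zt * (toC xt - rC d * x)) ((toC zt - rC d * z) * (rC d * x)).
have H3 : n1 (toC zt * (toC xt - rC d * x)) <= 3 * d * e.
  by apply: le_trans (n1M _ _) _; apply: ler_pM; rewrite ?n1_ge0.
have H4 : n1 ((toC zt - rC d * z) * (rC d * x)) <= ez * (d * v).
  apply: le_trans (n1M _ _) _; apply: ler_pM; rewrite ?n1_ge0 //.
  by rewrite n1_rC (ger0_norm (ltW d_gt0)) ler_wpM2l // ltW // d_gt0.
lra.
Qed.

Section Stages.
Variables (m : nat) (z y : nat -> C) (zt yt : nat -> gint) (ez : R).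
Let M := (2 ^ m)%N.
Hypothesis zE : forall j, (j < 2 ^ m.-1)%N -> n1 (toC (zt j) - rC d * z j) <= ez.
Hypothesis yE : forall j, (j < 2 ^ m.-1)%N -> n1 (toC (yt j) - rC d * y j) <= ez.
Hypothesis z2 : forall j, n1 (z j) <= 2.
Hypothesis y2 : forall j, n1 (y j) <= 2.
Hypothesis ezd : ez <= d.

Lemma approx_le3 zj ztj : n1 zj <= 2 -> n1 (toC ztj - rC d * zj) <= ez -> n1 (toC ztj) <= 3 * d.
Proof.
move=> h2 h; have -> : toC ztj = (toC ztj - rC d * zj) + rC d * zj by rewrite subrK.
apply: le_trans (n1D _ _) _; rewrite n1_rC (ger0_norm (ltW d_gt0)).
have : d * n1 zj <= d * 2 by rewrite ler_wpM2l // ltW // d_gt0.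
by move: h ezd; lra.
Qed.

Definition approx (Xt : nat -> gint) (X : nat -> C) v e := forall p, (p < M)%N ->
  n1 (X p) <= v /\ n1 (toC (Xt p) - rC d * X p) <= e.

Lemma approx_small Xt X v e p : approx Xt X v e -> (p < M)%N -> n1 (toC (Xt p)) <= d * v + e.
Proof.
move=> H /H[h1 h2]; have -> : toC (Xt p) = (toC (Xt p) - rC d * X p) + rC d * X p by rewrite subrK.
apply: le_trans (n1D _ _) _; rewrite n1_rC (ger0_norm (ltW d_gt0)).
have : d * n1 (X p) <= d * v by rewrite ler_wpM2l // ltW // d_gt0.
by move: h2; lra.
Qed.

(** A root has norm at most 2 and its table entry at most 3 d, whence 3 = 1 + 2 for the growth of
    the values and 4 = 1 + 3 for that of the errors. *)
Lemma gfwd_approx k Xt X v e : (k < m)%N -> approx Xt X v e -> 0 <= v ->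
  approx (gfwd D zt (2 ^ k) Xt) (fwd_stage z (2 ^ k) X) (3 * v) (4 * e + ez * v + 2).
Proof.
move=> km H v0 p pM; have [jm p1 p2] := stage_pos km pM.
have zv q : (q < M)%N -> n1 (z (p %/ (2 ^ k * 2)) * X q) <= 2 * v.
  by move=> qM; apply: le_trans (n1M _ _) _; apply: ler_pM; rewrite ?n1_ge0 ?(H q qM).1.
have er q : (q < M)%N -> n1 (toC (gdiv D (gmul (zt (p %/ (2 ^ k * 2))) (Xt q))) -
    rC d * (z (p %/ (2 ^ k * 2)) * X q)) <= 3 * e + ez * v + 2.
  move=> qM; have [h1 h2] := H q qM; apply: gdiv_mul_err => //; last exact: zE.
  exact: approx_le3 (z2 _) (zE jm).
rewrite /gfwd /fwd_stage; case: ifP => [od|/negbT/p2 pM2].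
  split.
    by apply: le_trans (n1B _ _) _; have := (H _ p1).1; have := zv _ pM; lra.
  rewrite toC_sub (_ : _ - _ = (toC (Xt (p - 2 ^ k)%N) - rC d * X (p - 2 ^ k)%N) -
   (toC (gdiv D (gmul (zt (p %/ (2 ^ k * 2))) (Xt p))) - rC d * (z (p %/ (2 ^ k * 2)) * X p))); last by ring.
  by apply: le_trans (n1B _ _) _; have := (H _ p1).2; have := er _ pM; lra.
split.
  by apply: le_trans (n1D _ _) _; have := (H _ pM).1; have := zv _ pM2; lra.
rewrite toC_add (_ : _ - _ = (toC (Xt p) - rC d * X p) +
   (toC (gdiv D (gmul (zt (p %/ (2 ^ k * 2))) (Xt (p + 2 ^ k)%N))) -
    rC d * (z (p %/ (2 ^ k * 2)) * X (p + 2 ^ k)%N))); last by ring.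
by apply: le_trans (n1D _ _) _; have := (H _ pM).2; have := er _ pM2; lra.
Qed.

(** Here the difference is formed before the multiplication and doubles both bounds, whence 4 = 2 *
    2 and 6 = 3 * 2. *)
Lemma ginv_approx k Xt X v e : (k < m)%N -> approx Xt X v e -> 0 <= v -> 0 <= e -> 0 <= ez ->
  approx (ginv D yt (2 ^ k) Xt) (inv_stage y (2 ^ k) X) (4 * v) (6 * e + ez * (2 * v) + 2).
Proof.
move=> km H v0 e0 ez0 p pM; have [jm p1 p2] := stage_pos km pM.
have ev0 : 0 <= ez * v by rewrite mulr_ge0.
rewrite /ginv /inv_stage; case: ifP => [od|/negbT/p2 pM2].
  have h1 : n1 (X (p - 2 ^ k)%N - X p) <= 2 * v.
    by apply: le_trans (n1B _ _) _; have := (H _ p1).1; have := (H _ pM).1; lra.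
  split.
    apply: le_trans (n1M _ _) _; rewrite (_ : 4 * v = 2 * (2 * v)); last by ring.
    by apply: ler_pM; rewrite ?n1_ge0.
  apply: le_trans (gdiv_mul_err (e := 2 * e) (approx_le3 (y2 _) (yE jm)) (yE jm) _ h1) _; last by lra.
  rewrite toC_sub (_ : _ - _ = (toC (Xt (p - 2 ^ k)%N) - rC d * X (p - 2 ^ k)%N) -
    (toC (Xt p) - rC d * X p)); last by ring.
  by apply: le_trans (n1B _ _) _; have := (H _ p1).2; have := (H _ pM).2; lra.
split.
  by apply: le_trans (n1D _ _) _; have := (H _ pM).1; have := (H _ pM2).1; lra.
rewrite toC_add (_ : _ - _ = (toC (Xt p) - rC d * X p) +
    (toC (Xt (p + 2 ^ k)%N) - rC d * X (p + 2 ^ k)%N)); last by ring.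
by apply: le_trans (n1D _ _) _; have := (H _ pM).2; have := (H _ pM2).2; lra.
Qed.

Lemma gsq_approx Xt X v e : approx Xt X v e -> 0 <= v -> 0 <= e -> e <= d ->
  approx (fun p => gdiv D (gmul (Xt p) (Xt p))) (fun p => X p ^+ 2)
    (v ^+ 2) (e * (2 * v + 1) + 2).
Proof.
move=> H v0 e0 ed p pM; have [h1 h2] := H p pM; split.
  rewrite !expr2; apply: le_trans (n1M _ _) _; apply: ler_pM => //; exact: n1_ge0.
have h3 := approx_small H pM.
apply: div_le.
have -> : d * n1 (toC (gdiv D (gmul (Xt p) (Xt p))) - rC d * X p ^+ 2) =
    n1 ((rC d * toC (gdiv D (gmul (Xt p) (Xt p))) - toC (gmul (Xt p) (Xt p))) +
     ((toC (Xt p) - rC d * X p) * (toC (Xt p) + rC d * X p))).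
  rewrite -{1}(ger0_norm (ltW d_gt0)) -n1_rC toC_mul; congr n1; ring.
apply: le_trans (n1D _ _) _.
have H1 := gdiv_err (gmul (Xt p) (Xt p)).
have H2 : n1 (toC (Xt p) + rC d * X p) <= d * (2 * v + 1).
  apply: le_trans (n1D _ _) _; rewrite n1_rC (ger0_norm (ltW d_gt0)).
  have : d * n1 (X p) <= d * v by rewrite ler_wpM2l // ltW // d_gt0.
  by move: h3 ed; lra.
have H3 : n1 ((toC (Xt p) - rC d * X p) * (toC (Xt p) + rC d * X p)) <= e * (d * (2 * v + 1)).
  by apply: le_trans (n1M _ _) _; apply: ler_pM; rewrite ?n1_ge0.
lra.
Qed.

Fixpoint gfwds k f := if k is k'.+1 then gfwd D zt (2 ^ (m - k)) (gfwds k' f) else f.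
Fixpoint ginvs k X := if k is k'.+1 then ginv D yt (2 ^ k') (ginvs k' X) else X.

(** The square of the transform length. The growth factors [3 ^+ k] and [4 ^+ k] are at most [A] and
    [8 ^+ k] is at most [A ^+ 2], so all bounds become polynomials in [A]; [Hd] keeps the final
    error below one unit [d]. *)
Let A : R := 4 ^+ m.
Hypothesis m0 : (0 < m)%N.
Hypothesis ez1 : 1 <= ez.
Hypothesis Hd : 32 * A ^+ 5 * ez < d.

Variables (f : nat -> C) (ft : nat -> gint).
Hypothesis ftE : forall p, (p < M)%N -> toC (ft p) = rC d * f p.
Hypothesis f2 : forall p, (p < M)%N -> n1 (f p) <= 2.

Lemma ez_ge0 : 0 <= ez. Proof. exact: le_trans ler01 ez1. Qed.

Lemma A_ge4 : 4 <= A.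
Proof. by rewrite /A -(prednK m0) exprS ler_peMr // exprn_ege1 //; lra. Qed.

Lemma A_ge0 : 0 <= A.
Proof. by apply: le_trans A_ge4. Qed.

Lemma A_ge1 : 1 <= A.
Proof. by apply: le_trans A_ge4; rewrite ler1n. Qed.

Lemma pow_le (a : R) k : 1 <= a -> (k <= m)%N -> a ^+ k <= a ^+ m.
Proof. by move=> a1 km; rewrite ler_weXn2l. Qed.

(** With c = 2 A ez + 2 the error obeys e' <= 4 e + c; the subtracted c is what lets the induction
    close. *)
Lemma gfwds_approx k : (k <= m)%N ->
  approx (gfwds k ft) (fwd m z k f) (2 * 3 ^+ k) (4 ^+ k * (2 * A * ez + 2) - (2 * A * ez + 2)).
Proof.
elim: k => [|k IH] km.
  move=> p pM /=; rewrite expr0 mulr1 mul1r subrr ftE // subrr; split; first exact: f2.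
  by rewrite /n1 /= normr0 addr0.
have k3 : 0 <= 3 ^+ k :> R by apply: exprn_ge0; lra.
have km' : (m - k.+1 < m)%N by lia.
have /= H := gfwd_approx km' (IH (ltnW km)) (mulr_ge0 (ler0n _ 2) k3).
move=> p /H[h1 h2]; split; first by rewrite exprS; move: h1; lra.
apply: le_trans h2 _; rewrite exprS.
have l34 : 3 ^+ k <= A.
  by apply: le_trans (pow_le _ (ltnW km)); [rewrite lerXn2r ?nnegrE|]; lra.
have : ez * (2 * 3 ^+ k) <= 2 * A * ez.
  rewrite [leRHS]mulrC ler_wpM2l ?ez_ge0 //; lra.
have : 0 <= 2 * A * ez by rewrite !mulr_ge0 ?ez_ge0 ?A_ge0.
lra.
Qed.

Let E1 := 4 * A ^+ 2 * ez.

Lemma AeE i : 1 <= A ^+ i * ez.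
Proof. by rewrite mulr_ege1 // exprn_ege1 // A_ge1. Qed.

Lemma Ae_le i j : (i <= j)%N -> A ^+ i * ez <= A ^+ j * ez.
Proof. by move=> ij; rewrite ler_wpM2r ?ez_ge0 // ler_weXn2l // A_ge1. Qed.

Lemma gfwds_approxE k : (k <= m)%N -> approx (gfwds k ft) (fwd m z k f) (2 * A) E1.
Proof.
move=> km p /(gfwds_approx km)[h1 h2]; have A4 := A_ge4; split.
  apply: le_trans h1 _; have : 3 ^+ k <= A; last by lra.
  by apply: le_trans (pow_le _ km); [rewrite lerXn2r ?nnegrE|]; lra.
apply: le_trans h2 _; apply: (@le_trans _ _ (A * (2 * A * ez + 2))).
  have h : 4 ^+ k <= A by apply: pow_le => //; lra.
  have : 0 <= 2 * A * ez + 2 by have := AeE 1; rewrite expr1; lra.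
  move: (2 * A * ez + 2) => c c0; have : 4 ^+ k * c <= A * c by rewrite ler_wpM2r.
  lra.
have h : 2 * A <= 2 * A * (A * ez).
  by rewrite ler_peMr //; [lra|have := AeE 1; rewrite expr1].
rewrite /E1; move: h; rewrite (_ : 2 * A * (A * ez) = 2 * (A ^+ 2 * ez)); last by ring.
rewrite (_ : A * (2 * A * ez + 2) = 2 * (A ^+ 2 * ez) + 2 * A); last by ring.
lra.
Qed.

Lemma E1_le_d : E1 <= d.
Proof.
have := @Ae_le 2 5 isT; have := AeE 5; rewrite /E1.
by move: Hd; rewrite -!mulrA; lra.
Qed.

Definition gsqs p := gdiv D (gmul (gfwds m ft p) (gfwds m ft p)).
Let V2 := 4 * A ^+ 2.
Let E2 := 22 * A ^+ 3 * ez.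

Lemma gsqs_approx : approx gsqs (fun p => fwd m z m f p ^+ 2) V2 E2.
Proof.
have A4 := A_ge4; have e10 : 0 <= E1 by have := AeE 2; rewrite /E1 -mulrA; lra.
have v0 : 0 <= 2 * A by lra.
move=> p /(gsq_approx (gfwds_approxE (leqnn m)) v0 e10 E1_le_d) [h1 h2].
split; first by apply: le_trans h1 _; rewrite /V2 exprMn; lra.
apply: le_trans h2 _; rewrite /E1 /E2.
have := @Ae_le 2 3 isT; have := AeE 3; have := AeE 2.
rewrite (_ : _ * _ * _ * _ = 16 * (A ^+ 3 * ez) + 4 * (A ^+ 2 * ez)); last by ring.
by rewrite -!mulrA; lra.
Qed.

Let c2 := 10 * A ^+ 3 * ez.

(** The recurrence is e' <= 6 e + c2, where [c2] covers the rounding and the table error;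
    [8 ^+ k * (E2 + c2) - c2] dominates it and starts at the error [E2] of the squares. *)
Lemma ginvs_approx k : (k <= m)%N -> approx (ginvs k gsqs)
  (bwd y k (fun p => fwd m z m f p ^+ 2)) (4 ^+ k * V2) (8 ^+ k * (E2 + c2) - c2).
Proof.
have A4 := A_ge4; have e3 := AeE 3; have ge1 n : 0 <= 4 ^+ n :> R by apply: exprn_ge0; lra.
have V0 : 0 <= V2 by rewrite mulr_ge0 // exprn_ge0 // A_ge0.
elim: k => [|k IH] km.
  move=> p /gsqs_approx[h1 h2]; rewrite !expr0 !mul1r; split=> //.
  by move: h2; rewrite /E2 /c2 -!mulrA; lra.
have k8 : 1 <= 8 ^+ k :> R by apply: exprn_ege1; lra.
have p8 : E2 + c2 <= 8 ^+ k * (E2 + c2).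
  by rewrite ler_peMl // /E2 /c2 -!mulrA; lra.
have e0 : 0 <= 8 ^+ k * (E2 + c2) - c2.
  by move: p8; rewrite /E2 /c2 -!mulrA; lra.
have H := ginv_approx km (IH (ltnW km)) (mulr_ge0 (ge1 k) V0) e0 (le_trans ler01 ez1).
move=> p /H[h1 h2]; split; first by move: h1; rewrite exprS mulrA.
apply: le_trans h2 _; rewrite exprS.
have h : 4 ^+ k <= A by apply: pow_le; [lra|exact: ltnW].
have : ez * (2 * (4 ^+ k * V2)) <= 8 * (A ^+ 3 * ez).
  rewrite (_ : 8 * _ = ez * (2 * (A * V2))); last by rewrite /V2; ring.
  by rewrite ler_wpM2l ?(le_trans ler01 ez1) // ler_wpM2l ?ler_wpM2r //; lra.
have : 8 * (A ^+ 3 * ez) + 2 <= c2 by rewrite /c2 -!mulrA; lra.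
by move: p8; rewrite /E2 /c2 -!mulrA; lra.
Qed.

Lemma ginvs_approxE k : (k <= m)%N -> approx (ginvs k gsqs)
  (bwd y k (fun p => fwd m z m f p ^+ 2)) (4 * A ^+ 3) (32 * A ^+ 5 * ez).
Proof.
move=> km p /(ginvs_approx km)[h1 h2]; have A4 := A_ge4; have e3 := AeE 3; split.
  apply: le_trans h1 _; rewrite (_ : 4 * A ^+ 3 = A * V2); last by rewrite /V2; ring.
  rewrite ler_wpM2r //; first by rewrite mulr_ge0 // exprn_ge0 // A_ge0.
  by apply: pow_le => //; lra.
apply: le_trans h2 _.
have k8 : 8 ^+ k <= A ^+ 2 :> R.
  rewrite /A -exprM mulnC exprM; apply: le_trans (pow_le _ km); last by rewrite -natrX ler1n.
  by rewrite lerXn2r ?nnegrE //; rewrite -?natrX ?ler_nat ?ler0n.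
have : 8 ^+ k * (32 * (A ^+ 3 * ez)) <= A ^+ 2 * (32 * (A ^+ 3 * ez)).
  by rewrite ler_wpM2r //; lra.
rewrite [A ^+ 2 * _](_ : _ = 32 * A ^+ 5 * ez); last by ring.
by rewrite (_ : E2 + c2 = 32 * (A ^+ 3 * ez)) /c2; rewrite /E2 -?mulrA; lra.
Qed.

(** The size a product may reach before it is rescaled. As [A] is at most the square of the table
    length N, this is at most D * D * N^12, the headroom that the words must offer. *)
Let bnd := d ^+ 2 * A ^+ 6.

Lemma bnd_le (x : R) : x <= 32 * A ^+ 3 -> d ^+ 2 * x <= bnd.
Proof.
move=> h; rewrite ler_wpM2l //; first by rewrite exprn_ge0 // ltW // d_gt0.
apply: le_trans h _; rewrite (_ : A ^+ 6 = A ^+ 3 * A ^+ 3); last by ring.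
rewrite ler_wpM2r ?exprn_ge0 ?A_ge0 //.
apply: (@le_trans _ _ (4 ^+ 3)); first by rewrite -natrX ler_nat.
by rewrite lerXn2r ?nnegrE ?A_ge0 ?A_ge4.
Qed.

Lemma A_poly : 1 <= A ^+ 2 /\ 4 * A ^+ 2 <= A ^+ 3.
Proof.
split; first by rewrite exprn_ege1 // A_ge1.
by rewrite [A ^+ 3]exprS ler_wpM2r ?exprn_ge0 ?A_ge0 ?A_ge4.
Qed.

Lemma gfwds_small k p j : (k <= m)%N -> (p < M)%N -> (j < 2 ^ m.-1)%N ->
  n1 (toC (gmul (zt j) (gfwds k ft p))) <= bnd.
Proof.
move=> km pM jm; have h1 := approx_le3 (z2 j) (zE jm).
have h2 := approx_small (gfwds_approxE km) pM.
rewrite toC_mul; apply: le_trans (n1M _ _) _.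
have A4 := A_ge4; have [A2 A3] := A_poly.
apply: (@le_trans _ _ (3 * d * (d * (2 * A + 1)))).
  by apply: ler_pM; rewrite ?n1_ge0 //; apply: le_trans h2 _; have := E1_le_d; lra.
rewrite (_ : _ * _ = d ^+ 2 * (6 * A + 3)); last by ring.
apply: bnd_le; have : A <= A ^+ 2 by rewrite expr2 ler_peMr ?A_ge0 ?A_ge1.
by move: A2 A3; lra.
Qed.

Lemma gsqs_small p : (p < M)%N -> n1 (toC (gmul (gfwds m ft p) (gfwds m ft p))) <= bnd.
Proof.
move=> pM; have h2 := approx_small (gfwds_approxE (leqnn m)) pM.
rewrite toC_mul; apply: le_trans (n1M _ _) _.
have A4 := A_ge4; have [A2 A3] := A_poly.
have h3 : n1 (toC (gfwds m ft p)) <= d * (2 * A + 1).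
  by apply: le_trans h2 _; have := E1_le_d; lra.
apply: (@le_trans _ _ ((d * (2 * A + 1)) * (d * (2 * A + 1)))).
  by apply: ler_pM; rewrite ?n1_ge0.
rewrite (_ : _ * _ = d ^+ 2 * (4 * A ^+ 2 + 4 * A + 1)); last by ring.
apply: bnd_le; have : A <= A ^+ 2 by rewrite expr2 ler_peMr ?A_ge0 ?A_ge1.
by move: A2 A3; lra.
Qed.

Lemma ginvs_small k p q j : (k <= m)%N -> (p < M)%N -> (q < M)%N -> (j < 2 ^ m.-1)%N ->
  n1 (toC (gmul (yt j) (gsub (ginvs k gsqs p) (ginvs k gsqs q)))) <= bnd.
Proof.
move=> km pM qM jm; have h1 := approx_le3 (y2 j) (yE jm).
have sm r : (r < M)%N -> n1 (toC (ginvs k gsqs r)) <= d * (4 * A ^+ 3 + 1).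
  by move=> rM; apply: le_trans (approx_small (ginvs_approxE km) rM) _; have := Hd; lra.
rewrite toC_mul; apply: le_trans (n1M _ _) _.
have A4 := A_ge4; have [A2 A3] := A_poly.
apply: (@le_trans _ _ (3 * d * (2 * (d * (4 * A ^+ 3 + 1))))).
  apply: ler_pM; rewrite ?n1_ge0 // toC_sub; apply: le_trans (n1B _ _) _.
  by have := sm _ pM; have := sm _ qM; lra.
rewrite (_ : _ * _ = d ^+ 2 * (24 * A ^+ 3 + 6)); last by ring.
by apply: bnd_le; move: A2 A3; lra.
Qed.

Lemma ginvs_last_small p : (p < M)%N -> n1 (toC (ginvs m gsqs p)) <= bnd.
Proof.
move=> pM; apply: le_trans (approx_small (ginvs_approxE (leqnn m)) pM) _.
apply: (@le_trans _ _ (d ^+ 2 * (4 * A ^+ 3 + 1))); last first.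
  by apply: bnd_le; have [] := A_poly; lra.
have A4 := A_ge4; have [A2 A3] := A_poly.
have dd : d <= d ^+ 2 by rewrite expr2 ler_peMr ?(ltW d_gt0) // ler1n.
apply: (@le_trans _ _ (d * (4 * A ^+ 3 + 1))); first by have := Hd; lra.
by rewrite ler_wpM2r //; lra.
Qed.

End Stages.
End Gauss.

(** * Roots of unity *)

Section Twiddles.
Local Open Scope ring_scope.
Import Order.TTheory GRing.Theory Num.Theory.

Lemma odd_bit_add i k j : (i < k)%N -> odd ((j + 2 ^ k) %/ 2 ^ i) = odd (j %/ 2 ^ i).
Proof.
move=> ik; have -> : (2 ^ k = 2 ^ (k - i).-1.+1 * 2 ^ i)%N.
  by rewrite -expnD; congr expn; lia.
by rewrite divnDr ?dvdn_mull // mulnK ?expn_gt0 // oddD expnS oddM /= addbF.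
Qed.

Lemma bit_small i j : (j < 2 ^ i)%N -> (j %/ 2 ^ i = 0)%N.
Proof. by move=> H; rewrite divn_small. Qed.

Lemma bit_top k j : (j < 2 ^ k)%N -> ((j + 2 ^ k) %/ 2 ^ k = 1)%N.
Proof.
move=> H; rewrite divnDr // divnn expn_gt0 bit_small //.
Qed.

Variable C : comNzRingType.

(** With o k = exp (i pi / 2^(k+1)) the argument of this product is pi times the binary fraction
    whose digits are those of j in reverse: the roots in the order in which the stages use them. *)
Definition zz K (o : nat -> C) j := \prod_(k < K) (if odd (j %/ 2 ^ k) then o k else 1).

Lemma zz_widen K o j i : (j < 2 ^ K)%N -> zz (K + i) o j = zz K o j.
Proof.
move=> jK; elim: i => [|i IH]; first by rewrite addn0.
rewrite addnS /zz big_ord_recr /= -/(zz (K + i) o j) IH bit_small ?mulr1 //.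
by apply: leq_trans jK _; rewrite leq_exp2l // leq_addr.
Qed.

Lemma zz_add K o k j : (k < K)%N -> (j < 2 ^ k)%N -> zz K o (j + 2 ^ k)%N = zz K o j * o k.
Proof.
move=> kK jk.
have -> : K = (k.+1 + (K - k.+1))%N by lia.
have j2 : (j + 2 ^ k < 2 ^ k.+1)%N by rewrite expnS; lia.
rewrite !zz_widen //; last by apply: ltn_trans jk _; rewrite ltn_exp2l.
rewrite /zz !big_ord_recr /= bit_top // bit_small //= mulr1; congr (_ * _).
by apply: eq_bigr => i _; rewrite odd_bit_add.
Qed.

(** Passing from j to 2 j + b shifts the digits by one place, which squaring undoes since o (k+1)
    squares to o k; the new lowest digit contributes the sign. *)
Lemma zz_sq K o (j : nat) (b : bool) : o 0%N ^+ 2 = -1 -> (forall k, o k.+1 ^+ 2 = o k) ->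
  (j < 2 ^ K)%N -> zz K.+1 o (j * 2 + b)%N ^+ 2 = (-1) ^+ b * zz K.+1 o j.
Proof.
move=> o0 oS jK; rewrite -[in RHS]addn1 zz_widen // /zz big_ord_recl /= exprMn.
have -> : odd ((j * 2 + b) %/ 2 ^ 0) = b by rewrite expn0 divn1 oddD oddM andbF /=; case: b.
congr (_ * _); first by case: b; rewrite ?o0 ?expr1 ?expr1n ?expr0.
rewrite -prodrXl; apply: eq_bigr => i _.
rewrite /bump /= add1n expnS divnMA divnMDl // (_ : (b %/ 2 = 0)%N) ?addn0; last by case: b.
by case: ifP; rewrite ?oS ?expr1n.
Qed.

Lemma zz_inv K o o' j : (forall k, o k * o' k = 1) -> zz K o j * zz K o' j = 1.
Proof.
move=> oo; rewrite /zz -big_split big1 // => i _ /=.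
by case: ifP; rewrite ?oo ?mulr1.
Qed.

Lemma zz0 K o : zz K o 0 = 1.
Proof. by rewrite /zz big1 // => i _; rewrite div0n. Qed.

End Twiddles.

Section Roots.
Local Open Scope ring_scope.
Import Order.TTheory GRing.Theory Num.Theory.
Variable R : rcfType.
Local Notation C := R[i].

(** The cosine of pi / 2^(k+1) by the half-angle formula, available in any real closed field; [sinr]
    is the corresponding sine. *)
Fixpoint cosr k : R := if k is k'.+1 then Num.sqrt ((1 + cosr k') / 2) else 0.
Definition sinr k : R := if k is k'.+1 then Num.sqrt ((1 - cosr k') / 2) else 1.

Lemma cosr_bounds k : 0 <= cosr k <= 1.
Proof.
elim: k => [|k IH] /=; first by lra.
rewrite sqrtr_ge0 /= -[leRHS]sqrtr1 ler_wsqrtr //; lra.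
Qed.

Lemma cosr_half k : 1 / 2 <= cosr k.+1.
Proof.
have := cosr_bounds k => H /=.
have -> : 1 / 2 = Num.sqrt ((1 / 2) ^+ 2) :> R by rewrite sqrtr_sqr ger0_norm //; lra.
by rewrite ler_wsqrtr //; lra.
Qed.

Lemma cosrS k : cosr k.+1 ^+ 2 = (1 + cosr k) / 2.
Proof. by rewrite /= sqr_sqrtr //; have := cosr_bounds k; lra. Qed.

Lemma sinr_ge0 k : 0 <= sinr k.
Proof. by case: k => [|k] //=; rewrite ?ler01 ?sqrtr_ge0. Qed.

Lemma sinrS k : sinr k.+1 ^+ 2 = (1 - cosr k) / 2.
Proof. by rewrite /= sqr_sqrtr //; have := cosr_bounds k; lra. Qed.

Lemma cos_sin k : cosr k ^+ 2 + sinr k ^+ 2 = 1.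
Proof. by case: k => [|k]; [rewrite /=|rewrite cosrS sinrS]; lra. Qed.

Lemma sin_double k : 2 * cosr k.+1 * sinr k.+1 = sinr k.
Proof.
apply/eqP; rewrite -(@eqrXn2 _ 2) ?sinr_ge0 //; last first.
  by rewrite !mulr_ge0 ?sinr_ge0 //; have := cosr_bounds k.+1; lra.
rewrite !exprMn cosrS sinrS; have := cos_sin k => H; apply/eqP; lra.
Qed.

(* [sg] selects between the root [exp (i pi / 2^(k+1))] and its conjugate. *)
Definition om (sg : R) k : C := Complex (cosr k) (sg * sinr k).

Lemma sqr_complex (a b : R) : Complex a b ^+ 2 = Complex (a ^+ 2 - b ^+ 2) (2 * a * b) :> C.
Proof.
by rewrite expr2; apply/eqP; rewrite eq_complex /=; apply/andP; split; apply/eqP; ring.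
Qed.

Lemma om0_sq sg : sg ^+ 2 = 1 -> om sg 0 ^+ 2 = -1.
Proof.
move=> s1; rewrite expr2; apply/eqP; rewrite eq_complex /=.
rewrite !mulr0 !mul0r mulr1 -expr2 s1 oppr0 sub0r !addr0 !eqxx //.
Qed.

Lemma omS_sq sg k : sg ^+ 2 = 1 -> om sg k.+1 ^+ 2 = om sg k.
Proof.
move=> s1; rewrite /om sqr_complex exprMn s1 mul1r cosrS sinrS -(sin_double k).
by congr Complex; [lra|ring].
Qed.

Lemma om_conj k : om 1 k * om (-1) k = 1.
Proof.
have H := cos_sin k; apply/eqP; rewrite eq_complex /=; apply/andP; split; apply/eqP.
  by move: H; lra.
by ring.
Qed.

Definition nrm2 (x : C) := complex.Re x ^+ 2 + complex.Im x ^+ 2.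

Lemma nrm2M x y : nrm2 (x * y) = nrm2 x * nrm2 y.
Proof. by case: x y => [a b] [c d]; rewrite /nrm2 /=; ring. Qed.

Lemma nrm2_om sg k : sg ^+ 2 = 1 -> nrm2 (om sg k) = 1.
Proof. by move=> s1; rewrite /nrm2 /= exprMn s1 mul1r cos_sin. Qed.

Lemma nrm2_zz K sg j : sg ^+ 2 = 1 -> nrm2 (zz K (om sg) j) = 1.
Proof.
move=> s1; elim: K => [|K IH]; first by rewrite /zz big_ord0 /nrm2 /= expr1n expr0n addr0.
rewrite /zz big_ord_recr /= nrm2M [X in X * _]IH mul1r.
by case: ifP => _; rewrite ?nrm2_om // /nrm2 /= expr1n expr0n addr0.
Qed.

Lemma unit_n1 x : nrm2 x = 1 -> n1 x <= 2.
Proof.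
rewrite /nrm2 /n1; move: (complex.Re x) (complex.Im x) => a b H.
have a1 : `|a| <= 1 by rewrite ler_norml; apply/andP; split; nra.
have b1 : `|b| <= 1 by rewrite ler_norml; apply/andP; split; nra.
lra.
Qed.

End Roots.

(** * Integer approximations of the roots *)

Section IntTables.

Lemma sqrt_spec x : Nat.sqrt x * Nat.sqrt x <= x < (Nat.sqrt x).+1 * (Nat.sqrt x).+1.
Proof. by have [] := PeanoNat.Nat.sqrt_spec' x; lia. Qed.

Lemma sqrt_uniq x r : r * r <= x < r.+1 * r.+1 -> Nat.sqrt x = r.
Proof. by move=> H; apply: PeanoNat.Nat.sqrt_unique; lia. Qed.

Variable D : nat.

(** The half-angle formula at scale D, rounded down: the square of D cos' is D (D + D cos) / 2. *)
Fixpoint cosn k := if k is k'.+1 then Nat.sqrt ((D * (D + cosn k')) %/ 2) else 0.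
Definition sinn k := Nat.sqrt (D * D - cosn k * cosn k).

Lemma cosn_le k : cosn k <= D.
Proof.
elim: k => //= k IH; have := sqrt_spec ((D * (D + cosn k)) %/ 2).
move: (Nat.sqrt _) => r /andP[h _]; have : (D * (D + cosn k)) %/ 2 <= D * D.
  by have := leq_trunc_div (D * (D + cosn k)) 2; nia.
nia.
Qed.

Lemma sinn_le k : sinn k <= D.
Proof.
rewrite /sinn; have := sqrt_spec (D * D - cosn k * cosn k).
by move: (Nat.sqrt _) => r; nia.
Qed.

Definition rootn (sg : int) k : gint := (Posz (cosn k), (sg * Posz (sinn k))%R).

(** Rounding makes the result depend on the order of the factors. Digits are taken from the lowest
    to the highest, the order in which the machine fills its table by doubling, so its entries agree
    with [zn] exactly. *)
Definition zn sg K j : gint := foldl (fun acc k =>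
  if odd (j %/ 2 ^ k) then gdiv D (gmul (rootn sg k) acc) else acc) (Posz D, 0%R) (iota 0 K).

Lemma zn0 sg K : zn sg K 0 = (Posz D, 0%R).
Proof. by rewrite /zn; elim: (iota 0 K) => //= k s IH; rewrite div0n. Qed.

Lemma znS sg K j : zn sg K.+1 j =
  if odd (j %/ 2 ^ K) then gdiv D (gmul (rootn sg K) (zn sg K j)) else zn sg K j.
Proof. by rewrite /zn -[K.+1]addn1 iotaD foldl_cat /= add0n. Qed.

Lemma zn_widen sg K i j : j < 2 ^ K -> zn sg (K + i) j = zn sg K j.
Proof.
move=> jK; elim: i => [|i IH]; first by rewrite addn0.
rewrite addnS znS IH bit_small //; apply: leq_trans jK _.
by rewrite leq_exp2l // leq_addr.
Qed.

Lemma zn_bits sg K j j' : (forall i, i < K -> odd (j %/ 2 ^ i) = odd (j' %/ 2 ^ i)) ->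
  zn sg K j = zn sg K j'.
Proof.
elim: K => // K IH H; rewrite !znS H // IH // => i iK; apply: H; exact: leqW.
Qed.

Lemma zn_add sg K k j : k < K -> j < 2 ^ k ->
  zn sg K (j + 2 ^ k) = gdiv D (gmul (rootn sg k) (zn sg K j)).
Proof.
move=> kK jk; have -> : K = k.+1 + (K - k.+1) by lia.
have j2 : j + 2 ^ k < 2 ^ k.+1 by rewrite expnS; lia.
rewrite !zn_widen //; last by apply: ltn_trans jk _; rewrite ltn_exp2l.
rewrite !znS bit_top // bit_small //=; congr (gdiv _ (gmul _ _)).
by apply: zn_bits => i; apply: odd_bit_add.
Qed.

End IntTables.

(** * Rounding errors of the roots *)

Section SquareGap.
Local Open Scope ring_scope.
Import Order.TTheory GRing.Theory Num.Theory.
Variables (R : realFieldType) (d k a b : R).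
Hypotheses (d100 : 100 <= d) (k0 : 0 <= 10 * k) (b0 : 0 <= b) (da : d / 2 <= a).

Lemma sqr_gapl : a ^+ 2 - b ^+ 2 <= d * (10 * k) / 2 + 4 * d -> a - b <= 10 * (k + 1).
Proof.
move=> ab; rewrite leNgt; apply/negP => lt.
have : (10 * k + 10) * (d / 2) <= (a - b) * (a + b).
  by move: lt d100 k0 b0 da => {ab} *; apply: ler_pM; lra.
rewrite (_ : (a - b) * (a + b) = a ^+ 2 - b ^+ 2); last by ring.
by move: ab d100; lra.
Qed.

Lemma sqr_gapr : b ^+ 2 - a ^+ 2 <= d * (10 * k) / 2 -> b - a <= 10 * (k + 1).
Proof.
move=> ab; rewrite leNgt; apply/negP => lt.
have : (10 * k + 10) * (d / 2) <= (b - a) * (a + b).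
  by move: lt d100 k0 b0 da => {ab} *; apply: ler_pM; lra.
rewrite (_ : (b - a) * (a + b) = b ^+ 2 - a ^+ 2); last by ring.
by move: ab d100; lra.
Qed.

End SquareGap.

Section TableErrors.
Local Open Scope ring_scope.
Import Order.TTheory GRing.Theory Num.Theory.
Variables (R : rcfType) (De : nat).
Let D := (De * De)%N.
Let e : R := De%:R.
Let d : R := D%:R.
Hypothesis De10 : (10 <= De)%N.

Lemma de : d = e ^+ 2. Proof. by rewrite /d /D natrM expr2. Qed.
Lemma e10 : 10 <= e. Proof. by rewrite /e ler_nat. Qed.
Lemma d100 : 100 <= d. Proof. by rewrite de; have := e10; nra. Qed.

Lemma sqrt_specR x : let r := (Nat.sqrt x)%:R : R in r ^+ 2 <= x%:R < (r + 1) ^+ 2.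
Proof.
have /andP[h1 h2] := sqrt_spec x; rewrite /= natr1 -!natrX ler_nat ltr_nat.
by rewrite !expnS !expn0; apply/andP; split; lia.
Qed.

Lemma half_specR x : let r := (x %/ 2)%:R : R in 2 * r <= x%:R <= 2 * r + 1.
Proof.
by rewrite /= -natrM natr1 !ler_nat; have := divn_eq x 2; have := ltn_pmod x (isT : 0 < 2)%N; lia.
Qed.

(** The squares differ by at most d (10 k) / 2 + 4 d. Dividing by the sum of the two roots, at least
    d / 2 by [cosr_half], gives 10 k + 8: the error grows only linearly in k. *)
Lemma cosn_err k : `|(cosn D k)%:R - d * cosr R k| <= 10 * k%:R.
Proof.
elim: k => [|k IH]; first by rewrite /= mulr0 subrr normr0 mulr0.
have := sqrt_specR ((D * (D + cosn D k)) %/ 2).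
have := half_specR (D * (D + cosn D k)).
have /= := cosn_le D k.+1; have := cosn_le D k.
rewrite -!(ler_nat R) natrM natrD -/d /=.
have c2 := cosrS R k; have ch := cosr_half R k; have cb := cosr_bounds R k.
move: IH c2 ch cb; rewrite -[Num.sqrt _]/(cosr R k.+1).
have := ler0n R (Nat.sqrt (D * (D + cosn D k) %/ 2)).
move: (cosr R k) (cosr R k.+1) => c c'.
move: ((Nat.sqrt _)%:R : R) ((_ %/ 2)%:R : R) ((cosn D k)%:R : R) => r x ct r0.
have -> : k.+1%:R = k%:R + 1 :> R by rewrite natr1.
move: (k%:R : R) => kr; have dd := d100.
move=> IH c2 ch cb ctd rd H1 H2.
have k0 : 0 <= 10 * kr by apply: (le_trans _ IH).
have IH1 : ct - d * c <= 10 * kr by apply: (le_trans _ IH); rewrite ler_norm.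
have IH2 : d * c - ct <= 10 * kr by apply: (le_trans _ IH); rewrite distrC ler_norm.
have e2 : (d * c') ^+ 2 = d * (d + d * c) / 2 by rewrite exprMn c2; field.
have dc : d / 2 <= d * c' by nra.
have u1 : r ^+ 2 - (d * c') ^+ 2 <= d * (10 * kr) / 2.
  have h : d * (ct - d * c) <= d * (10 * kr) by nra.
  by rewrite e2; move: h H1 H2; lra.
have u2 : (d * c') ^+ 2 - r ^+ 2 <= d * (10 * kr) / 2 + 4 * d.
  have h : d * (d * c - ct) <= d * (10 * kr) by nra.
  by rewrite e2; move: h H1 H2 rd dd; lra.
move: e2 u1 u2 dc; move: (d * c') => y _ u1 u2 dc.
rewrite ler_norml; apply/andP; split; last exact: (sqr_gapr dd k0 r0 dc u1).
by rewrite lerNl opprB; apply: (sqr_gapl dd k0 r0 dc u2).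
Qed.

Variable K : nat.
Let N := (2 ^ K)%N.
Hypothesis K4 : (4 <= K)%N.

Lemma N16 : (16 <= N)%N.
Proof. by rewrite -[16%N]/(2 ^ 4)%N leq_exp2l. Qed.

Lemma K_le : (20 * K + 3 <= N ^ 2)%N.
Proof.
rewrite /N -expnM; have : exists i, K = (4 + i)%N by exists (K - 4)%N; lia.
case=> i ->; elim: i => // i IH.
have -> : ((4 + i.+1) * 2 = (4 + i) * 2 + 2)%N by lia.
rewrite expnD; lia.
Qed.

Lemma sinn_err k : (k <= K)%N -> `|(sinn D k)%:R - d * sinr R k| <= N%:R * e.
Proof.
move=> kK; have := sqrt_specR (D * D - cosn D k * cosn D k); rewrite -/(sinn D k).
have h := cosn_le D k; have h2 := sinn_le D k.
have := cosn_err k; have cs := cos_sin R k; have s0 := sinr_ge0 R k; have cb := cosr_bounds R k.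
rewrite natrB ?leq_mul // (natrM _ D) (natrM _ (cosn D k)) -/d.
move: h h2; rewrite -!(ler_nat R) -/d.
have : 20 * k%:R + 3 <= N%:R ^+ 2 :> R.
  by rewrite -natrX -natrM -natrD ler_nat; have := K_le; lia.
move: (cosr R k) (sinr R k) cs s0 cb (sinn _ _)%:R (cosn D k)%:R (k%:R) N%:R (ler0n R N) (ler0n R (cosn D k)) (ler0n R (sinn D k)).
move=> c s cs s0 cb st ct kr n n0 ct0 st0 kn ctd std cerr H.
have dd := d100.
have k0 : 0 <= 10 * kr by apply: (le_trans _ cerr).
have IH1 : ct - d * c <= 10 * kr by apply: (le_trans _ cerr); rewrite ler_norm.
have IH2 : d * c - ct <= 10 * kr by apply: (le_trans _ cerr); rewrite distrC ler_norm.
have h1 : d ^+ 2 * c ^+ 2 - ct ^+ 2 <= 20 * kr * d.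
  rewrite (_ : _ - _ = (d * c - ct) * (d * c + ct)); last by ring.
  apply: (@le_trans _ _ (10 * kr * (2 * d))); last by lra.
  by apply: (@le_trans _ _ (10 * kr * (d * c + ct))); [apply: ler_wpM2r|apply: ler_wpM2l]; nra.
have h2 : ct ^+ 2 - d ^+ 2 * c ^+ 2 <= 20 * kr * d.
  rewrite (_ : _ - _ = (ct - d * c) * (d * c + ct)); last by ring.
  apply: (@le_trans _ _ (10 * kr * (2 * d))); last by lra.
  by apply: (@le_trans _ _ (10 * kr * (d * c + ct))); [apply: ler_wpM2r|apply: ler_wpM2l]; nra.
have s2 : (d * s) ^+ 2 = d ^+ 2 - d ^+ 2 * c ^+ 2 by rewrite exprMn (_ : s ^+ 2 = 1 - c ^+ 2); [ring|rewrite -cs; ring].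
have ds0 : 0 <= d * s by rewrite mulr_ge0 //; lra.
have g : `|st ^+ 2 - (d * s) ^+ 2| <= n ^+ 2 * d.
  apply: (@le_trans _ _ ((20 * kr + 3) * d)); last by rewrite ler_wpM2r //; lra.
  rewrite s2 ler_norml; case/andP: H => H1 H2; apply/andP; split; lra.
have ne0 : 0 <= n * e by rewrite mulr_ge0 // ler0n.
rewrite -ler_sqr ?nnegrE // exprMn -de; apply: le_trans g.
rewrite expr2 (_ : st ^+ 2 - _ = (st - d * s) * (st + d * s)); last by ring.
rewrite normrM ler_wpM2l // [leRHS]ger0_norm; last by lra.
by rewrite ler_norml; apply/andP; split; lra.
Qed.
End TableErrors.

(** * The rounded transform decides Boolean convolution *)

Section FFTFacts.
Local Open Scope ring_scope.
Import Order.TTheory GRing.Theory Num.Theory.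

Variables (R : rcfType) (K : nat).
Hypothesis K4 : (4 <= K)%N.
Let N := (2 ^ K)%N.
Let De := (N ^ 16)%N.
Let D := (De * De)%N.
Local Notation C := R[i].
Let n : R := N%:R.
Let e : R := De%:R.
Let d : R := D%:R.

Lemma n16 : 16 <= n. Proof. by rewrite /n ler_nat N16. Qed.
Lemma n_gt0 : 0 < n. Proof. by apply: lt_le_trans n16. Qed.
Lemma enE : e = n ^+ 16. Proof. by rewrite /e /De natrX. Qed.
Lemma de2 : d = e ^+ 2. Proof. by rewrite /d /D natrM expr2. Qed.
Lemma De10 : (10 <= De)%N.
Proof.
apply: (@leq_trans (16 ^ 1)) => //; apply: leq_trans (leq_pexp2l _ (isT : 1 <= 16)%N); last by rewrite /N expn_gt0.
by rewrite leq_exp2r // N16.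
Qed.
Lemma D_gt0 : (0 < D)%N. Proof. by rewrite muln_gt0 !(ltn_trans _ De10). Qed.
Lemma e_ge : n ^+ 3 <= e.
Proof. by rewrite enE ler_weXn2l // (le_trans _ n16) // ler1n. Qed.
Lemma e_gt0 : 0 < e. Proof. by rewrite /e ltr0n (ltn_trans _ De10). Qed.

Let eo := 2 * n * e.

Lemma rootn_err sg k : `|sg| = 1 -> (k <= K)%N ->
  n1 (toC R (rootn D sg k) - rC d * om sg%:~R k) <= eo.
Proof.
move=> s1 kK; rewrite /n1 /= !mul0r subr0 addr0.
have h1 := cosn_err R De10 k; have h2 := sinn_err R De10 K4 kK.
have sR : `|sg%:~R| = 1 :> R by rewrite -intr_norm s1.
rewrite rmorphM /= -!pmulrn mulrCA -mulrBr normrM sR mul1r.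
apply: le_trans (lerD h1 h2) _; rewrite /eo.
have : 10 * k%:R <= n * e.
  rewrite mulrC; apply: ler_pM => //.
    rewrite /n ler_nat; apply: leq_trans kK _; exact: ltnW (ltn_expl _ _).
  by rewrite /e ler_nat De10.
by rewrite -/D -/d -/n -/e; lra.
Qed.

Lemma eo_le_d : eo <= d.
Proof.
rewrite /eo de2 expr2; apply: ler_wpM2r; first exact: ltW e_gt0.
apply: le_trans e_ge; have := n16; rewrite !exprS expr0 mulr1; nra.
Qed.

Lemma sgR_sq sg : `|sg| = 1 -> sg%:~R ^+ 2 = 1 :> R.
Proof.
move=> s1; rewrite -real_normK ?num_real // -intr_norm s1 expr1n //.
Qed.

Lemma om_n1 sg k : `|sg| = 1 -> n1 (om sg%:~R k : C) <= 2.
Proof. by move=> s1; apply/unit_n1/nrm2_om/sgR_sq. Qed.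

Lemma rootn_le3 sg k : `|sg| = 1 -> (k <= K)%N -> n1 (toC R (rootn D sg k)) <= 3 * d.
Proof.
move=> s1 kK; apply: (approx_le3 D_gt0 eo_le_d (om_n1 k s1)); exact: rootn_err.
Qed.

Lemma zz_n1 sg j : `|sg| = 1 -> n1 (zz K (om sg%:~R : nat -> C) j) <= 2.
Proof. by move=> s1; apply/unit_n1/nrm2_zz/sgR_sq. Qed.

Let c := 2 * eo + 2.

(** Each digit 1 of j costs one rounded multiplication, with e' <= 3 e + c; the bound increases in k
    and so also covers a digit 0. *)
Lemma zn_errk sg k j : `|sg| = 1 -> (k <= K)%N -> (j < 2 ^ k)%N ->
  n1 (toC R (zn D sg K j) - rC d * zz K (om sg%:~R) j) <= 4 ^+ k * c - c.
Proof.
move=> s1; elim: k j => [|k IH] j kK jk.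
  have -> : j = 0%N by move: jk; rewrite expn0; lia.
  have -> : toC R (zn D sg K 0) = rC d by rewrite zn0.
  by rewrite zz0 mulr1 expr0 mul1r !subrr /n1 /= normr0 addr0.
have c0 : 0 <= c by rewrite /c /eo !addr_ge0 // !mulr_ge0 // ltW // ?n_gt0 ?e_gt0.
have k1 : 1 <= 4 ^+ k :> R by rewrite exprn_ege1 // ler1n.
case: (ltnP j (2 ^ k)) => [jk'|jk'].
  apply: le_trans (IH j (ltnW kK) jk') _; rewrite exprS.
  have : 0 <= 4 ^+ k * c by rewrite mulr_ge0 // (le_trans _ k1).
  lra.
have [i ij] : exists i, j = (i + 2 ^ k)%N by exists (j - 2 ^ k)%N; lia.
have ik : (i < 2 ^ k)%N by move: jk; rewrite ij expnS; lia.
rewrite ij zn_add // zz_add // [zz _ _ _ * _]mulrC.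
apply: le_trans (gdiv_mul_err D_gt0 (rootn_le3 s1 (ltnW kK)) (rootn_err s1 (ltnW kK))
  (IH i (ltnW kK) ik) (zz_n1 i s1)) _.
have : c <= 4 ^+ k * c by rewrite ler_peMl.
have ec : eo * 2 + 2 = c by rewrite /c; ring.
by rewrite exprS; move: ec c0; move: c => c'; lra.
Qed.

Let ez := 5 * n ^+ 3 * e.

Lemma zn_err sg j : `|sg| = 1 -> (j < N)%N ->
  n1 (toC R (zn D sg K j) - rC d * zz K (om sg%:~R) j) <= ez.
Proof.
move=> s1 jN; apply: le_trans (zn_errk s1 (leqnn K) jN) _.
have -> : 4 ^+ K = n ^+ 2 :> R.
  by rewrite /n /N natrX -exprM mulnC exprM; congr (_ ^+ K); ring.
have c0 : 0 <= c by rewrite /c /eo !addr_ge0 // !mulr_ge0 // ltW // ?n_gt0 ?e_gt0.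
apply: (@le_trans _ _ (n ^+ 2 * c)); first by lra.
rewrite /ez (_ : 5 * n ^+ 3 * e = n ^+ 2 * (5 * n * e)); last by ring.
rewrite ler_wpM2l ?exprn_ge0 ?(ltW n_gt0) // /c /eo.
have h1 := n16; have : 10 <= e by rewrite /e ler_nat De10.
nra.
Qed.

Section Size.
Variable m : nat.
Hypotheses (m0 : (0 < m)%N) (mK : (m <= K)%N).
Let M := (2 ^ m)%N.

Lemma A_le_n2 : 4 ^+ m <= n ^+ 2 :> R.
Proof.
rewrite /n /N natrX -exprM mulnC exprM (_ : 2%:R ^+ 2 = 4); last by ring.
by rewrite ler_weXn2l // ler1n.
Qed.

(** This fixes the exponent of [De]: the left side is at most 160 n^13 e, and e = n^16 exceeds 160
    n^13 because n >= 16. *)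
Lemma ezHd : 32 * (4 ^+ m) ^+ 5 * ez < d.
Proof.
have A2 := A_le_n2; have h16 := n16; have n0 := n_gt0; have e0 := e_gt0.
apply: (@le_lt_trans _ _ (32 * (n ^+ 2) ^+ 5 * ez)).
  rewrite ler_wpM2r ?/ez ?mulr_ge0 ?exprn_ge0 // ?(ltW n0) ?(ltW e0) //.
  by rewrite ler_wpM2l // lerXn2r ?nnegrE ?exprn_ge0 // ltW.
rewrite de2 /ez (_ : 32 * _ * _ = e * (n ^+ 13 * 160)); last by ring.
rewrite expr2 [X in _ < _ * X]enE.
rewrite ltr_pM2l // (_ : n ^+ 16 = n ^+ 13 * n ^+ 3); last by ring.
rewrite ltr_pM2l ?exprn_gt0 // !exprS expr0 mulr1; nra.
Qed.

Lemma ez_ge1 : 1 <= ez.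
Proof.
rewrite /ez; have h : 1 <= n by have := n16; lra.
have e1 : 1 <= e by rewrite /e ler1n; apply: ltn_trans De10.
have n31 : 1 <= n ^+ 3 by apply: exprn_ege1.
by apply: mulr_ege1 => //; apply: mulr_ege1 => //; rewrite ler1n.
Qed.

Lemma ez_le_d : ez <= d.
Proof.
apply: le_trans (ltW ezHd); rewrite ler_peMl ?(le_trans ler01 ez_ge1) //.
by rewrite mulr_ege1 ?ler1n // !exprn_ege1 // ler1n.
Qed.

Let z := zz K (om 1%:~R : nat -> C).
Let y := zz K (om (-1)%:~R : nat -> C).
Let zt := zn D 1 K.
Let yt := zn D (-1) K.

Lemma half_lt_N j : (j < 2 ^ m.-1)%N -> (j < 2 ^ K.-1)%N.
Proof. by move=> h; apply: leq_trans h _; rewrite leq_exp2l //; lia. Qed.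

Lemma half_ltN j : (j < 2 ^ m.-1)%N -> (j < N)%N.
Proof. by move/half_lt_N => h; apply: leq_trans h _; rewrite leq_exp2l //; lia. Qed.

Lemma root_rel j (b : bool) : (j < 2 ^ m.-1)%N -> z (j * 2 + b)%N ^+ 2 = (-1) ^+ b * z j.
Proof.
move/half_lt_N; rewrite /z; case: K K4 => // k _ jk; apply: zz_sq => //.
  by apply: om0_sq; apply: sgR_sq.
by move=> i; apply: omS_sq; apply: sgR_sq.
Qed.

Lemma zyE j : z j * y j = 1.
Proof. by apply: zz_inv => i; rewrite mulrN1z; apply: om_conj. Qed.

Lemma zt_err j : (j < 2 ^ m.-1)%N -> n1 (toC R (zt j) - rC d * z j) <= ez.
Proof. by move/half_ltN; apply: zn_err. Qed.
Lemma yt_err j : (j < 2 ^ m.-1)%N -> n1 (toC R (yt j) - rC d * y j) <= ez.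
Proof. by move/half_ltN; apply: zn_err. Qed.

Variables a b : nat -> bool.
Hypothesis ab0 : forall i, (2 ^ m.-1 <= i)%N -> a i = false /\ b i = false.

Let f p : C := Complex (a p)%:R (b p)%:R.
(** Both sequences travel in one transform: the imaginary part of (a + i b)^2 is 2 a b, so a single
    squaring yields their convolution. *)
Definition gin p : gint := (D%:Z * (a p)%:Z, D%:Z * (b p)%:Z).

Lemma f_zero i : (2 ^ m.-1 <= i)%N -> f i = 0.
Proof. by move/ab0 => [h1 h2]; rewrite /f h1 h2. Qed.

Lemma f_n1 p : n1 (f p) <= 2.
Proof. by rewrite /n1 /=; case: (a p); case: (b p); rewrite ?normr1 ?normr0; lra. Qed.

Lemma gin_toC p : toC R (gin p) = rC d * f p.
Proof.
apply/eqP; rewrite eq_complex /= !(intrM _ (Posz D)) -!pmulrn.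
by rewrite !mul0r subr0 addr0 !eqxx.
Qed.

Definition gbd (g : gint) := (`|g.1| <= (D * D * N ^ 12)%N) && (`|g.2| <= (D * D * N ^ 12)%N).

Lemma gbdP g : n1 (toC R g) <= d ^+ 2 * (4 ^+ m) ^+ 6 -> gbd g.
Proof.
move=> h; have : n1 (toC R g) <= ((D * D * N ^ 12)%N%:Z)%:~R.
  apply: le_trans h _; rewrite -pmulrn (natrM _ (D * D)) natrX (natrM _ D D) -expr2.
  rewrite ler_wpM2l ?exprn_ge0 // ?ler0n // (_ : n ^+ 12 = (n ^+ 2) ^+ 6); last by ring.
  by rewrite lerXn2r ?nnegrE ?exprn_ge0 ?A_le_n2 // ler0n.
move=> {}h; rewrite /gbd -!(ler_int R) !intr_norm.
have := n1_Re (toC R g); have := n1_Im (toC R g); rewrite /= => h1 h2.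
by rewrite (le_trans h1 h) (le_trans h2 h).
Qed.

Lemma Im_sqconv p : complex.Im (sqconv f p) =
  \sum_(j < p.+1) (((a j && b (p - j)%N) + (b j && a (p - j)%N))%N)%:R.
Proof.
rewrite /sqconv (big_morph (@complex.Im R) (id1 := 0) (op1 := +%R)) //; last by case=> ? ? [].
apply: eq_bigr => j _; rewrite /f /=.
by case: (a j); case: (b j); case: (a _); case: (b _);
  rewrite /= ?mulr0 ?mul0r ?mulr1 ?addr0 ?add0r -?natrD.
Qed.

Lemma Im_nat (p k : nat) (x : C) : complex.Im (x *+ k) = complex.Im x *+ k.
Proof. by elim: k => [|k IH]; rewrite ?mulr0n // !mulrS -IH; case: x {IH} => u v; case: (_ *+ k). Qed.

(** At scale D the imaginary part is D S 2^m up to an error below D, where S counts the pairs in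
    both orders. A single pair gives S 2^m >= 2 because m > 0, hence a value above D, while S = 0
    gives one below D: the threshold [D] is exact. The other four facts are the size conditions for
    reading words back. *)
Theorem fft_facts :
  [/\ forall k p j, (k <= m)%N -> (p < M)%N -> (j < 2 ^ m.-1)%N ->
        gbd (gmul (zt j) (gfwds D m zt k gin p)),
      forall p, (p < M)%N -> gbd (gmul (gfwds D m zt m gin p) (gfwds D m zt m gin p)),
      forall k p q j, (k <= m)%N -> (p < M)%N -> (q < M)%N -> (j < 2 ^ m.-1)%N ->
        gbd (gmul (yt j) (gsub (ginvs D yt k (gsqs D m zt gin) p)
                               (ginvs D yt k (gsqs D m zt gin) q))),
      forall p, (p < M)%N -> gbd (ginvs D yt m (gsqs D m zt gin) p) &
      forall p, (p < M)%N -> (D%:Z <= (ginvs D yt m (gsqs D m zt gin) p).2) =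
        [exists j : 'I_p.+1, a j && b (p - j)%N]].
Proof.
have z2 j : n1 (z j) <= 2 by apply: zz_n1.
have y2 j : n1 (y j) <= 2 by apply: zz_n1.
have fE p : (p < M)%N -> toC R (gin p) = rC d * f p by rewrite gin_toC.
have f2 p : (p < M)%N -> n1 (f p) <= 2 by move=> _; apply: f_n1.
split.
- move=> k p j km pM jm; apply: gbdP.
  exact: (gfwds_small D_gt0 zt_err z2 ez_le_d m0 ez_ge1 ezHd fE f2).
- move=> p pM; apply: gbdP.
  exact: (gsqs_small D_gt0 zt_err z2 ez_le_d m0 ez_ge1 ezHd fE f2).
- move=> k p q j km pM qM jm; apply: gbdP.
  exact: (ginvs_small D_gt0 zt_err yt_err z2 y2 ez_le_d m0 ez_ge1 ezHd fE f2).
- move=> p pM; apply: gbdP.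
  exact: (ginvs_last_small D_gt0 zt_err yt_err z2 y2 ez_le_d m0 ez_ge1 ezHd fE f2).
move=> p pM.
have [_ h] := ginvs_approxE D_gt0 zt_err yt_err z2 y2 ez_le_d m0 ez_ge1 ezHd fE f2 (leqnn m) pM.
have := le_lt_trans (le_trans (n1_Im _) h) ezHd.
rewrite (@fft_square _ m z y (fun j => z j ^+ 2) _ _ _ _ f) //; first last.
- exact: f_zero.
- by move=> j _; apply: zyE.
- by move=> j jm; rewrite -addn1 (root_rel true) // expr1 mulN1r.
- by move=> j jm; rewrite -[(j * 2)%N]addn0 (root_rel false) // expr0 mul1r.
set g := ginvs _ _ _ _ _.
have -> : complex.Im (toC R g - rC d * (sqconv f p *+ 2 ^ m)) =
    g.2%:~R - d * (complex.Im (sqconv f p) *+ 2 ^ m).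
  by rewrite -Im_nat //; case: (_ *+ _) => u v; rewrite /= mul0r addr0.
rewrite Im_sqconv -natr_sum -mulrnA.
set S := (\sum_(j < p.+1) _)%N.
have d0 : 0 < d by rewrite ltr0n D_gt0.
rewrite ltr_norml => /andP[h1 h2].
case: (boolP [exists j : 'I_p.+1, a j && b (p - j)%N]) => [/existsP[j abj]|/existsPn none].
  have S1 : (2 <= S * 2 ^ m)%N.
    have : (0 < S)%N by rewrite /S (bigD1 j) //= abj.
    have : (2 ^ 1 <= 2 ^ m)%N by rewrite leq_exp2l.
    by clear; nia.
  have : 2%:R <= (S * 2 ^ m)%:R :> R by rewrite ler_nat.
  move=> S2; have : d * 2 <= d * (S * 2 ^ m)%:R by rewrite ler_pM2l.
  move=> S3; rewrite -(ler_int R) -pmulrn -/d; lra.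
have S0 : S = 0%N.
  rewrite /S big1 // => j _; have := none j; have jp : (p - j < p.+1)%N by lia.
  have := none (Ordinal jp) => /=; rewrite subKn; last by rewrite -ltnS.
  by move=> /negbTE h3 /negbTE h4; rewrite h4 andbC h3.
apply/negbTE; rewrite -ltNge -(ltr_int R) -pmulrn -/d.
by move: h2; rewrite S0 mul0n mulr0; lra.
Qed.

End Size.

Lemma table_small sg k j : `|sg| = 1 -> (k < K)%N -> (j < 2 ^ k)%N ->
  gbd (gmul (rootn D sg k) (zn D sg K j)).
Proof.
move=> s1 kK jk; apply: (@gbdP K) => //; rewrite toC_mul; apply: le_trans (n1M _ _) _.
have jN : (j < N)%N by apply: ltn_trans jk _; rewrite ltn_exp2l.
have h1 := rootn_le3 s1 (ltnW kK).
have h2 := approx_le3 D_gt0 (ez_le_d (leqnn K)) (zz_n1 j s1) (zn_err s1 jN).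
apply: (@le_trans _ _ ((3 * d) * (3 * d))); first by apply: ler_pM; rewrite ?n1_ge0.
rewrite (_ : _ * _ = d ^+ 2 * 9); last by ring.
rewrite ler_wpM2l ?exprn_ge0 ?ler0n //.
have h4 : 4 ^+ 4 <= 4 ^+ K :> R by rewrite ler_weXn2l // ler1n.
apply: (@le_trans _ _ (4 ^+ 4)); first by lra.
by apply: le_trans h4 _; rewrite ler_eXnr // exprn_ege1 // ler1n.
Qed.

End FFTFacts.

(** * Gaussian integers as words *)

Section Encoding.
Import Order.TTheory GRing.Theory Num.Theory.

(* [H] is a square root of -1 modulo [H^2 + 1], so a Gaussian integer fits in one
   word and the ring operations become modular arithmetic; [4 * D * Hd] leaves
   room to read off both coordinates when they are at most [D * Hd]. *)
Variables (D Hd : nat).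
Hypotheses (D0 : 0 < D) (Hd0 : 0 < Hd).
Definition encH := 4 * (D * Hd).
Definition encM := encH * encH + 1.
Let H := encH.
Let M0 := encM.

Definition enc (g : gint) : nat := `|((g.1 + g.2 * Posz H) %% Posz M0)%Z|%N.

Lemma M0_gt0 : 0 < M0. Proof. by rewrite /M0 /encM addn1. Qed.
Lemma H_gt0 : 0 < H. Proof. by rewrite /H /encH !muln_gt0 D0 Hd0. Qed.

Lemma encE g : Posz (enc g) = ((g.1 + g.2 * Posz H) %% Posz M0)%Z.
Proof. by rewrite /enc gez0_abs // modz_ge0 // -lt0n M0_gt0. Qed.

Lemma enc_lt g : enc g < M0.
Proof. by rewrite -ltz_nat encE ltz_pmod // ltz_nat M0_gt0. Qed.

Lemma enc_nat (g : gint) w : Posz w = (g.1 + g.2 * Posz H)%R -> w %% M0 = enc g.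
Proof. by move=> e; apply/eqP; rewrite -eqz_nat encE -e modz_nat. Qed.

Lemma enc_add a b : (enc a + enc b) %% M0 = enc (gadd a b).
Proof.
apply/eqP; rewrite -eqz_nat -modz_nat PoszD !encE modzDm /=.
by apply/eqP; congr (modz _ _); ring.
Qed.

Lemma enc_sub a b : (enc a + (M0 - enc b)) %% M0 = enc (gsub a b).
Proof.
apply/eqP; rewrite -eqz_nat -modz_nat PoszD -subzn ?(ltnW (enc_lt b)) // !encE /=.
rewrite addrCA modzDl modzDml -modzDmr modzNm modzDmr.
by apply/eqP; congr (modz _ _); ring.
Qed.

Lemma enc_mul a b : (enc a * enc b) %% M0 = enc (gmul a b).
Proof.
apply/eqP; rewrite -eqz_nat -modz_nat PoszM !encE modzMm /=.
rewrite (_ : _ * _ = (a.2 * b.2) * Posz M0 + ((a.1 * b.1 - a.2 * b.2) + (a.1 * b.2 + a.2 * b.1) * Posz H))%R.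
  by rewrite modzMDl.
by rewrite /M0 /encM PoszD PoszM; ring.
Qed.

(** Moves both coordinates up by D * Hd, which makes them nonnegative, so that division by H
    separates them. As the shift is a multiple of D, flooring by D turns it into exactly Hd, and
    [encoff2] takes this away modulo [M0]. *)
Definition encoff1 := (D * Hd) * (H + 1).
Definition encoff2 := M0 - Hd * (H + 1).

Definition inbox (g : gint) := ((`|g.1| <= Posz (D * Hd)) && (`|g.2| <= Posz (D * Hd)))%R.

Lemma enc_split g : inbox g -> exists x y, [/\
  (enc g + encoff1) %% M0 = x + y * H, x < H,
  Posz x = (g.1 + Posz (D * Hd))%R & Posz y = (g.2 + Posz (D * Hd))%R].
Proof.
case/andP; rewrite !ler_norml => /andP[a1 a2] /andP[b1 b2].
exists `|(g.1 + Posz (D * Hd))%R|%N, `|(g.2 + Posz (D * Hd))%R|%N.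
have DH : 0 < D * Hd by rewrite muln_gt0 D0 Hd0.
have ex : Posz `|(g.1 + Posz (D * Hd))%R| = (g.1 + Posz (D * Hd))%R.
  by rewrite gez0_abs // -lerBlDr sub0r.
have ey : Posz `|(g.2 + Posz (D * Hd))%R| = (g.2 + Posz (D * Hd))%R.
  by rewrite gez0_abs // -lerBlDr sub0r.
have xH : `|(g.1 + Posz (D * Hd))%R| < H by rewrite -ltz_nat ex /H /encH; lia.
have yH : (`|(g.2 + Posz (D * Hd))%R| < H)%N by rewrite -ltz_nat ey /H /encH; lia.
split=> //; apply/eqP; rewrite -eqz_nat -modz_nat PoszD encE modzDml.
rewrite (_ : _ + Posz encoff1 = Posz (`|(g.1 + Posz (D * Hd))%R| + `|(g.2 + Posz (D * Hd))%R| * H))%R.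
  rewrite modz_nat modn_small // /M0 /encM -/H; move: xH yH; clear.
  by move: `|_|%N `|_|%N => x y; nia.
by rewrite PoszD (PoszM _ H) ex ey /encoff1 (PoszM (D * Hd)) (PoszD H); ring.
Qed.

Lemma enc_rescale g : inbox g -> let w := (enc g + encoff1) %% M0 in
  (w %% H %/ D + (w %/ H %/ D) * H + encoff2) %% M0 = enc (gdiv D g).
Proof.
move=> /enc_split[x [y [-> xH ex ey]]] /=.
have -> : (x + y * H) %% H = x by rewrite addnC modnMDl modn_small.
have -> : (x + y * H) %/ H = y by rewrite addnC divnMDl ?H_gt0 // divn_small // addn0.
have d0 : Posz D != 0%R by rewrite eqz_nat -lt0n.
have h2 : Hd * (H + 1) <= M0.
  have : 2 * Hd <= H by rewrite /H /encH; nia.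
  by rewrite /M0 /encM -/H; have := H_gt0; nia.
have dv (t : nat) (u : int) : Posz t = (u + Posz (D * Hd))%R ->
    Posz (t %/ D) = ((u %/ Posz D)%Z + Posz Hd)%R.
  by move=> e; rewrite -divz_nat e PoszM mulrC addrC divzMDl // addrC.
apply/eqP; rewrite -eqz_nat -modz_nat !PoszD PoszM (dv _ _ ex) (dv _ _ ey) encE /=.
rewrite /encoff2 -subzn // PoszM PoszD.
rewrite (_ : _ + (Posz M0 - _) = Posz M0 + ((g.1 %/ Posz D)%Z + (g.2 %/ Posz D)%Z * Posz H))%R; last by ring.
by rewrite modzDl.
Qed.

Lemma enc_im g : inbox g -> let w := (enc g + encoff1) %% M0 in
  (D + D * Hd <= w %/ H) = (Posz D <= g.2)%R.
Proof.
move=> /enc_split[x [y [-> xH ex ey]]] /=.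
have -> : (x + y * H) %/ H = y by rewrite addnC divnMDl ?H_gt0 // divn_small // addn0.
by rewrite -lez_nat ey PoszD lerD2r.
Qed.

End Encoding.

(** * Boolean convolution *)

Notation "e1 +e e2" := (Bin Oadd e1 e2) (at level 50, left associativity).
Notation "e1 -e e2" := (Bin Osub e1 e2) (at level 50, left associativity).
Notation "e1 *e e2" := (Bin Omul e1 e2) (at level 40, left associativity).
Notation "e1 /e e2" := (Bin Odiv e1 e2) (at level 40, left associativity).
Notation "e1 %e e2" := (Bin Omod e1 e2) (at level 40, left associativity).
Notation "x ::= e" := (Asn x e) (at level 70).
Notation "c1 ;;; c2" := (Seq c1 c2) (at level 90, right associativity).

Lemma updE m a v x : upd m a v x = if x == a then v else m x. Proof. by []. Qed.

Definition same k (s s' : store) := forall x, x < k -> s' x = s x.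

Definition blit (h : store) da n (F : nat -> nat) a :=
  if da <= a < da + n then F (a - da) else h a.

Lemma blit_in h da n F i : i < n -> blit h da n F (da + i) = F i.
Proof. by move=> Hi; rewrite /blit leq_addr ltn_add2l Hi addKn. Qed.

Lemma blit_out h da n F a : ~~ (da <= a < da + n) -> blit h da n F a = h a.
Proof. by rewrite /blit => /negbTE ->. Qed.

Section Map.

Variable B : nat.

Definition MAP d l c := For 50 (Var l) (c ;;; Sto (Var d +e Var 50) (Var 51)).

(** The body sees a heap whose first i target cells are already overwritten, so each use has to show
    that its reads avoid them. *)
Lemma wp_map d l c n da t F s h : d < 50 -> l < 50 -> s d = da -> s l = n ->
  da + n <= B -> n < B -> (forall i, i < n -> F i < B) ->
  (forall i s' h', i < n -> same 50 s s' -> s' 50 = i ->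
     (forall a, h' a = blit h da i F a) ->
     wp B c t (fun s'' h'' => [/\ same 51 s' s'', s'' 51 = F i & h'' = h']) s' h') ->
  wp B (MAP d l c) (n * (t + 3) + 2)
    (fun s' h' => same 50 s s' /\ forall a, h' a = blit h da n F a) s h.
Proof.
move=> d50 l50 sd sl daB nB FB Hc.
pose I i (s' h' : store) := same 50 s s' /\ forall a, h' a = blit h da i F a.
have -> : t + 3 = (t + 1) + 2 by lia.
apply: (@wp_for_unif _ _ _ _ _ (t + 1) I) => //.
- split=> [x x50|a]; first by rewrite updE (ltn_eqF x50).
  by rewrite /blit addn0 ifF //; lia.
- by move=> i s' h' _ [sm _] _; rewrite /= sm.
move=> i s' h' iln [sm hh] s50.
apply: (@wp_seq _ _ _ t 1) => //.
apply: (wp_conseq (Hc i s' h' iln sm s50 hh)) => // s2 h2 [sm2 r ->].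
have e1 : s2 50 = i by rewrite sm2.
have e2 : s2 d = da by rewrite sm2 ?sm //; lia.
apply: wp_sto; rewrite /= ?e1 ?e2 ?r //; first lia.
  exact: FB.
split=> //; split=> [x x50|a].
  by rewrite updE (ltn_eqF x50) sm2 ?sm //; lia.
rewrite updE hh /blit; case: (eqVneq a (da + i)) => [->|ne].
  by rewrite ifT ?addKn //; lia.
by have -> : (da <= a < da + i.+1) = (da <= a < da + i) by lia.
Qed.

End Map.

(** Both ends of a butterfly read the old values, so a stage is computed into the second buffer and
    copied back. *)
Definition COPY := MAP 7 13 (51 ::= Deref (Var 8 +e Var 50)).

Definition RESCALE := 51 ::= (Var 54 %e Var 3 /e Var 4 +e Var 54 /e Var 3 /e Var 4 *e Var 3 +e Var 6) %e Var 2.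

Definition FBODY :=
  52 ::= Var 50 /e Var 42 %e Cst 2 ;;;
  53 ::= Deref (Var 9 +e Var 50 /e (Var 42 *e Cst 2)) ;;;
  If (Var 52)
    (54 ::= (Deref (Var 7 +e Var 50) *e Var 53 +e Var 5) %e Var 2 ;;;
     RESCALE ;;;
     51 ::= (Deref (Var 7 +e (Var 50 -e Var 42)) +e (Var 2 -e Var 51)) %e Var 2)
    (54 ::= (Deref (Var 7 +e (Var 50 +e Var 42)) *e Var 53 +e Var 5) %e Var 2 ;;;
     RESCALE ;;;
     51 ::= (Deref (Var 7 +e Var 50) +e Var 51) %e Var 2).

Definition IBODY :=
  52 ::= Var 50 /e Var 42 %e Cst 2 ;;;
  If (Var 52)
    (53 ::= Deref (Var 10 +e Var 50 /e (Var 42 *e Cst 2)) ;;;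
     54 ::= ((Deref (Var 7 +e (Var 50 -e Var 42)) +e (Var 2 -e Deref (Var 7 +e Var 50))) *e Var 53 +e Var 5) %e Var 2 ;;;
     RESCALE)
    (51 ::= (Deref (Var 7 +e Var 50) +e Deref (Var 7 +e (Var 50 +e Var 42))) %e Var 2).

Definition SBODY :=
  54 ::= (Deref (Var 7 +e Var 50) *e Deref (Var 7 +e Var 50) +e Var 5) %e Var 2 ;;;
  RESCALE.

(** The word of D (a + i b), with the two halves of the block as a and b. Positions from half the
    length on are zero, so the square does not wrap around. *)
Definition GBODY :=
  If (Var 13 /e Cst 2 -e Var 50)
    (51 ::= (Var 4 *e Deref (Var 12 +e Var 50) +e
             Var 4 *e Deref (Var 12 +e Var 13 /e Cst 2 +e Var 50) *e Var 3) %e Var 2)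
    (51 ::= Cst 0).

(** Register 11 is the threshold [D] raised by the shift D * Hd of the coordinates, so the
    comparison is made directly on the quotient by [H]. *)
Definition OBODY :=
  54 ::= (Deref (Var 7 +e Var 50) +e Var 5) %e Var 2 ;;;
  If (Var 54 /e Var 3 +e Cst 1 -e Var 11)
    (If (Var 15 +e Cst 1 -e Var 50 %e Var 14) (51 ::= Cst 1) (51 ::= Cst 0))
    (51 ::= Cst 0).

(* Registers: 2, 3, 4 hold [M0], [H], [D]; 5, 6 the offsets of the encoding; 7, 8
   the two transform buffers; 9, 10 the tables of roots and of inverse roots; the
   arguments 12, 13, 14, 15 are the base and the length of the block, whose halves
   are convolved, and [Qm], [q]: entries with index above [q] modulo [Qm] are cleared. *)
Definition CONV :=
  MAP 7 13 GBODY ;;;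
  42 ::= Var 13 /e Cst 2 ;;;
  While (Var 42) ((MAP 8 13 FBODY ;;; COPY) ;;; 42 ::= Var 42 /e Cst 2) ;;;
  MAP 7 13 SBODY ;;;
  42 ::= Cst 1 ;;;
  While (Var 13 -e Var 42) ((MAP 8 13 IBODY ;;; COPY) ;;; 42 ::= Var 42 *e Cst 2) ;;;
  MAP 12 13 OBODY.

(* Scale of the fixed-point arithmetic: the square of a power of the transform
   length that exceeds the accumulated error, and the headroom for overflow. *)
Definition fft_D K := (2 ^ K) ^ 16 * (2 ^ K) ^ 16.
Definition fft_Hd K := (2 ^ K) ^ 12 * fft_D K.

Section Conv.

Variables (B K : nat).
Hypothesis K4 : 3 < K.
Local Notation N := (2 ^ K).
Local Notation D := (fft_D K).
Local Notation Hd := (fft_Hd K).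
Local Notation H := (encH D Hd).
Local Notation M0 := (encM D Hd).
Local Notation enc := (enc D Hd).
Variables (bx bx2 bz by_ : nat).
Hypothesis regions : [&& bx + N <= bx2, bx2 + N <= bz, bz + N <= by_ & by_ + N <= B].
Hypothesis M0B : M0 < B.

Definition fft_env (s : store) :=
  [/\ s 2 = M0, s 3 = H, s 4 = D, s 5 = encoff1 D Hd & s 6 = encoff2 D Hd] /\
  [/\ s 7 = bx, s 8 = bx2, s 9 = bz, s 10 = by_ & s 11 = D + D * Hd].

Definition fft_tables (h : store) := forall j, j < N ->
  h (bz + j) = enc (zn D 1 K j) /\ h (by_ + j) = enc (zn D (-1)%R K j).

Lemma DD_gt0 : 0 < D. Proof. by rewrite /fft_D muln_gt0 !expn_gt0. Qed.
Lemma Hd_gt0 : 0 < Hd. Proof. by rewrite /fft_Hd muln_gt0 !expn_gt0 DD_gt0. Qed.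

Lemma gbd_inbox g : gbd K g -> inbox D Hd g.
Proof. by rewrite /inbox (_ : D * Hd = D * D * N ^ 12) //; rewrite /fft_Hd mulnCA mulnC. Qed.

Lemma MB v : v %% M0 < B.
Proof. by apply: ltn_trans M0B; rewrite ltn_mod M0_gt0. Qed.

Lemma fft_env_same s s' : same 40 s s' -> fft_env s -> fft_env s'.
Proof. by move=> sm [[? ? ? ? ?] [? ? ? ? ?]]; split; split; rewrite sm. Qed.

Lemma same_trans k s1 s2 s3 : same k s1 s2 -> same k s2 s3 -> same k s1 s3.
Proof. by move=> h1 h2 x xk; rewrite h2 ?h1. Qed.

Lemma same_le k k' s s' : k <= k' -> same k' s s' -> same k s s'.
Proof. by move=> kk h x xk; apply: h; apply: leq_trans xk kk. Qed.

Lemma rescale_ok g t Q s h : fft_env s -> s 54 = (enc g + encoff1 D Hd) %% M0 ->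
  inbox D Hd g -> Q (upd s 51 (enc (gdiv D g))) h -> wp B RESCALE t.+1 Q s h.
Proof.
move=> [[e2 e3 e4 e5 e6] _] e54 ib q; apply: wp_asn; rewrite /= ?e2 ?e3 ?e4 ?e6 ?e54.
  exact: MB.
by move=> v ->; rewrite (enc_rescale DD_gt0 Hd_gt0 ib).
Qed.

Variables (m : nat).
Hypotheses (m0 : 0 < m) (mK : m <= K).
Local Notation M := (2 ^ m).
Local Notation zt := (zn D 1 K).
Local Notation yt := (zn D (-1)%R K).

Lemma M_le_N : M <= N. Proof. by rewrite leq_exp2l. Qed.

Lemma M_le_B : M <= B.
Proof. by apply: leq_trans M_le_N _; case/and4P: regions; lia. Qed.

Definition holds (h : store) b (X : nat -> gint) := forall p, p < M -> h (b + p) = enc (X p).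

Lemma enc_off g v : v %% M0 = enc g -> (v + encoff1 D Hd) %% M0 = (enc g + encoff1 D Hd) %% M0.
Proof. by move=> <-; rewrite modnDml. Qed.

Lemma fbody_ok k X s h i : k < m -> fft_env s -> fft_tables h -> s 42 = 2 ^ k -> s 50 = i ->
  i < M -> holds h bx X ->
  (forall p j, p < M -> j < 2 ^ m.-1 -> inbox D Hd (gmul (zt j) (X p))) ->
  wp B FBODY 6 (fun s' h' => [/\ same 51 s s', s' 51 = enc (gfwd D zt (2 ^ k) X i) & h' = h]) s h.
Proof.
move=> km en tb e42 e50 iM hX ib.
have [[e2 e3 e4 e5 e6] [e7 e8 e9 e10 e11]] := en.
have [jm p1 p2] := stage_pos km iM.
have jN : i %/ (2 ^ k * 2) < N.
  by apply: leq_trans jm (leq_trans _ M_le_N); rewrite leq_exp2l // leq_pred.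
have iB : i < B by apply: leq_trans iM M_le_B.
have encB g : enc g < B by apply: ltn_trans (enc_lt _ _ _) M0B.
have tz := (tb _ jN).1.
apply: wp_seq_asn; first by rewrite /= e50 e42; apply: leq_ltn_trans (leq_mod _ _) _; apply: leq_ltn_trans (leq_div _ _) iB.
move=> v52 E52; rewrite /= e50 e42 modn2 in E52.
apply: wp_seq_asn; rewrite /= !updE /= e50 e42 e9 tz; first exact: encB.
move=> v53 E53; rewrite /gfwd.
apply: wp_if; rewrite /= !updE /= E52 ?eqb0 ?negbK => od.
  rewrite od; set g := gmul _ _; have ig : inbox D Hd g by apply: ib.
  apply: wp_seq_asn; rewrite /= !updE /= e50 e2; first exact: MB.
  rewrite e5 e7 hX // E53 (enc_off (g := g)); last by rewrite mulnC enc_mul.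
  move=> v54 E54.
  apply: (@wp_seq _ _ _ 1 1) => //; apply: (@rescale_ok g) => //.
    apply: wp_asn; rewrite /= !updE /= e2; first exact: MB.
    rewrite e50 e42 e7 hX // => v ->; rewrite enc_sub; split=> // x x51.
    by rewrite !updE !(ltn_eqF (leq_trans x51 _)).
have od' : odd (i %/ 2 ^ k) = false by move: od; case: odd.
have pM := p2 (negbT od').
rewrite od'; set g := gmul _ _; have ig : inbox D Hd g by apply: ib.
apply: wp_seq_asn; rewrite /= !updE /= e50 e42 e2; first exact: MB.
rewrite e5 e7 hX // E53 (enc_off (g := g)); last by rewrite mulnC enc_mul.
move=> v54 E54.
apply: (@wp_seq _ _ _ 1 1) => //; apply: (@rescale_ok g) => //.
  apply: wp_asn; rewrite /= !updE /= e2; first exact: MB.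
  rewrite e50 e7 hX // => v ->; rewrite enc_add; split=> // x x51.
  by rewrite !updE !(ltn_eqF (leq_trans x51 _)).
Qed.

Lemma ibody_ok k X s h i : k < m -> fft_env s -> fft_tables h -> s 42 = 2 ^ k -> s 50 = i ->
  i < M -> holds h bx X ->
  (forall p q j, p < M -> q < M -> j < 2 ^ m.-1 -> inbox D Hd (gmul (yt j) (gsub (X p) (X q)))) ->
  wp B IBODY 6 (fun s' h' => [/\ same 51 s s', s' 51 = enc (ginv D yt (2 ^ k) X i) & h' = h]) s h.
Proof.
move=> km en tb e42 e50 iM hX ib.
have [[e2 e3 e4 e5 e6] [e7 e8 e9 e10 e11]] := en.
have [jm p1 p2] := stage_pos km iM.
have jN : i %/ (2 ^ k * 2) < N.
  by apply: leq_trans jm (leq_trans _ M_le_N); rewrite leq_exp2l // leq_pred.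
have iB : i < B by apply: leq_trans iM M_le_B.
have encB g : enc g < B by apply: ltn_trans (enc_lt _ _ _) M0B.
have ty := (tb _ jN).2.
apply: wp_seq_asn; first by rewrite /= e50 e42; apply: leq_ltn_trans (leq_mod _ _) _; apply: leq_ltn_trans (leq_div _ _) iB.
move=> v52 E52; rewrite /= e50 e42 modn2 in E52.
rewrite /ginv.
apply: wp_if; rewrite /= !updE /= E52 ?eqb0 ?negbK => od.
  rewrite od; set g := gmul _ _; have ig : inbox D Hd g by apply: ib.
  apply: wp_seq_asn; rewrite /= !updE /= e50 e42 e10 ty; first exact: encB.
  move=> v53 E53.
  apply: wp_seq_asn; rewrite /= !updE /= e50 e42 e2; first exact: MB.
  rewrite e5 e7 !hX // E53 (enc_off (g := g)); last first.
    by rewrite mulnC -modnMmr enc_sub enc_mul.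
  move=> v54 E54.
  apply: (@rescale_ok g) => //.
    by split=> // x x51; rewrite !updE !(ltn_eqF (leq_trans x51 _)).
have od' : odd (i %/ 2 ^ k) = false by move: od; case: odd.
have pM := p2 (negbT od').
rewrite od'; apply: wp_asn; rewrite /= !updE /= e2; first exact: MB.
rewrite e50 e42 e7 !hX // => v ->; rewrite enc_add; split=> // x x51.
by rewrite !updE !(ltn_eqF (leq_trans x51 _)).
Qed.

Lemma sbody_ok (X : nat -> gint) s h i : fft_env s -> s 50 = i -> h (bx + i) = enc (X i) ->
  inbox D Hd (gmul (X i) (X i)) ->
  wp B SBODY 2 (fun s' h' => [/\ same 51 s s', s' 51 = enc (gdiv D (gmul (X i) (X i))) & h' = h]) s h.
Proof.
move=> en e50 hX ib.
have [[e2 e3 e4 e5 e6] [e7 e8 e9 e10 e11]] := en.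
apply: wp_seq_asn; rewrite /= e50 e2; first exact: MB.
rewrite e5 e7 hX (enc_off (g := gmul (X i) (X i))); last by rewrite enc_mul.
move=> v54 E54; apply: (@rescale_ok (gmul (X i) (X i))) => //.
by split=> // x x51; rewrite !updE !(ltn_eqF (leq_trans x51 _)).
Qed.

Definition frame_out lo hi (h h' : store) := forall a, ~~ (lo <= a < hi) -> h' a = h a.

Lemma encB g : enc g < B. Proof. by apply: ltn_trans (enc_lt _ _ _) M0B. Qed.

Lemma stage_copy c t F s h : fft_env s -> s 13 = M ->
  (forall i s' h', i < M -> same 50 s s' -> s' 50 = i -> frame_out bx2 (bx2 + N) h h' ->
     wp B c t (fun s'' h'' => [/\ same 51 s' s'', s'' 51 = enc (F i) & h'' = h']) s' h') ->
  wp B (MAP 8 13 c ;;; COPY) (M * (t + 7) + 4)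
    (fun s' h' => [/\ same 50 s s', holds h' bx F & frame_out bx (bx2 + N) h h']) s h.
Proof.
move=> en e13 Hc; have [_ [e7 e8 _ _ _]] := en; have MN := M_le_N.
have [r1 r2 r3 r4] := and4P regions.
have MB' : M < B by apply: leq_ltn_trans MN _; apply: leq_trans r4; case/and4P: regions; have := expn_gt0 2 K; lia.
apply: (@wp_seq _ _ _ (M * (t + 3) + 2) (M * 4 + 2)); last by lia.
have out1 i h' : i <= M -> (forall a, h' a = blit h bx2 i (fun p => enc (F p)) a) ->
    frame_out bx2 (bx2 + N) h h'.
  by move=> iM hh a out; rewrite hh blit_out //; lia.
apply: (wp_conseq (@wp_map B 8 13 c M bx2 t (fun p => enc (F p)) s h _ _ e8 e13 _ MB' _ _)) => //; try lia.
- by move=> i _; apply: encB.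
- by move=> i s' h' iM sm e50 hh; apply: Hc => //; apply: out1 hh; exact: ltnW.
move=> s1 h1 [sm hh].
apply: (wp_conseq (@wp_map B 7 13 _ M bx 1 (fun p => enc (F p)) s1 h1 _ _ _ _ _ MB' _ _)) => //; try lia.
- by rewrite sm.
- by rewrite sm.
- by move=> i _; apply: encB.
- move=> i s' h' iM sm' e50 hh'.
  have E : h' (s' 8 + s' 50) = enc (F i).
    by rewrite e50 sm' // sm // e8 hh' blit_out ?hh ?blit_in //; lia.
  apply: wp_asn; rewrite /= E; first exact: encB.
  by move=> v ->; split=> // x x51; rewrite updE (ltn_eqF x51).
move=> s2 h2 [sm2 hh2]; split.
- exact: same_trans sm sm2.
- by move=> p pM; rewrite hh2 blit_in.
by move=> a out; rewrite hh2 blit_out ?hh ?blit_out //; lia.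
Qed.

Variables (ba : nat) (fa fb : nat -> bool) (Qm q : nat).
Hypothesis ba_r : (by_ + N <= ba) && (ba + M <= B).
Hypothesis fab0 : forall i, 2 ^ m.-1 <= i -> fa i = false /\ fb i = false.
Hypotheses (Q0 : 0 < Qm) (qB : q.+1 < B).

Lemma M_half : M = 2 ^ m.-1 + 2 ^ m.-1.
Proof. by rewrite -{1}(prednK m0) expnS; lia. Qed.

Lemma half_M : M %/ 2 = 2 ^ m.-1.
Proof. by rewrite M_half addnn -muln2 mulnK. Qed.

Definition conv_env (s : store) := [/\ fft_env s, s 12 = ba, s 13 = M, s 14 = Qm & s 15 = q].

Definition conv_in (h : store) := forall p, p < 2 ^ m.-1 ->
  h (ba + p) = fa p /\ h (ba + 2 ^ m.-1 + p) = fb p.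

Local Notation F0 := (gin K fa fb).

Lemma gbody_ok s h i : conv_env s -> s 50 = i -> i < M -> conv_in h ->
  wp B GBODY 2 (fun s' h' => [/\ same 51 s s', s' 51 = enc (F0 i) & h' = h]) s h.
Proof.
move=> [[[e2 e3 e4 e5 e6] _] e12 e13 e14 e15] e50 iM hin.
apply: wp_if; rewrite /= e13 e50 half_M => cnd.
  have im : i < 2 ^ m.-1 by rewrite -subn_gt0 lt0n.
  have [ha hb] := hin _ im.
  apply: wp_asn; rewrite /= e2; first exact: MB.
  rewrite e3 e4 e12 e13 half_M e50 ha hb => v ->; split=> //.
    by move=> x x51; rewrite updE (ltn_eqF x51).
  by rewrite updE /=; apply: enc_nat; rewrite PoszD !PoszM.
have im : 2 ^ m.-1 <= i by rewrite -subn_eq0; apply/eqP.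
apply: wp_asn => /=; first by apply: leq_ltn_trans M0B.
move=> v ->; split=> //; first by move=> x x51; rewrite updE (ltn_eqF x51).
rewrite updE /= /gin; have [-> ->] := fab0 im; rewrite !GRing.mulr0.
by rewrite -(@enc_nat D Hd (Posz 0, Posz 0) 0) ?mod0n.
Qed.

Definition conv_out p := [exists j : 'I_p.+1, fa j && fb (p - j)] && (p %% Qm <= q).

Lemma obody_ok g s h i : conv_env s -> s 50 = i -> h (bx + i) = enc g -> inbox D Hd g ->
  (Posz D <= g.2)%R = [exists j : 'I_i.+1, fa j && fb (i - j)] ->
  wp B OBODY 4 (fun s' h' => [/\ same 51 s s', s' 51 = conv_out i & h' = h]) s h.
Proof.
move=> [[[e2 e3 e4 e5 e6] [e7 e8 e9 e10 e11]] e12 e13 e14 e15] e50 hX ib gE.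
have B1 : 1 < B by apply: leq_ltn_trans qB.
have fin v s' : same 51 s s' -> v = conv_out i :> nat -> wp B (51 ::= Cst v) 1
    (fun s' h' => [/\ same 51 s s', s' 51 = conv_out i & h' = h]) s' h.
  move=> sm ->; apply: wp_asn; first by case: conv_out => //=; apply: ltn_trans B1.
  by move=> w ->; split=> // x x51; rewrite updE (ltn_eqF x51) sm.
apply: wp_seq_asn; rewrite /= e50 e2; first exact: MB.
rewrite e7 e5 hX => v54 E54.
have := enc_im DD_gt0 Hd_gt0 ib; rewrite /= -E54 gE => im.
have sm : same 51 s (upd s 54 v54) by move=> x x51; rewrite updE; case: eqP => // ?; lia.
have tst x y : (x + 1 - y != 0) = (y <= x) by clear; lia.
apply: wp_if; rewrite /= !updE /= e3 e11.
  rewrite tst im => t1; apply: wp_if; rewrite /= !updE /= e50 e14 e15.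
    by rewrite tst => t2; apply: fin => //; rewrite /conv_out t1 t2.
  by move/eqP; rewrite -[_ == 0]negbK tst => /negbTE t2; apply: fin => //; rewrite /conv_out t2 andbF.
move/eqP; rewrite -[_ == 0]negbK tst im => /negbTE t1.
by apply: (wp_time (t := 1)) => //; apply: fin => //; rewrite /conv_out t1.
Qed.

Lemma conv_time x y : 2 <= x -> 0 < y ->
  x * 5 + 2 + ((y * (x * 13 + 6) + 1) + ((x * 5 + 2) +
    ((y * (x * 13 + 6) + 1) + (x * 7 + 2)).+1)).+1 <= 60 * (x * y).
Proof.
move=> x2 y0; have h : x <= x * y by rewrite leq_pmulr.
have h2 : 2 * y <= x * y by rewrite leq_mul2r x2 orbT.
rewrite mulnDr mulnA [y * x]mulnC; lia.
Qed.

Lemma conv_ok s h : conv_env s -> fft_tables h -> conv_in h ->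
  wp B CONV (60 * (M * m)) (fun s' h' => [/\ same 40 s s',
    forall p, p < M -> h' (ba + p) = conv_out p &
    forall a, ~~ (bx <= a < bx2 + N) -> ~~ (ba <= a < ba + M) -> h' a = h a]) s h.
Proof.
move=> cen tb hin; have [en e12 e13 e14 e15] := cen.
have [_ [e7 e8 e9 e10 e11]] := en.
have [r1 r2 r3 r4] := and4P regions; have /andP[a1 a2] := ba_r; have MN := M_le_N.
have M0' : 0 < M by rewrite expn_gt0.
have MB' : M < B by lia.
(* The conclusions are about integers only, so any concrete real closed field can witness the error
   analysis. *)
have [sm1 sm2 sm3 sm4 sm5] := fft_facts realalg K4 m0 mK fab0.
have tb' h' : frame_out bx (bx2 + N) h h' -> fft_tables h'.
  by move=> fr j jN; have [t1 t2] := tb j jN; split; rewrite fr ?t1 ?t2 //; lia.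
have hin' h' : frame_out bx (bx2 + N) h h' -> conv_in h'.
  by move=> fr j jN; have [t1 t2] := hin j jN; split; rewrite fr ?t1 ?t2 //; have := M_half; lia.
have cen' s' : same 40 s s' -> conv_env s'.
  by move=> sm; split; [exact: fft_env_same en| | | |]; rewrite sm.
have halfB : M %/ 2 < B by apply: leq_ltn_trans (leq_div _ _) MB'.
apply: (@wp_seq _ _ _ (M * 5 + 2) ((m * (M * 13 + 6) + 1) + ((M * 5 + 2) + ((m * (M * 13 + 6) + 1) + (M * 7 + 2)).+1)).+1);
  last by apply: conv_time => //; rewrite -[2]/(2 ^ 1) leq_exp2l.
apply: (wp_conseq (@wp_map B 7 13 GBODY M bx 2 (fun p => enc (F0 p)) s h _ _ e7 e13 _ MB' _ _)) => //.
- by lia.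
- by move=> i _; apply: encB.
- move=> i s' h' iM sm e50 hh; apply: gbody_ok => //.
    by apply: cen'; apply: same_le sm.
  by apply: hin' => a out; rewrite hh blit_out //; lia.
move=> s1 h1 [S1 H1].
apply: wp_seq_asn; first by rewrite /= S1 // e13.
move=> v42 E42; rewrite /= S1 // e13 half_M in E42.
apply: (@wp_seq _ _ _ (m * (M * 13 + 6) + 1) _ _ _ _ _ _ (leqnn _)).
(* The index is the number of stages left. Register 42 halves down to 1 and then becomes 0 by
   integer division, which ends the loop. *)
pose I j (s' h' : store) := [/\ same 40 s s', j <= m,
  s' 42 = (if j is j'.+1 then 2 ^ j' else 0),
  holds h' bx (gfwds D m zt (m - j) F0) & frame_out bx (bx2 + N) h h'].
have -> : M * 13 + 6 = (M * 13 + 5).+1 by lia.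
apply: (@wp_while _ _ _ _ I) => [|j s' h'|].
- split=> //.
  + by move=> x x40; rewrite updE ifF ?S1 //; lia.
  + by rewrite updE /= E42; case: m m0.
  + by rewrite subnn => p pM; rewrite H1 blit_in.
  + by move=> a out; rewrite H1 blit_out //; lia.
- move=> [S2 jm e42 hd fr] /= c0.
  have j0 : j = 0 by case: j e42 {jm hd} => // j'; rewrite c0; have := expn_gt0 2 j'; lia.
  rewrite j0 subn0 in hd.
  apply: (@wp_seq _ _ _ (M * 5 + 2) _ _ _ _ _ _ (leqnn _)).
  pose G := gsqs D m zt F0.
  apply: (wp_conseq (@wp_map B 7 13 SBODY M bx 2 (fun p => enc (G p)) s' h' _ _ _ _ _ MB' _ _)) => //.
  + by rewrite S2.
  + by rewrite S2.
  + by lia.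
  + by move=> i _; apply: encB.
  + move=> i s2 h2 iM sm e50 hh; apply: sbody_ok => //.
    * by apply: fft_env_same en; apply: same_trans S2 (same_le _ sm).
    * by rewrite hh blit_out ?hd //; lia.
    * by apply: gbd_inbox; apply: sm2.
  move=> s2 h2 [S3 H3].
  apply: wp_seq_asn; first by rewrite /=; lia.
  move=> w42 W42; rewrite /= in W42.
  apply: (@wp_seq _ _ _ (m * (M * 13 + 5).+1 + 1) _ _ _ _ _ _ (leqnn _)).
  pose J j (s' h' : store) := [/\ same 40 s s', j <= m, s' 42 = 2 ^ (m - j),
    holds h' bx (ginvs D yt (m - j) G) & frame_out bx (bx2 + N) h h'].
  apply: (@wp_while _ _ _ _ J) => [|i s3 h3|i s3 h3].
  + split=> //.
    * move=> x x40; rewrite updE ifF; last by lia.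
      by rewrite S3 ?S2 //; lia.
    * by rewrite subnn.
    * by rewrite subnn => p pM; rewrite H3 blit_in.
    * by move=> a out; rewrite H3 blit_out ?fr //; lia.
  + move=> [S4 im e42' hd' fr'] /=; rewrite S4 // e13 e42' => c1.
    have i0 : i = 0.
      by apply/eqP; case: i im c1 {e42' hd'} => // i im /eqP; rewrite subn_eq0 leq_exp2l //; lia.
    rewrite i0 subn0 in hd'.
    apply: (wp_conseq (@wp_map B 12 13 OBODY M ba 4 (fun p => conv_out p : nat) s3 h3 _ _ _ _ _ MB' _ _)) => //.
    * by rewrite S4.
    * by rewrite S4.
    * by move=> p _; case: conv_out; lia.
    * move=> p s4 h4 pM sm e50 hh; apply: (@obody_ok (ginvs D yt m G p)) => //.
      - by apply: cen'; apply: same_trans S4 (same_le _ sm).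
      - by rewrite hh blit_out ?hd' //; lia.
      - by apply: gbd_inbox; apply: sm4.
      - exact: sm5.
    move=> s4 h4 [S5 H5]; split.
    * by apply: same_trans S4 (same_le _ S5).
    * by move=> p pM; rewrite H5 blit_in.
    * by move=> a o1 o2; rewrite H5 blit_out ?fr'.
  move=> [S4 im e42' hd' fr'] /=; rewrite S4 // e13 e42' => c1.
  have i0 : 0 < i by case: i c1 {im e42' hd'} => //; rewrite subn0 subnn eqxx.
  case: i i0 im e42' hd' c1 => // i _ im e42' hd' c1; exists i => //.
  apply: (@wp_seq _ _ _ (M * 13 + 4) 1); last by lia.
  have en3 := fft_env_same S4 en.
  have km : m - i.+1 < m by lia.
  pose G' := ginv D yt (2 ^ (m - i.+1)) (ginvs D yt (m - i.+1) G).
  apply: (wp_conseq (@stage_copy IBODY 6 G' s3 h3 en3 _ _)) => //.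
  + by rewrite S4.
  + move=> p s4 h4 pM sm e50 fr4; apply: (@ibody_ok (m - i.+1)) => //.
    * by apply: fft_env_same en3; apply: same_le sm.
    * by apply: tb' => a out; rewrite fr4 ?fr' //; lia.
    * by rewrite sm.
    * by move=> p' pM'; rewrite fr4 ?hd' //; lia.
    * by move=> p1 p2 j' h5 h6 h7; apply: gbd_inbox; apply: sm3 => //; exact: ltnW.
  move=> s4 h4 [S5 hd5 fr5].
  have e2 : 2 ^ (m - i.+1) * 2 = 2 ^ (m - i) by rewrite -expnSr; congr expn; lia.
  apply: wp_asn; rewrite /= S5 // e42' e2.
    by apply: leq_ltn_trans MB'; rewrite leq_exp2l ?leq_subr.
  move=> v ->; split=> //.
  + move=> x x40; rewrite updE ifF; last by lia.
    by rewrite S5 ?S4 //; lia.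
  + by lia.
  + by rewrite (_ : m - i = (m - i.+1).+1) //; lia.
  + by move=> a out; rewrite fr5 ?fr'.
move=> j s' h' [S2 jm e42 hd fr] /= c0.
case: j e42 jm hd => [|j] e42 jm hd; first by rewrite e42 in c0.
exists j => //.
apply: (@wp_seq _ _ _ (M * 13 + 4) 1); last by lia.
have en3 := fft_env_same S2 en.
pose G' := gfwd D zt (2 ^ j) (gfwds D m zt (m - j.+1) F0).
apply: (wp_conseq (@stage_copy FBODY 6 G' s' h' en3 _ _)) => //.
- by rewrite S2.
- move=> p s4 h4 pM sm e50 fr4; apply: (@fbody_ok j) => //.
  + by apply: fft_env_same en3; apply: same_le sm.
  + by apply: tb' => a out; rewrite fr4 ?fr //; lia.
  + by rewrite sm.
  + by move=> p' pM'; rewrite fr4 ?hd //; lia.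
  + by move=> p' j' h5 h6; apply: gbd_inbox; apply: sm1 => //; exact: leq_subr.
move=> s4 h4 [S5 hd5 fr5].
have jd : 2 ^ j %/ 2 = (if j is j'.+1 then 2 ^ j' else 0).
  by case: j {e42 jm hd G' hd5} => // j'; rewrite expnSr mulnK.
apply: wp_asn; rewrite /= S5 // e42 jd.
  rewrite -jd; apply: leq_ltn_trans (leq_div _ _) _; apply: leq_ltn_trans MB'.
  by rewrite leq_exp2l //; lia.
move=> v ->; split=> //.
- move=> x x40; rewrite updE ifF; last by lia.
  by rewrite S5 ?S2 //; lia.
- by lia.
- rewrite (_ : m - j = (m - j.+1).+1) /=; last by lia.
  by rewrite (_ : m - (m - j.+1).+1 = j) //; lia.
- by move=> a out; rewrite fr5 ?fr.
Qed.

End Conv.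

(** * Tables of roots of unity *)

(** Digit-by-digit search from register 4, which holds the power of two [D]; the argument is at most
    D * D. A linear search would be too slow, as D is N^32. *)
Definition ISQRT :=
  44 ::= Cst 0 ;;;
  45 ::= Var 4 ;;;
  While (Var 45) (
    47 ::= Var 44 +e Var 45 ;;;
    If (Var 43 +e Cst 1 -e Var 47 *e Var 47) (44 ::= Var 47) Skip ;;;
    45 ::= Var 45 /e Cst 2).

Definition TBODY x w :=
  54 ::= (Deref (Var x +e Var 50) *e Var w +e Var 5) %e Var 2 ;;;
  RESCALE.

(** Filled by doubling: the entries from 2^k to 2^(k+1) - 1 are the first 2^k entries times the k-th
    root. Registers 42 and 49 hold that root and its conjugate, which is its inverse; they may be
    left unreduced because [TBODY] reduces the product. *)
Definition TABLE :=
  40 ::= Cst 0 ;;;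
  41 ::= Cst 1 ;;;
  Sto (Var 9) (Var 4 %e Var 2) ;;;
  Sto (Var 10) (Var 4 %e Var 2) ;;;
  While (Var 16 -e Var 41) (
    43 ::= Var 4 *e Var 4 -e Var 40 *e Var 40 ;;;
    ISQRT ;;;
    42 ::= Var 40 +e Var 44 *e Var 3 ;;;
    49 ::= Var 40 +e (Var 2 -e Var 44 *e Var 3) ;;;
    46 ::= Var 9 +e Var 41 ;;;
    MAP 46 41 (TBODY 9 42) ;;;
    46 ::= Var 10 +e Var 41 ;;;
    MAP 46 41 (TBODY 10 49) ;;;
    43 ::= Var 4 *e (Var 4 +e Var 40) /e Cst 2 ;;;
    ISQRT ;;;
    40 ::= Var 44 ;;;
    41 ::= Var 41 *e Cst 2).

Section Isqrt.
Variables (B k x : nat).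

Lemma isqrt_ok s h : s 4 = 2 ^ k -> s 43 = x -> x <= 2 ^ k * 2 ^ k -> 2 ^ k * 4 < B ->
  wp B ISQRT (5 * k + 8) (fun s' h' => [/\ forall y, y < 44 \/ y = 46 \/ 47 < y -> s' y = s y,
    s' 44 = Nat.sqrt x & h' = h]) s h.
Proof.
move=> e4 e43 xD kB; have k0 : 0 < 2 ^ k by rewrite expn_gt0.
apply: (wp_time (t := (k.+1 * 5 + 1).+2)); last by lia.
apply: wp_seq_asn => [|v44 /= E44] /=; first by lia.
apply: wp_seq_asn => [|v45 /= E45] /=; first by rewrite !updE /= e4; lia.
pose I j (s' h' : store) := [/\ forall y, y < 44 \/ y = 46 \/ 47 < y -> s' y = s y,
  s' 45 = (if j is j'.+1 then 2 ^ j' else 0), j <= k.+1,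
  s' 44 * s' 44 <= x < (s' 44 + 2 ^ j) * (s' 44 + 2 ^ j) & h' = h].
apply: (@wp_while _ _ _ _ I).
- split=> //.
  + by move=> y Hy; rewrite !updE !ifF //; apply/negbTE/eqP; lia.
  + by rewrite !updE /= E45 updE /= e4.
  + by rewrite !updE /= E44 expnS; nia.
- move=> j s' h' [fr e45 jk /andP[r1 r2] hh] /= c0; split=> //.
  have j0 : j = 0 by case: j e45 {jk r2} => // j; rewrite c0; have := expn_gt0 2 j; lia.
  by rewrite (@sqrt_uniq x (s' 44)) // r1; rewrite j0 expn0 addn1 in r2.
move=> j s' h' [fr e45 jk /andP[r1 r2] hh] /= c0.
case: j e45 jk r2 => [|j] e45 jk r2; first by rewrite e45 in c0.
exists j => //.
have jk2 : 2 ^ j <= 2 ^ k by rewrite leq_exp2l.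
have rk : s' 44 <= 2 ^ k by nia.
have j0 : 0 < 2 ^ j by rewrite expn_gt0.
have hj : 2 ^ j %/ 2 = (if j is j'.+1 then 2 ^ j' else 0).
  by case: j {e45 jk r2 jk2 j0 c0} => // j'; rewrite expnSr mulnK.
have hj' : 2 ^ j %/ 2 < B by apply: leq_ltn_trans (leq_div _ _) _; lia.
rewrite hj in hj'.
apply: wp_seq_asn => [|v47 /= E47] /=; first by rewrite e45; lia.
rewrite e45 in E47; rewrite expnS in r2.
apply: (@wp_seq _ _ _ 2 1) => //; apply: wp_if; rewrite /= !updE /= E47 fr ?e43; try (by left).
  move=> c1; apply: wp_asn; rewrite /= !updE /=; first by lia.
  move=> v ->; apply: wp_asn => [|w ->]; rewrite /= !updE /= e45 ?hj //; split=> //=; rewrite ?updE //=.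
  + by move=> y Hy; rewrite !updE !ifF ?fr //; apply/negbTE/eqP; lia.
  + exact: ltnW.
  + by apply/andP; split; nia.
move=> c1; apply: wp_skip; apply: wp_asn => [|w ->]; rewrite /= !updE /= e45 ?hj //; split=> //=; rewrite ?updE //=.
- by move=> y Hy; rewrite !updE !ifF ?fr //; apply/negbTE/eqP; lia.
- exact: ltnW.
- by rewrite r1 /=; nia.
Qed.

End Isqrt.

Lemma D_le_H K : 4 * fft_D K <= encH (fft_D K) (fft_Hd K).
Proof. by rewrite /encH; have := Hd_gt0 K; nia. Qed.

Lemma H_sq K : encH (fft_D K) (fft_Hd K) * encH (fft_D K) (fft_Hd K) < encM (fft_D K) (fft_Hd K).
Proof. by rewrite /encM addn1. Qed.

Lemma half_le d c : c <= d -> d * (d + c) %/ 2 <= d * d.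
Proof. by move=> cd; have := leq_trunc_div (d * (d + c)) 2; move: (_ %/ 2) => z; nia. Qed.

Section Table.
Variables (B K : nat).
Hypothesis K4 : 3 < K.
Local Notation N := (2 ^ K).
Local Notation D := (fft_D K).
Local Notation Hd := (fft_Hd K).
Local Notation H := (encH D Hd).
Local Notation M0 := (encM D Hd).
Local Notation enc := (enc D Hd).
Variables (bx bx2 bz by_ : nat).
Hypothesis regions : [&& bx + N <= bx2, bx2 + N <= bz, bz + N <= by_ & by_ + N <= B].
Hypothesis M0B : 2 * M0 < B.

Lemma fft_D_pow : D = 2 ^ (32 * K).
Proof. by rewrite /fft_D -expnD -expnM mulnC. Qed.

Lemma D_bounds : D * 4 < B /\ D * H <= M0.
Proof. have := D_le_H K; have := H_sq K; have := DD_gt0 K; have := M0B; nia. Qed.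

Lemma enc_natM (g : gint) w : Posz w = (g.1 + g.2 * Posz H + Posz M0)%R -> w %% M0 = enc g.
Proof. by move=> e; apply/eqP; rewrite -eqz_nat encE -modz_nat e intdiv.modzDr. Qed.

Lemma table_entry k i sg w v : `|sg|%R = 1%R -> k < K -> i < 2 ^ k ->
  w %% M0 = enc (rootn D sg k) -> v = enc (zn D sg K i) ->
  inbox D Hd (gmul (rootn D sg k) (zn D sg K i)) /\
  (v * w + encoff1 D Hd) %% M0 = (enc (gmul (rootn D sg k) (zn D sg K i)) + encoff1 D Hd) %% M0.
Proof.
move=> s1 kK ik ew ->; split; first by apply: gbd_inbox; apply: (table_small realalg K4).
by rewrite -modnDml -modnMmr ew [in LHS]mulnC enc_mul.
Qed.

Lemma tbody_ok x w g e s h i : fft_env K bx bx2 bz by_ s -> x < 40 -> w < 50 -> s 50 = i ->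
  (h (s x + i) * s w + encoff1 D Hd) %% M0 = (enc g + encoff1 D Hd) %% M0 -> inbox D Hd g ->
  e = enc (gdiv D g) ->
  wp B (TBODY x w) 2 (fun s' h' => [/\ same 51 s s', s' 51 = e & h' = h]) s h.
Proof.
move=> en x40 w50 e50 eg ib ->; have [[e2 e3 e4 e5 e6] _] := en.
have M0B' : M0 < B by lia.
apply: wp_seq_asn; rewrite /= e50 e2; first exact: (MB M0B').
rewrite e5 eg => v54 E54.
apply: (@rescale_ok _ _ bx bx2 bz by_ M0B' g) => //.
by split=> // y y51; rewrite !updE !(ltn_eqF (leq_trans y51 _)).
Qed.

(** Each of the K rounds takes two integer square roots of O(K) steps; the resulting K^2 is absorbed
    by N K. *)
Lemma table_time : 4 + (K * (320 * K + 10 * N + 28).+1 + 1) <= 400 * (N * K).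
Proof.
have h1 : K <= N by apply: ltnW; apply: ltn_expl.
move: (2 ^ K) h1 K4 => x h1 k4.
have h2 : K * K <= x * K by rewrite leq_mul2r h1 orbT.
have h3 : K <= x * K by rewrite leq_pmull //; lia.
have -> : K * (320 * K + 10 * x + 28).+1 = 320 * (K * K) + 10 * (x * K) + 29 * K by lia.
lia.
Qed.

Lemma table_ok s h : fft_env K bx bx2 bz by_ s -> s 16 = N ->
  wp B TABLE (400 * (N * K)) (fun s' h' => [/\ same 40 s s', fft_tables K bz by_ h' &
    forall a, ~~ (bz <= a < by_ + N) -> h' a = h a]) s h.
Proof.
move=> en e16; have [[e2 e3 e4 e5 e6] [e7 e8 e9 e10 e11]] := en.
have [r1 r2 r3 r4] := and4P regions.
have N0 : 0 < N by rewrite expn_gt0.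
have M0B' : M0 < B by lia.
have [D4 DH] := D_bounds; have D0 := DD_gt0 K; have DleH := D_le_H K; have HH := H_sq K.
have ND : N <= D by rewrite fft_D_pow leq_exp2l //; lia.
have NB : N < B by lia.
apply: wp_time table_time; rewrite -[4]/(3.+1).
rewrite addSn; apply: wp_seq_asn => [|v40 /= E40] /=; first by lia.
rewrite addSn; apply: wp_seq_asn => [|v41 /= E41] /=; first by lia.
rewrite addSn; apply: (@wp_seq _ _ _ 1 (1 + (K * (320 * K + 10 * N + 28).+1 + 1))); last by lia.
apply: wp_sto; rewrite /= !updE /= ?e9 ?e4 ?e2; [by lia|exact: (MB M0B')|].
apply: (@wp_seq _ _ _ 1 (K * (320 * K + 10 * N + 28).+1 + 1)) => //.
apply: wp_sto; rewrite /= !updE /= ?e10 ?e4 ?e2; [by lia|exact: (MB M0B')|].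
have encD sg : D %% M0 = enc (zn D sg K 0).
  by rewrite zn0; apply: enc_nat; rewrite /= GRing.mul0r GRing.addr0.
pose I j (s' h' : store) := [/\ same 40 s s' /\ s' 40 = cosn D (K - j), s' 41 = 2 ^ (K - j), j <= K,
  (forall i, i < 2 ^ (K - j) -> h' (bz + i) = enc (zn D 1 K i) /\ h' (by_ + i) = enc (zn D (-1)%R K i)) &
  forall a, ~~ (bz <= a < by_ + N) -> h' a = h a].
apply: (@wp_while _ _ _ _ I).
- split=> //.
  + split; last by rewrite !updE /= E40 subnn.
    by move=> y y40; rewrite !updE !(ltn_eqF (leq_trans y40 _)).
  + by rewrite !updE /= E41 subnn.
  + rewrite subnn => i; rewrite expn0 ltnS leqn0 => /eqP ->; rewrite !updE !addn0 !eqxx.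
    rewrite -(encD (-1)%R) -(encD 1%R); split=> //.
    by rewrite ifF //; apply/negbTE/eqP; lia.
  + by move=> a out; rewrite !updE !ifF //; apply/negbTE/eqP; lia.
- move=> j s' h' [[sm _] e41 jK hd fr] /=; rewrite sm // e16 e41 => c0.
  have j0 : j = 0.
    case: j c0 jK {e41 hd} => // j /eqP; rewrite subn_eq0 leq_exp2l //; lia.
  by split=> // i iN; apply: hd; rewrite j0 subn0.
move=> j s' h' [[sm e40] e41 jK hd fr] /=; rewrite sm // e16 e41 => c0.
case: j c0 jK e41 e40 hd => [|j] c0 jK e41 e40 hd; first by rewrite subn0 subnn in c0.
exists j => //; have [k kE] : exists k, K - j.+1 = k by exists (K - j.+1).
rewrite kE in e41 e40 hd.
have kK : k < K by lia.
have k2 : 2 ^ k + 2 ^ k <= N by rewrite addnn -mul2n -expnS leq_exp2l.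
have en' : fft_env K bx bx2 bz by_ s' := fft_env_same sm en.
have kd : K - j = k.+1 by lia.
have b2 : bz + 2 ^ k + 2 ^ k <= B by lia.
have b4 : by_ + 2 ^ k + 2 ^ k <= B by lia.
have b3 : 2 ^ k < B by lia.
have ck := cosn_le D k; have sk := sinn_le D k.
have skH : sinn D k * H <= D * H by rewrite leq_mul2r sk orbT.
have skM : sinn D k * H <= M0 by lia.
have DD : D * D <= D * H by rewrite leq_mul2l; apply/orP; right; lia.
have DDB : D * D < B by lia.
apply: (wp_time (t := ((160 * K + 8) + (((2 ^ k * 5 + 2) + ((2 ^ k * 5 + 2) + ((160 * K + 8) + 2).+1).+1).+3)).+1)); last by lia.
apply: wp_seq_asn; rewrite /= e40 (sm 4) // e4; first by lia.
move=> v43 E43.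
apply: (@wp_seq _ _ _ (160 * K + 8) _ _ _ _ _ _ (leqnn _)).
have sqD : fft_D K = 2 ^ (32 * K) := fft_D_pow.
apply: (wp_conseq (@isqrt_ok B (32 * K) v43 _ _ _ _ _ _)) => //; rewrite ?updE /= -?sqD ?sm //.
- by rewrite E43 leq_subr.
- by lia.
move=> s1 h1 [S1 E44 ->].
have S1' y : y < 42 -> s1 y = s' y by move=> y42; rewrite S1 ?updE ?ifF //; [apply/negbTE/eqP|]; lia.
rewrite E43 -/(sinn D k) in E44.
have T1 : same 40 s s1 by move=> y y40; rewrite S1' ?sm //; lia.
have H1 : s1 3 = H by rewrite T1.
have H2 : s1 2 = M0 by rewrite T1.
have C1 : s1 40 = cosn D k by rewrite S1'.
have C2 : s1 41 = 2 ^ k by rewrite S1'.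
apply: wp_seq_asn; rewrite /= ?C1 ?E44 ?H1; first by lia.
move=> v42 E42.
apply: wp_seq_asn; rewrite /= !updE /= ?C1 ?E44 ?H1 ?H2; first by lia.
move=> v49 E49.
apply: wp_seq_asn; rewrite /= !updE /= ?C2 ?T1 // ?e9; first by lia.
move=> v46 E46.
apply: (@wp_seq _ _ _ (2 ^ k * 5 + 2) _ _ _ _ _ _ (leqnn _)).
set s2 := upd _ 46 v46.
have T2 : same 40 s s2.
  by move=> y y40; rewrite /s2 !updE !(ltn_eqF (leq_trans y40 _)) // T1.
have ez i : i < 2 ^ k -> enc (zn D 1 K (2 ^ k + i)) = enc (gdiv D (gmul (rootn D 1 k) (zn D 1 K i))).
  by move=> ik; rewrite addnC zn_add.
have ey i : i < 2 ^ k -> enc (zn D (-1)%R K (2 ^ k + i)) = enc (gdiv D (gmul (rootn D (-1)%R k) (zn D (-1)%R K i))).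
  by move=> ik; rewrite addnC zn_add.
have te1 i v : i < 2 ^ k -> v = enc (zn D 1 K i) ->
    inbox D Hd (gmul (rootn D 1 k) (zn D 1 K i)) /\
    (v * v42 + encoff1 D Hd) %% M0 = (enc (gmul (rootn D 1 k) (zn D 1 K i)) + encoff1 D Hd) %% M0.
  move=> ik; apply: table_entry => //.
  by apply: enc_nat; rewrite /= GRing.mul1r E42 PoszD PoszM.
have te2 i v : i < 2 ^ k -> v = enc (zn D (-1)%R K i) ->
    inbox D Hd (gmul (rootn D (-1)%R k) (zn D (-1)%R K i)) /\
    (v * v49 + encoff1 D Hd) %% M0 = (enc (gmul (rootn D (-1)%R k) (zn D (-1)%R K i)) + encoff1 D Hd) %% M0.
  move=> ik; apply: table_entry => //.
  apply: enc_natM; rewrite E49 PoszD -subzn // PoszM /=.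
  by move: (Posz _) (Posz _) => x y; ring.
have d2 : s2 46 = bz + 2 ^ k by rewrite /s2 updE /= E46.
have l2 : s2 41 = 2 ^ k by rewrite /s2 !updE.
apply: (wp_conseq (@wp_map B 46 41 _ (2 ^ k) (bz + 2 ^ k) 2 (fun i => enc (zn D 1 K (2 ^ k + i))) s2 h' isT isT d2 l2 b2 b3 _ _)) => //.
- by move=> i _; apply: (encB M0B').
- move=> i s3 h3 ik sm3 e50 hh.
  have T3 : same 40 s s3 by apply: same_trans T2 (same_le _ sm3).
  have E9 : s3 9 = bz by rewrite T3.
  have hz : h3 (bz + i) = enc (zn D 1 K i) by rewrite hh blit_out ?(hd _ ik).1 //; lia.
  have [ib te] := te1 i _ ik hz.
  apply: (tbody_ok (fft_env_same T3 en) _ _ e50 _ ib (ez _ ik)) => //.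
  by rewrite E9 sm3.
move=> s3 h3 [S3 H3].
have T3 : same 40 s s3 by apply: same_trans T2 (same_le _ S3).
apply: wp_seq_asn; rewrite /= ?S3 // /s2 !updE /= ?C2 ?T1 // ?e10; first by lia.
move=> w46 F46.
apply: (@wp_seq _ _ _ (2 ^ k * 5 + 2) _ _ _ _ _ _ (leqnn _)).
set s4 := upd _ 46 w46.
have T4 : same 40 s s4 by move=> y y40; rewrite /s4 !updE !(ltn_eqF (leq_trans y40 _)) // T3.
have d4 : s4 46 = by_ + 2 ^ k by rewrite /s4 updE /= F46.
have l4 : s4 41 = 2 ^ k by rewrite /s4 !updE /= S3.
apply: (wp_conseq (@wp_map B 46 41 _ (2 ^ k) (by_ + 2 ^ k) 2 (fun i => enc (zn D (-1)%R K (2 ^ k + i))) s4 h3 isT isT d4 l4 b4 b3 _ _)) => //.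
- by move=> i _; apply: (encB M0B').
- move=> i s5 h5 ik sm5 e50 hh.
  have T5 : same 40 s s5 by apply: same_trans T4 (same_le _ sm5).
  have E10 : s5 10 = by_ by rewrite T5.
  have hz : h5 (by_ + i) = enc (zn D (-1)%R K i).
    by rewrite hh blit_out ?H3 ?blit_out ?(hd _ ik).2 //; lia.
  have [ib te] := te2 i _ ik hz.
  apply: (tbody_ok (fft_env_same T5 en) _ _ e50 _ ib (ey _ ik)) => //.
  by rewrite E10 sm5 // /s4 updE /= S3.
move=> s5 h5 [S5 H5].
have T5 : same 40 s s5 by apply: same_trans T4 (same_le _ S5).
have C5 : s5 40 = cosn D k by rewrite S5 // /s4 updE /= S3 // /s2 !updE /= C1.
have C6 : s5 41 = 2 ^ k by rewrite S5 // /s4 updE /= S3 // /s2 !updE /= C2.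
apply: wp_seq_asn; rewrite /= C5 T5 // e4; first by apply: leq_ltn_trans (half_le ck) DDB.
move=> u43 U43.
apply: (@wp_seq _ _ _ (160 * K + 8) 2); last by lia.
apply: (wp_conseq (@isqrt_ok B (32 * K) u43 _ _ _ _ _ _)) => //; rewrite ?updE /= -?sqD ?T5 //.
- by rewrite U43; apply: half_le.
- by rewrite mulnA.
move=> s6 h6 [S6 E6 ->].
have S6' y : y < 42 -> s6 y = s5 y by move=> y42; rewrite S6 ?updE ?ifF //; [apply/negbTE/eqP|]; lia.
have E7 : s6 44 = cosn D k.+1 by rewrite E6 U43.
clear U43 E6.
have ck1 := cosn_le D k.+1.
apply: wp_seq_asn; rewrite /= E7; first by lia.
move=> u40 U40.
apply: wp_asn; rewrite /= !updE /= S6' // C6 -expnSr.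
  by rewrite expnSr; lia.
move=> u41 U41.
have k2' : 2 ^ k.+1 = 2 ^ k + 2 ^ k by rewrite expnS; lia.
rewrite /I kd; split.
- split; last by rewrite !updE /= U40.
  by move=> y y40; rewrite !updE !(ltn_eqF (leq_trans y40 _)) // S6' ?T5 //; lia.
- by rewrite !updE /= U41.
- by lia.
- move=> i; rewrite k2' => ik; rewrite !H5.
  case: (ltnP i (2 ^ k)) => ik'.
    have [z1 z2] := hd _ ik'.
    by split; rewrite blit_out ?H3 ?blit_out ?z1 ?z2 //; lia.
  have -> : i = 2 ^ k + (i - 2 ^ k) by lia.
  have i2 : i - 2 ^ k < 2 ^ k by lia.
  split; rewrite addnA; last by rewrite blit_in.
  by rewrite blit_out ?H3 ?blit_in //; lia.
by move=> a out; rewrite H5 blit_out ?H3 ?blit_out ?fr //; lia.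
Qed.

End Table.

(** * Subset sums by residue classes *)

Section Blocks.
Variables (Qm q : nat) (ys : seq nat).
Hypothesis qQ : 2 * q < Qm.

(* A subset of [ys] with sum [z] and [c] elements is coded by [z + c * Qm]. *)
Definition slot r := if r < size ys then nth 0 ys r + Qm else 0.

(** A leaf offers the empty set or its element; a leaf past the end offers only the empty set, which
    pads the tree to a power of two. *)
Fixpoint blk j r x := if j is j'.+1 then
    [exists i : 'I_x.+1, blk j' (r * 2) i && blk j' (r * 2).+1 (x - i)] && (x %% Qm <= q)
  else (x == 0) || (x == slot r).

Definition seg j r := take (2 ^ j) (drop (r * 2 ^ j) ys).

Lemma segS j r : seg j.+1 r = seg j (r * 2) ++ seg j (r * 2).+1.
Proof.
rewrite /seg expnS mul2n -addnn takeD drop_drop; congr (take _ (drop _ _) ++ take _ (drop _ _));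
  rewrite ?mulSn; lia.
Qed.

Lemma subseq_catP (t s1 s2 : seq nat) : subseq t (s1 ++ s2) ->
  exists t1 t2, [/\ t = t1 ++ t2, subseq t1 s1 & subseq t2 s2].
Proof.
case/subseqP=> m sm ->; exists (mask (take (size s1) m) s1), (mask (drop (size s1) m) s2).
split; rewrite ?mask_subseq // -mask_cat ?cat_take_drop //.
by rewrite size_takel // sm size_cat leq_addr.
Qed.

Lemma subseq_singl (t : seq nat) y : subseq t [:: y] -> t = [::] \/ t = [:: y].
Proof.
case: t => [|a [|c t]] /=; [by left|by case: (a =P y) => // -> _; right|].
by case: (a =P y).
Qed.

Lemma code_mod z c : z < Qm -> (z + c * Qm) %% Qm = z.
Proof. by move=> zQ; rewrite addnC modnMDl modn_small. Qed.

Hypothesis ysq : all (leq^~ q) ys.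

(** Both parts of a merge have z <= q and 2 q < Qm, so their sums add without a carry into the
    cardinality and the test modulo [Qm] reads off the true sum. Sums only grow, so a code dropped
    early is never missed later. *)
Lemma blkP j r x : blk j r x <-> exists t, [/\ subseq t (seg j r), sumn t <= q &
  x = sumn t + size t * Qm].
Proof.
elim: j r x => [|j IH] r x.
  rewrite /= /seg expn0 muln1; split.
    case/orP=> /eqP ->; first by exists [::]; rewrite sub0seq.
    rewrite /slot; case: ltnP => rs; last by exists [::]; rewrite sub0seq.
    exists [:: nth 0 ys r]; rewrite (drop_nth 0) // /= eqxx; split=> //; last by lia.
      exact: sub0seq.
    by rewrite addn0; apply: (allP ysq); rewrite mem_nth.
  case=> t [st tq ->]; rewrite /slot; case: ltnP => rs.
    move: st; rewrite (drop_nth 0) //= take0 => /subseq_singl.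
    by case=> ->; rewrite /= ?eqxx // mul1n addn0 eqxx orbT //.
  by move: st; rewrite (_ : take 1 _ = [::]) ?subseq0 ?drop_oversize // => /eqP ->.
rewrite /= segS; split.
  case/andP=> /existsP[i /andP[/IH[t1 [s1 q1 e1]] /IH[t2 [s2 q2 e2]]]] xq.
  have ix : i <= x by rewrite -ltnS.
  have ex : x = (sumn t1 + sumn t2) + (size t1 + size t2) * Qm by rewrite mulnDl; lia.
  exists (t1 ++ t2); rewrite sumn_cat size_cat; split=> //; first exact: cat_subseq.
  by move: xq; rewrite {1}ex code_mod //; lia.
case=> t [/subseq_catP[t1 [t2 [-> s1 s2]]] tq ->].
rewrite sumn_cat size_cat in tq *.
rewrite code_mod ?tq ?andbT; last by lia.
have lt : sumn t1 + size t1 * Qm < (sumn t1 + sumn t2 + (size t1 + size t2) * Qm).+1.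
  by rewrite mulnDl; lia.
apply/existsP; exists (Ordinal lt) => /=; apply/andP; split; apply/IH.
  by exists t1; split=> //; lia.
exists t2; split=> //; first by lia.
by clear; rewrite mulnDl; move: (_ * Qm) (_ * Qm) => x1 x2; lia.
Qed.

(** At most 2^j elements are chosen, so the code is below (2^j + 1) Qm. The weaker power-of-two
    multiple makes the length double exactly from one level to the next. *)
Lemma blk_lt j r x : blk j r x -> x < Qm * 2 * 2 ^ j.
Proof.
case/blkP=> t [st tq ->]; have sz : size t <= 2 ^ j.
  by apply: leq_trans (size_subseq st) _; rewrite /seg size_take; case: ltnP.
have h : size t * Qm <= Qm * 2 ^ j by rewrite mulnC leq_mul2l sz orbT.
have h2 : Qm <= Qm * 2 ^ j by rewrite leq_pmulr // expn_gt0.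
by rewrite -mulnA [2 * _]mul2n -addnn mulnDr; lia.
Qed.

Lemma blk_top k x : size ys <= 2 ^ k -> blk k 0 x <->
  exists t, [/\ subseq t ys, sumn t <= q & x = sumn t + size t * Qm].
Proof. by move=> sk; rewrite blkP /seg mul0n drop0 take_oversize. Qed.

End Blocks.

Section Classes.
Variables (s : seq nat) (b : nat).
Hypotheses (us : uniq s) (b0 : 0 < b).

Definition ssum (p : pred nat) z := exists Y : seq nat,
  [/\ uniq Y, {subset Y <= [seq x <- s | p x]} & sumn Y = z].

Definition quots l := [seq x %/ b | x <- s & x %% b == l].

Lemma sumn_perm (x y : seq nat) : perm_eq x y -> sumn x = sumn y.
Proof. by move=> H; rewrite !sumnE; apply: perm_big. Qed.

Lemma ssum_split l z : ssum (fun x => x %% b < l.+1) z <->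
  exists z1 z2, [/\ z = z1 + z2, ssum (fun x => x %% b < l) z1 & ssum (fun x => x %% b == l) z2].
Proof.
split.
  case=> Y [uY sY <-].
  exists (sumn [seq x <- Y | x %% b < l]), (sumn [seq x <- Y | x %% b == l]).
  have sp p x : (p : pred nat) x -> x \in Y -> x \in [seq x <- s | p x].
    by move=> px /sY; rewrite !mem_filter px => /andP[].
  split.
  - rewrite -sumn_cat; apply: sumn_perm; rewrite -(perm_filterC (fun x => x %% b < l) Y).
    rewrite perm_cat2l; apply/permP => a; congr (count a _); apply: eq_in_filter => x /sY.
    by rewrite mem_filter ltnS => /andP[h _]; rewrite /predC /= -leqNgt eqn_leq h.
  - exists [seq x <- Y | x %% b < l]; split=> //; first exact: filter_uniq.
    by move=> x; rewrite mem_filter => /andP[]; apply: (sp (fun x => x %% b < l)).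
  - exists [seq x <- Y | x %% b == l]; split=> //; first exact: filter_uniq.
    by move=> x; rewrite mem_filter => /andP[]; apply: (sp (fun x => x %% b == l)).
case=> z1 [z2 [-> [Y1 [u1 s1 <-]] [Y2 [u2 s2 <-]]]]; exists (Y1 ++ Y2); split.
- rewrite cat_uniq u1 u2 andbT /=; apply/hasPn => x /s2; rewrite mem_filter => /andP[/eqP xl _].
  by apply/negP => /s1; rewrite mem_filter xl ltnn.
- move=> x; rewrite mem_cat => /orP[/s1|/s2]; rewrite !mem_filter => /andP[h ->]; rewrite andbT ltnS.
    exact: ltnW.
  by rewrite (eqP h).
by rewrite sumn_cat.
Qed.

Lemma sumn_quots l (Y : seq nat) : all (fun x => x %% b == l) Y ->
  sumn Y = sumn [seq x %/ b | x <- Y] * b + size Y * l.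
Proof.
elim: Y => //= x Y IH /andP[/eqP xl /IH ->]; rewrite {1}(divn_eq x b) xl.
by rewrite mulnDl mulSn; lia.
Qed.

(** Listed in the order of [s], a subset of the class is a subsequence of it, and its quotients form
    a subsequence of [quots l]. *)
Lemma ssum_class l z : ssum (fun x => x %% b == l) z <->
  exists t, subseq t (quots l) /\ z = sumn t * b + size t * l.
Proof.
split.
  case=> Y [uY sY <-]; pose Y' := [seq x <- [seq x <- s | x %% b == l] | x \in Y].
  have pY : perm_eq Y Y'.
    apply: uniq_perm => //; first by rewrite !filter_uniq.
    move=> x; rewrite [RHS]mem_filter; case: (boolP (x \in Y)) => //= /sY.
    by [].
  exists [seq x %/ b | x <- Y']; split; first by rewrite map_subseq ?filter_subseq.
  rewrite (sumn_perm pY) size_map -sumn_quots //.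
  by apply/allP => x; rewrite !mem_filter => /andP[_ /andP[]].
case=> t [/subseqP[m sm ->] ->]; rewrite -map_mask.
set cl := [seq x <- s | x %% b == l]; exists (mask m cl); split.
- by apply: mask_uniq; apply: filter_uniq.
- by move=> x; apply: mem_mask.
rewrite size_map -sumn_quots //; apply/allP => x /mem_mask.
by rewrite mem_filter => /andP[].
Qed.

Lemma ssum0 z : ssum (fun x => x %% b < 0) z <-> z = 0.
Proof.
split=> [[Y [_ sY <-]]|->]; last by exists [::].
by case: Y sY => // a Y /(_ a (mem_head _ _)); rewrite mem_filter ltn0.
Qed.

Lemma ssum_all u x : x <= u -> ssum (fun x => x %% b < b) x <-> in_subset_sums s u x.
Proof.
move=> xu; have e : [seq x <- s | x %% b < b] = s by apply/all_filterP/allP => y _; rewrite ltn_mod.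
by rewrite /ssum e; split=> [h|[]].
Qed.

Lemma size_quots l : size (quots l) = count (fun x => x %% b == l) s.
Proof. by rewrite size_map size_filter. Qed.

Lemma sum_size_quots : \sum_(l < b) size (quots l) = size s.
Proof.
under eq_bigr do rewrite size_quots.
elim: s => [|x s' IH] /=; first by rewrite big1.
rewrite big_split /= IH (bigD1 (Ordinal (ltn_pmod x b0))) //= eqxx big1 ?addn0 // => i ne.
by case: eqP => // e; case/eqP: ne; apply: val_inj.
Qed.

End Classes.

(** * Parameters *)

Definition POW2 d e := d ::= Cst 1 ;;; While (e -e Var d) (d ::= Var d *e Cst 2).

Definition TLOG d p e :=
  d ::= Cst 0 ;;; p ::= Cst 2 ;;;
  While (e +e Cst 1 -e Var p) (p ::= Var p *e Cst 2 ;;; d ::= Var d +e Cst 1).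

(** Linear search is affordable here: the root is b itself, and the budget is O(u b log u). *)
Definition LSQRT d e :=
  d ::= Cst 0 ;;;
  While (e +e Cst 1 -e (Var d +e Cst 1) *e (Var d +e Cst 1)) (d ::= Var d +e Cst 1).

Section SmallLoops.
Variable B : nat.

Definition same_but (d : nat -> bool) (s s' : store) := forall y, ~~ d y -> s' y = s y.

Lemma up_log_le x : up_log 2 x <= x.
Proof. by apply: up_log_min => //; apply: ltnW; apply: ltn_expl. Qed.

Lemma up_log_lt x : 0 < x -> 2 ^ up_log 2 x < 2 * x.
Proof.
case: x => [|[|x]] // _.
have /andP[h _] := up_log_bounds (isT : 1 < 2) (isT : 1 < x.+2).
have : 0 < up_log 2 x.+2 by rewrite up_log_gt0.
by case: (up_log 2 _) h => // k; rewrite expnS /=; lia.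
Qed.

Lemma pow2_ok d e x s h : (forall s', same_but (pred1 d) s s' -> ev e s' h = x) ->
  0 < x -> 2 * x < B ->
  wp B (POW2 d e) (2 * x + 2) (fun s' h' =>
    [/\ same_but (pred1 d) s s', s' d = 2 ^ up_log 2 x & h' = h]) s h.
Proof.
move=> ex x0 xB; have B1 : 1 < B by lia.
have ulx := up_log_le x; have ult := up_log_lt x0.
apply: (wp_time (t := (up_log 2 x * 2 + 1).+1)); last by lia.
apply: wp_seq_asn => [|v1 E1] //.
pose I j (s' h' : store) := [/\ same_but (pred1 d) s s', s' d = 2 ^ (up_log 2 x - j), j <= up_log 2 x & h' = h].
apply: (@wp_while _ _ _ _ I).
- split=> //; first by move=> y; rewrite inE updE => /negbTE ->.
  by rewrite updE eqxx subnn.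
- move=> j s' h' [sm ed jl ->] /=; rewrite ex // ed => c0; split=> //; congr expn.
  have : up_log 2 x <= up_log 2 x - j by apply: up_log_min => //; rewrite -subn_eq0; apply/eqP.
  by lia.
move=> j s' h' [sm ed jl ->] /=; rewrite ex // ed => c0.
case: j jl ed c0 => [|j] jl ed c0.
  by case/eqP: c0; apply/eqP; rewrite subn_eq0 subn0; apply: up_logP.
exists j => //; rewrite subn_eq0 -ltnNge in c0.
apply: wp_asn; rewrite /= ed; first by lia.
move=> v ->; split=> //.
- by move=> y yd; rewrite upd_neq ?sm.
- by rewrite updE eqxx -expnSr; congr expn; lia.
by lia.
Qed.

Lemma tlog_ok d p e x s h : d != p ->
  (forall s', same_but (pred2 d p) s s' -> ev e s' h = x) -> 0 < x -> 2 * x + 2 < B ->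
  wp B (TLOG d p e) (3 * x + 3) (fun s' h' =>
    [/\ same_but (pred2 d p) s s', s' d = trunc_log 2 x & h' = h]) s h.
Proof.
move=> dp ex x0 xB; set T := trunc_log 2 x.
have Tx : T <= x by apply: ltnW; apply: leq_trans (ltn_expl T (isT : 1 < 2)) _; apply: trunc_logP.
apply: (wp_time (t := (T * 3 + 1).+2)); last by lia.
apply: wp_seq_asn => [|v1 /= E1] /=; first by lia.
apply: wp_seq_asn => [|v2 /= E2] /=; first by lia.
pose I j (s' h' : store) := [/\ same_but (pred2 d p) s s', s' d + j = T, s' p = 2 ^ (s' d).+1 & h' = h].
apply: (@wp_while _ _ _ _ I).
- split=> //; rewrite ?updE ?eqxx ?(negbTE dp) ?E1 ?E2 //.
  by move=> y; rewrite !inE !updE negb_or => /andP[/negbTE -> /negbTE ->].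
- move=> j s' h' [sm ed ep ->] /=; rewrite ex // ep => c0; split=> //.
  have xl : x < 2 ^ (s' d).+1 by rewrite -addn1 -subn_eq0; apply/eqP.
  have := leq_ltn_trans (trunc_logP (isT : 1 < 2) x0) xl.
  by rewrite ltn_exp2l // -/T; lia.
move=> j s' h' [sm ed ep ->] /=; rewrite ex // ep => c0.
rewrite subn_eq0 -ltnNge addn1 ltnS in c0.
have lt : s' d < T by apply: trunc_log_max.
exists j.-1; first by lia.
apply: wp_seq_asn; rewrite /= ep; first by lia.
move=> v3 E3; apply: wp_asn; rewrite /= updE (negbTE dp); first by lia.
move=> v4 E4; split=> //.
- by move=> y yd; rewrite !updE; move: (yd); rewrite !inE negb_or => /andP[/negbTE -> /negbTE ->]; apply: sm.
- by rewrite updE eqxx E4; lia.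
- by rewrite !updE eqxx [p == d]eq_sym (negbTE dp) eqxx E3 E4 -expnSr addn1.
Qed.

Lemma lsqrt_ok d e x s h : (forall s', same_but (pred1 d) s s' -> ev e s' h = x) -> x + 2 < B ->
  wp B (LSQRT d e) (2 * Nat.sqrt x + 2) (fun s' h' =>
    [/\ same_but (pred1 d) s s', s' d = Nat.sqrt x & h' = h]) s h.
Proof.
move=> ex xB; have /andP[q1 q2] := sqrt_spec x.
apply: (wp_time (t := (Nat.sqrt x * 2 + 1).+1)); last by lia.
apply: wp_seq_asn => [|v1 /= E1] /=; first by lia.
pose I j (s' h' : store) := [/\ same_but (pred1 d) s s', s' d + j = Nat.sqrt x & h' = h].
apply: (@wp_while _ _ _ _ I).
- split=> //; first by move=> y; rewrite inE updE => /negbTE ->.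
  by rewrite updE eqxx E1.
- move=> j s' h' [sm ed ->] /=; rewrite ex // => c0; split=> //.
  have : x < (s' d + 1) * (s' d + 1) by rewrite -addn1 -subn_eq0; apply/eqP.
  by move: q1 ed; move: (s' d) (Nat.sqrt x) => a r q1 ed; nia.
move=> j s' h' [sm ed ->] /=; rewrite ex // => c0.
rewrite subn_eq0 -ltnNge [x + 1]addn1 ltnS in c0.
have lt : s' d < Nat.sqrt x by move: c0 q2; move: (s' d) (Nat.sqrt x) => a r; nia.
exists j.-1; first by lia.
apply: wp_asn => /=; first by move: lt q1; move: (Nat.sqrt x) => r; nia.
move=> v ->; split=> //.
- by move=> y yd; rewrite upd_neq ?sm.
- by rewrite updE eqxx; lia.
Qed.

End SmallLoops.

Definition par_b n := Nat.sqrt (n * trunc_log 2 n).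
Definition par_q u n := u %/ par_b n.
Definition par_kQ u n := up_log 2 (par_q u n * 2 + 1).
Definition par_kU u := up_log 2 (u + 1).
(** One power of two N serves as the length of the root tables and of every memory region. The
    factor 512 makes it exceed all blocks ([sizes_le]) and the addresses of the relocated input,
    while N K stays within the time bound. *)
Definition par_K u n := up_log 2 (512 * u * par_b n).

Section Sizes.
Variables (u n : nat).
Hypotheses (u2 : 2 <= u) (n2 : 2 <= n) (nu : n <= u.+1).
Local Notation L := (trunc_log 2 n).
Local Notation b := (par_b n).
Local Notation q := (par_q u n).
Local Notation Q := (2 ^ par_kQ u n).
Local Notation U := (2 ^ par_kU u).
Local Notation K := (par_K u n).
Local Notation lu := (trunc_log 2 u).

Lemma L_ge1 : 0 < L. Proof. by rewrite trunc_log_gt0. Qed.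
Lemma lu_ge1 : 0 < lu. Proof. by rewrite trunc_log_gt0. Qed.

Lemma L_le_n : L < n.
Proof. by apply: leq_trans (ltn_expl L (isT : 1 < 2)) _; apply: trunc_logP => //; lia. Qed.

Lemma b_sq : b * b <= n * L < b.+1 * b.+1.
Proof. exact: sqrt_spec. Qed.

Lemma b_ge1 : 0 < b.
Proof. by have := b_sq; have := L_ge1; case: (par_b n) => //; nia. Qed.

Lemma b_le_n : b <= n.
Proof. by have := b_sq; have := L_le_n; nia. Qed.

Lemma nL_le : n * L <= 4 * (b * b).
Proof. by have := b_sq; have := b_ge1; nia. Qed.

Lemma n_le : n <= 4 * (b * b).
Proof. by have := nL_le; have := L_ge1; nia. Qed.

Lemma qb_le : q * b <= u.
Proof. exact: leq_trunc_div. Qed.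

Lemma Q_gt : 2 * q < Q.
Proof.
by have := up_logP (q * 2 + 1) (isT : 1 < 2); rewrite -/(par_kQ u n); lia.
Qed.

Lemma Q_le : Q <= 4 * q + 2.
Proof.
have /up_log_lt : 0 < q * 2 + 1 by lia.
by rewrite -/(par_kQ u n); lia.
Qed.

Lemma U_gt : u < U.
Proof. by have := up_logP (u + 1) (isT : 1 < 2); rewrite -/(par_kU u); lia. Qed.

Lemma U_le : U <= 2 * u + 2.
Proof.
have /up_log_lt : 0 < u + 1 by lia.
by rewrite -/(par_kU u); lia.
Qed.

Lemma N_ge : 512 * (u * b) <= 2 ^ K.
Proof. by rewrite mulnA; apply: up_logP. Qed.

Lemma N_le : 2 ^ K <= 1024 * (u * b).
Proof.
have /up_log_lt : 0 < 512 * u * b by have := b_ge1; nia.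
by rewrite -/(par_K u n); lia.
Qed.

Lemma ub_ge : u <= u * b. Proof. by rewrite leq_pmulr // b_ge1. Qed.

Lemma K_ge4 : 3 < K.
Proof.
rewrite ltnNge; apply/negP => h.
have : 2 ^ K <= 2 ^ 3 by rewrite leq_exp2l.
by have := N_ge; have := ub_ge; rewrite (_ : 2 ^ 3 = 8) //; lia.
Qed.

(** As b <= n <= u + 1, N is polynomial in u: this is where log N becomes O(log u). *)
Lemma K_le_lu : K <= 15 * lu.
Proof.
have h : K <= 13 + 2 * lu; last by have := lu_ge1; lia.
have ul : u < 2 ^ lu.+1 by apply: trunc_log_ltn.
have : 512 * u * b <= 2 ^ (13 + 2 * lu).
  apply: (@leq_trans (2 ^ 9 * (2 ^ lu.+1 * 2 ^ lu.+2))); last first.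
    by rewrite -!expnD leq_exp2l //; lia.
  rewrite -mulnA leq_mul //.
  apply: leq_mul; first exact: ltnW.
  apply: leq_trans b_le_n (leq_trans nu _); rewrite expnS; lia.
by apply: up_log_min.
Qed.

(** The balance behind [par_b]: Q is at most 4 u / b + 2 and n L at most 4 b^2. *)
Lemma QnL_le : Q * (n * L) <= 32 * (u * b).
Proof.
apply: (@leq_trans ((4 * q + 2) * (4 * (b * b)))).
  by apply: leq_mul; [exact: Q_le|exact: nL_le].
have h1 : q * b * b <= u * b by rewrite leq_mul2r qb_le orbT.
have h2 : b * b <= 2 * (u * b).
  by rewrite mulnA leq_mul2r; apply/orP; right; have := b_le_n; lia.
rewrite (_ : _ * _ = 16 * (q * b * b) + 8 * (b * b)); last by ring.
lia.
Qed.

Lemma Qn_le : Q * n <= 32 * (u * b).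
Proof.
by apply: leq_trans QnL_le; rewrite leq_mul2l leq_pmulr ?orbT // L_ge1.
Qed.

Lemma sizes_le g : g <= 2 * n -> 2 * Q * g <= 2 ^ K /\ 2 * U <= 2 ^ K.
Proof.
move=> gn; have h1 := Qn_le; have h2 := N_ge; have h3 := ub_ge; have h4 := U_le.
split; last by lia.
have : Q * g <= Q * (2 * n) by rewrite leq_mul2l gn orbT.
by rewrite mulnCA -mulnA; lia.
Qed.

End Sizes.

(* Registers: 16 [N], 17 [u], 18 [n], 19 [b], 20 [q], 21 [Q], 22 [U]; 24 to 27 the
   bases [N] of the input, [6N] of the work blocks, [7N] of the accumulator and
   [8N] of the quotients of the current class; 28 the class, 29 its size.
   The cells from [2N] to [6N] are the buffers and tables of the transform. *)
Definition PARAMS :=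
  17 ::= Var 0 ;;; 18 ::= Var 1 -e Var 17 ;;;
  TLOG 23 35 (Var 18) ;;;
  36 ::= Var 18 *e Var 23 ;;;
  LSQRT 19 (Var 36) ;;;
  20 ::= Var 17 /e Var 19 ;;;
  POW2 21 (Var 20 *e Cst 2 +e Cst 1) ;;;
  POW2 22 (Var 17 +e Cst 1) ;;;
  POW2 16 (Cst 512 *e Var 17 *e Var 19).

Definition CONSTS :=
  7 ::= Cst 2 *e Var 16 ;;; 8 ::= Cst 3 *e Var 16 ;;;
  9 ::= Cst 4 *e Var 16 ;;; 10 ::= Cst 5 *e Var 16 ;;;
  24 ::= Var 16 ;;; 25 ::= Cst 6 *e Var 16 ;;;
  26 ::= Cst 7 *e Var 16 ;;; 27 ::= Cst 8 *e Var 16 ;;;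
  35 ::= Var 16 *e Var 16 ;;; 36 ::= Var 35 *e Var 35 ;;;
  37 ::= Var 36 *e Var 36 ;;; 38 ::= Var 37 *e Var 37 ;;;
  4 ::= Var 38 *e Var 38 ;;;
  39 ::= Var 36 *e Var 37 *e Var 4 ;;;
  35 ::= Var 4 *e Var 39 ;;;
  3 ::= Cst 4 *e Var 35 ;;;
  2 ::= Var 3 *e Var 3 +e Cst 1 ;;;
  5 ::= Var 35 *e (Var 3 +e Cst 1) ;;;
  6 ::= Var 2 -e Var 39 *e (Var 3 +e Cst 1) ;;;
  11 ::= Var 4 +e Var 35.

(** Heap addresses are machine addresses minus 80, whence 81 = 80 + 1. All sources lie below N, so
    writing from N on destroys none of them. *)
Definition COPYIN :=
  For 35 (Var 18) (
    If (Cst 78 -e Var 35)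
      (36 ::= Deref (Cst 80 *e Var 1 -e Cst 81 +e Var 35))
      (36 ::= Deref (Var 35 -e Cst 78)) ;;;
    Sto (Var 24 +e Var 35) (Var 36)).

Definition ZERO e a := For 35 e (Sto (a +e Var 35) (Cst 0)).

Definition SETUP :=
  PARAMS ;;; CONSTS ;;; TABLE ;;; COPYIN ;;; ZERO (Var 22) (Var 26) ;;; Sto (Var 26) (Cst 1).

Lemma zero_ok B e a x n s h : (forall s', same_but (pred1 35) s s' -> forall h, ev e s' h = n /\ ev a s' h = x) ->
  n < B -> x + n <= B ->
  wp B (ZERO e a) (n * 3 + 2) (fun s' h' => same_but (pred1 35) s s' /\
    forall y, h' y = blit h x n (fun=> 0) y) s h.
Proof.
move=> He nB xB.
pose I i (s' h' : store) := same_but (pred1 35) s s' /\ forall y, h' y = blit h x i (fun=> 0) y.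
apply: (@wp_for_unif _ _ _ _ _ 1 I) => //.
- split=> [y|y]; first by rewrite inE => yd; rewrite upd_neq.
  by rewrite blit_out // addn0; lia.
- by move=> i s' h' _ [sm _] _; rewrite (He _ sm _).1.
move=> i s' h' iln [sm hh] e35; have [_ ea] := He _ sm h'.
apply: wp_sto; rewrite /= ?ea ?e35; [lia|lia|].
split=> //; split=> [y yd|y].
  by rewrite upd_neq ?sm.
rewrite updE hh /blit; case: (eqVneq y (x + i)) => [->|ne].
  by rewrite ifT //; lia.
by have -> : (x <= y < x + i.+1) = (x <= y < x + i) by lia.
Qed.

Lemma enc_bounds D Hd : 0 < D -> 0 < Hd ->
  [/\ D + D * Hd <= encM D Hd, Hd <= D * Hd, encH D Hd <= encM D Hd,
      encoff1 D Hd <= encM D Hd & encoff2 D Hd <= encM D Hd].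
Proof.
move=> D0 H0; rewrite /encoff1 /encoff2 /encM /encH.
have h1 : Hd <= D * Hd by rewrite leq_pmull.
have h2 : D <= D * Hd by rewrite leq_pmulr.
move: (D * Hd) h1 h2 => z h1 h2; split=> //; try lia.
- by have : z <= z * z; nia.
- by nia.
by nia.
Qed.

(** * Correctness of the initial phase *)

Section Setup.
Variables (u n B : nat) (lst : seq nat).
Hypotheses (u2 : 2 <= u) (n2 : 2 <= n) (nu : n <= u.+1) (szl : size lst = n) (lu : all (leq^~ u) lst).
Local Notation L := (trunc_log 2 n).
Local Notation b := (par_b n).
Local Notation q := (par_q u n).
Local Notation Q := (2 ^ par_kQ u n).
Local Notation U := (2 ^ par_kU u).
Local Notation K := (par_K u n).
Local Notation N := (2 ^ K).
Local Notation D := (fft_D K).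
Local Notation Hd := (fft_Hd K).
Local Notation H := (encH D Hd).
Local Notation M0 := (encM D Hd).
Hypothesis BM : 4 * M0 < B.

Definition penv (s : store) := [/\ s 16 = N, s 17 = u, s 18 = n & s 19 = b] /\
  [/\ s 20 = q, s 21 = Q & s 22 = U].

Definition genv (s : store) := [/\ penv s, fft_env K (2 * N) (3 * N) (4 * N) (5 * N) s &
  [/\ s 24 = N, s 25 = 6 * N, s 26 = 7 * N & s 27 = 8 * N]].

Definition gsame (s s' : store) := forall y, (1 < y < 12) || (15 < y < 28) -> s' y = s y.

Lemma genv_gsame s s' : gsame s s' -> genv s -> genv s'.
Proof.
move=> sm [[[? ? ? ?] [? ? ?]] [[? ? ? ? ?] [? ? ? ? ?]] [? ? ? ?]].
by split; split=> //; rewrite ?sm //; split; rewrite sm.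
Qed.

Lemma NN_le : N * N <= D.
Proof.
rewrite /fft_D -!expnM -!expnD leq_exp2l //; lia.
Qed.

Lemma N_ge16 : 16 <= N.
Proof. by rewrite -[16]/(2 ^ 4) leq_exp2l // (K_ge4 u2 n2 nu). Qed.

Lemma big_B : [/\ 4 * D <= H, H * H < M0, 100 * N <= B & 1024 <= N].
Proof.
have h1 := D_le_H K; have h2 := H_sq K; have h3 := NN_le; have h4 := N_ge16.
have h5 := N_ge u n; have h6 := ub_ge u2 n2 nu.
split=> //; last by lia.
have h8 : 16 * N <= N * N by rewrite leq_mul2r h4 orbT.
have h7 : H <= H * H by apply: leq_pmulr; have := DD_gt0 K; lia.
lia.
Qed.

Lemma params_ok s h : s 0 = u -> s 1 = u + n ->
  wp B PARAMS (2000 * (u * b)) (fun s' h' => [/\ penv s', s' 1 = u + n & h' = h]) s h.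
Proof.
move=> e0 e1; have [_ _ hB N1024] := big_B.
have b1 := b_ge1 u2 n2 nu; have bn := b_le_n u2 n2 nu; have ub1 := ub_ge u2 n2 nu; have Ng := N_ge u n.
have Nl := N_le u2 n2 nu; have qb := qb_le u n; have Ln := L_le_n u2 n2 nu; have bs := b_sq n.
have nL := nL_le u2 n2 nu; have q1 : q <= u by apply: leq_div.
have bb : b * b <= 2 * (u * b) by rewrite mulnA leq_mul2r; apply/orP; right; lia.
have nub : n <= 8 * (u * b) by have := n_le u2 n2 nu; lia.
apply: (wp_time (t := ((3 * n + 3) + ((2 * b + 2) + ((2 * (q * 2 + 1) + 2) + ((2 * (u + 1) + 2) + (2 * (512 * u * b) + 2))).+1).+1).+2)); last first.
  by rewrite -mulnA; lia.
apply: wp_seq_asn; rewrite /= ?e0; first by lia.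
move=> v1 E1; apply: wp_seq_asn; rewrite /= !updE /= e1 E1 addKn; first by lia.
move=> v2 E2; apply: (@wp_seq _ _ _ (3 * n + 3) _ _ _ _ _ _ (leqnn _)).
set s2 := upd _ 18 _.
apply: (wp_conseq (@tlog_ok B 23 35 (Var 18) n s2 h _ _ _ _)) => //; try lia.
  by move=> s' sm /=; rewrite sm // /s2 updE.
move=> s3 h3 [sm3 e23 ->].
have f3 y : y != 23 -> y != 35 -> s3 y = s2 y by move=> h1 h2; rewrite sm3 // inE negb_or h1.
apply: wp_seq_asn; rewrite /= ?e23 f3 // /s2 !updE /= E2; first by nia.
move=> v4 E4; apply: (@wp_seq _ _ _ (2 * b + 2) _ _ _ _ _ _ (leqnn _)).
set s4 := upd _ 36 _.
apply: (wp_conseq (@lsqrt_ok B 19 (Var 36) (n * L) s4 h _ _)) => //; try lia.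
  by move=> s' sm /=; rewrite sm // /s4 updE.
move=> s5 h5 [sm5 e19 ->].
have f5 y : y != 19 -> y != 36 -> y != 23 -> y != 35 -> s5 y = s2 y.
  by move=> ? ? ? ?; rewrite sm5 // /s4 upd_neq ?f3.
have e5 : [/\ s5 17 = u, s5 18 = n & s5 1 = u + n].
  by rewrite !f5 // /s2 !updE /=.
case: e5 => e17 e18 e1'.
apply: wp_seq_asn; rewrite /= e17 e19 -/(par_b n) -/(par_q u n); first by lia.
move=> v6 E6; apply: (@wp_seq _ _ _ (2 * (q * 2 + 1) + 2) _ _ _ _ _ _ (leqnn _)).
set s6 := upd _ 20 _.
apply: (wp_conseq (@pow2_ok B 21 (Var 20 *e Cst 2 +e Cst 1) (q * 2 + 1) s6 h _ _ _)) => //; try lia.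
  by move=> s' sm /=; rewrite sm // /s6 updE /= E6.
move=> s7 h7 [sm7 e21 ->].
apply: (@wp_seq _ _ _ (2 * (u + 1) + 2) _ _ _ _ _ _ (leqnn _)).
apply: (wp_conseq (@pow2_ok B 22 (Var 17 +e Cst 1) (u + 1) s7 h _ _ _)) => //; try lia.
  by move=> s' sm /=; rewrite sm // sm7 // /s6 updE /= e17.
move=> s8 h8 [sm8 e22 ->].
apply: (wp_conseq (@pow2_ok B 16 (Cst 512 *e Var 17 *e Var 19) (512 * u * b) s8 h _ _ _)) => //.
- by move=> s' sm /=; rewrite !sm // !sm8 // !sm7 // /s6 !updE /= e17 e19.
- by rewrite -mulnA; lia.
- by rewrite -mulnA; lia.
move=> s9 h9 [sm9 e16 ->]; split=> //; last first.
  by rewrite sm9 // sm8 // sm7 // /s6 updE.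
split; split=> //; rewrite sm9 // ?e22 // sm8 // ?e21 // sm7 // /s6 updE //= ?E6 //.
Qed.

Lemma consts_ok s h : penv s -> wp B CONSTS 20 (fun s' h' => [/\ genv s', s' 1 = s 1 & h' = h]) s h.
Proof.
move=> pe; have [[e16 e17 e18 e19] [e20 e21 e22]] := pe.
have [h1 h2 h3 h4] := big_B; have D0 := DD_gt0 K; have Hd0 := Hd_gt0 K.
have [g1 g2 g3 g4 g5] := enc_bounds D0 Hd0.
have g0 : D * Hd <= M0 by apply: leq_trans g1; apply: leq_addl.
have M0B : M0 < B by move: BM; clear; lia.
have pw i : i <= 32 -> N ^ i < B.
  move=> i32; apply: leq_ltn_trans M0B; apply: leq_trans (leq_trans (leq_addr _ _) g1).
  by rewrite /fft_D -expnD leq_pexp2l ?expn_gt0.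
have mul i j : N ^ i * N ^ j = N ^ (i + j) by rewrite expnD.
have eD : N ^ 16 * N ^ 16 = D by [].
have eHd : N ^ 12 * D = Hd by [].
have eH : 4 * (D * Hd) = H by [].
have eM : H * H + 1 = M0 by [].
have sN c : c <= 100 -> c * N < B.
  by move=> c1; apply: leq_ltn_trans M0B; apply: leq_trans (_ : N * N <= _);
    [rewrite leq_mul2r; apply/orP; right; move: c1 h4; clear; lia|
     apply: leq_trans NN_le (leq_trans (leq_addr _ _) g1)].
have lt x : x <= M0 -> x < B by move=> xM; apply: leq_ltn_trans xM M0B.
have ltx x y : x = y -> y <= M0 -> x < B by move=> ->; apply: lt.
have step c x e t P s0 h0 y : ev e s0 h0 = y -> y < B -> (forall v, v = y -> wp B c t P (upd s0 x v) h0) ->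
    wp B (x ::= e ;;; c) t.+1 P s0 h0.
  by move=> E1 E2 E3; apply: wp_seq_asn; rewrite E1.
apply: (@step _ _ _ _ _ _ _ (2 * N)); [by rewrite /= e16|exact: sN|move=> v7 E7].
apply: (@step _ _ _ _ _ _ _ (3 * N)); [by rewrite /= /upd /= e16|exact: sN|move=> v8 E8].
apply: (@step _ _ _ _ _ _ _ (4 * N)); [by rewrite /= /upd /= e16|exact: sN|move=> v9 E9].
apply: (@step _ _ _ _ _ _ _ (5 * N)); [by rewrite /= /upd /= e16|exact: sN|move=> v10 E10].
apply: (@step _ _ _ _ _ _ _ N); [by rewrite /= /upd /= e16|by rewrite -[N]mul1n; apply: sN|move=> v24 E24].
apply: (@step _ _ _ _ _ _ _ (6 * N)); [by rewrite /= /upd /= e16|exact: sN|move=> v25 E25].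
apply: (@step _ _ _ _ _ _ _ (7 * N)); [by rewrite /= /upd /= e16|exact: sN|move=> v26 E26].
apply: (@step _ _ _ _ _ _ _ (8 * N)); [by rewrite /= /upd /= e16|exact: sN|move=> v27 E27].
apply: (@step _ _ _ _ _ _ _ (N ^ 2)); [by rewrite /= /upd /= e16 mulnn|exact: pw|move=> v35 E35].
apply: (@step _ _ _ _ _ _ _ (N ^ 4)); [by rewrite /= /upd /= E35 mul|exact: pw|move=> v36 E36].
apply: (@step _ _ _ _ _ _ _ (N ^ 8)); [by rewrite /= /upd /= E36 mul|exact: pw|move=> v37 E37].
apply: (@step _ _ _ _ _ _ _ (N ^ 16)); [by rewrite /= /upd /= E37 mul|exact: pw|move=> v38 E38].
apply: (@step _ _ _ _ _ _ _ D); [by rewrite /= /upd /= E38|exact: (lt D (leq_trans (leq_addr _ _) g1))|move=> v4 E4].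
apply: (@step _ _ _ _ _ _ _ Hd); [by rewrite /= /upd /= E36 E37 E4 mul|exact: (lt Hd (leq_trans g2 g0))|move=> v39 E39].
clear E35 E36 E37 E38.
apply: (@step _ _ _ _ _ _ _ (D * Hd)); [by rewrite /= /upd /= E4 E39|exact: (lt _ g0)|move=> v35' E35].
apply: (@step _ _ _ _ _ _ _ H); [by rewrite /= /upd /= E35|exact: (lt _ g3)|move=> v3 E3].
apply: (@step _ _ _ _ _ _ _ M0); [by rewrite /= /upd /= E3|exact: (lt _ (leqnn _))|move=> v2 E2].
apply: (@step _ _ _ _ _ _ _ (encoff1 D Hd)); [by rewrite /= /upd /= E3 E35|exact: (lt _ g4)|move=> v5 E5].
apply: (@step _ _ _ _ _ _ _ (encoff2 D Hd)); [by rewrite /= /upd /= E2 E3 E39|exact: (lt _ g5)|move=> v6 E6].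
apply: wp_asn; rewrite /= /upd /= E4 E35; [exact: (lt _ g1)|move=> v11 E11].
by split=> //; split; split; rewrite /upd /= ?E11 //; split.
Qed.

Definition hinv (h : store) := fft_tables K (4 * N) (5 * N) h /\ forall j, j < n -> h (N + j) = nth 0 lst j.

Lemma nth_lst_le j : nth 0 lst j <= u.
Proof. exact: nth_le. Qed.

Lemma copyin_ok s h : genv s -> s 1 = u + n ->
  (forall j, j < n -> h (if j < 78 then 80 * (u + n) - 81 + j else j - 78) = nth 0 lst j) ->
  wp B COPYIN (n * 5 + 2) (fun s' h' => [/\ genv s', (forall j, j < n -> h' (N + j) = nth 0 lst j) &
    forall y, ~~ (N <= y < N + n) -> h' y = h y]) s h.
Proof.
move=> ge e1 hin; have [_ _ hB h1024] := big_B.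
have ub := ub_ge u2 n2 nu; have Ng := N_ge u n.
have [[[e16 e17 e18 e19] _] _ [e24 _ _ _]] := ge.
pose I i (s' h' : store) := [/\ gsame s s', s' 1 = u + n & forall y, h' y = blit h N i (nth 0 lst) y].
apply: (@wp_for_unif B 35 (Var 18) _ n 3 I) => //; first by lia.
- split=> //; first by move=> y Hy; rewrite upd_neq //; lia.
  by move=> y; rewrite blit_out //; lia.
- by move=> i s' h' _ [sm _ _] _; rewrite /= sm.
- move=> i s' h' iln [sm e1' hh] e35.
  have hi : h' (if i < 78 then 80 * (u + n) - 81 + i else i - 78) = nth 0 lst i.
    by rewrite hh blit_out ?hin //; case: ltnP; lia.
  have xB : nth 0 lst i < B by have := nth_lst_le i; lia.
  have nx v : v = nth 0 lst i -> wp B (Sto (Var 24 +e Var 35) (Var 36)) 1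
      (fun s' h' => s' 35 = i /\ I i.+1 (upd s' 35 i.+1) h') (upd s' 36 v) h'.
    move=> ->; apply: wp_sto; rewrite /= /upd /= ?e35 ?sm ?e24 //; first by lia.
    split=> //; split=> //; first by move=> y Hy; rewrite /= !ifF ?sm //; lia.
    move=> y; rewrite hh /blit; case: (eqVneq y (N + i)) => [->|ne].
      by rewrite ifT ?addKn //; lia.
    by have -> : (N <= y < N + i.+1) = (N <= y < N + i) by lia.
  apply: (@wp_seq _ _ _ 2 1) => //; apply: wp_if; rewrite /= e35 => c0.
    rewrite ifT in hi; last by lia.
    by apply: wp_asn; rewrite /= e35 e1' hi.
  rewrite ifF in hi; last by lia.
  by apply: wp_asn; rewrite /= e35 hi.
move=> s' h' [sm _ hh]; split; first exact: genv_gsame sm ge.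
  by move=> j jn; rewrite hh blit_in.
by move=> y out; rewrite hh blit_out.
Qed.

Lemma same_gsame s s' : same_but (pred1 35) s s' -> gsame s s'.
Proof. by move=> sm y Hy; apply: sm; rewrite inE; lia. Qed.

Lemma fft_regions : [&& 2 * N + N <= 3 * N, 3 * N + N <= 4 * N, 4 * N + N <= 5 * N & 5 * N + N <= B].
Proof. by have [_ _ hB _] := big_B; lia. Qed.

Lemma setup_ok s h : s 0 = u -> s 1 = u + n ->
  (forall j, j < n -> h (if j < 78 then 80 * (u + n) - 81 + j else j - 78) = nth 0 lst j) ->
  wp B SETUP (500 * (1000 * (u * b * K))) (fun s' h' => [/\ genv s', hinv h' &
    forall z, z < U -> h' (7 * N + z) = (z == 0)]) s h.
Proof.
move=> e0 e1 hin; have K4 := K_ge4 u2 n2 nu.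
have [_ _ hB h1024] := big_B.
have ub := ub_ge u2 n2 nu; have Ng := N_ge u n; have Nl := N_le u2 n2 nu.
have Ul := U_le u2 n2 nu; have Ug := U_gt u2 n2 nu.
apply: (wp_time (t := 2000 * (u * b) + (20 + (400 * (N * K) + ((n * 5 + 2) + ((U * 3 + 2) + 1)))))); last first.
  have h1 : N * K <= 1024 * (u * b * K) by rewrite mulnA leq_mul2r Nl orbT.
  have h2 : u * b <= u * b * K by rewrite leq_pmulr //; lia.
  move: h1 h2 ub Ul nu u2; clear; move: (N * K) (u * b * K) (u * b) U => x y z w; lia.
apply: (@wp_seq _ _ _ _ _ _ _ _ _ _ (leqnn _)); apply: (wp_conseq (params_ok h e0 e1)) => // s1 h1 [pe e1' ->].
apply: (@wp_seq _ _ _ _ _ _ _ _ _ _ (leqnn _)); apply: (wp_conseq (consts_ok h pe)) => // s2 h2 [ge e1'' ->].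
have [[[e16 _ _ _] _] fe _] := ge.
have M2 : 2 * M0 < B by move: BM; clear; lia.
apply: (@wp_seq _ _ _ _ _ _ _ _ _ _ (leqnn _)); apply: (wp_conseq (table_ok K4 fft_regions M2 h fe e16)) => //.
move=> s3 h3 [sm3 tb fr3].
have ge3 : genv s3 by apply: genv_gsame ge => y Hy; apply: sm3; lia.
have e13 : s3 1 = u + n by rewrite sm3 // e1'' e1'.
have hin3 j : j < n -> h3 (if j < 78 then 80 * (u + n) - 81 + j else j - 78) = nth 0 lst j.
  by move=> jn; rewrite fr3 ?hin //; case: ltnP; lia.
apply: (@wp_seq _ _ _ _ _ _ _ _ _ _ (leqnn _)); apply: (wp_conseq (copyin_ok ge3 e13 hin3)) => //.
move=> s4 h4 [ge4 in4 fr4].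
have [[_ [_ _ e22]] _ [_ _ e26 _]] := ge4.
apply: (@wp_seq _ _ _ _ _ _ _ _ _ _ (leqnn _)).
apply: (wp_conseq (@zero_ok B (Var 22) (Var 26) (7 * N) U s4 h4 _ _ _)) => //; try lia.
  by move=> s' sm h' /=; rewrite !sm.
move=> s5 h5 [sm5 hh5].
have ge5 := genv_gsame (same_gsame sm5) ge4.
have e26' : s5 26 = 7 * N by rewrite sm5.
apply: wp_sto; rewrite /= ?e26'; [lia|lia|].
split=> //.
- split; last by move=> j jn; rewrite upd_neq ?hh5 ?blit_out ?in4 //; lia.
  move=> j jn; have [t1 t2] := tb j jn.
  by rewrite !upd_neq ?hh5 ?blit_out ?fr4 ?t1 ?t2 //; lia.
move=> z zU; rewrite /upd -{2}[7 * N]addn0 eqn_add2l; case: eqP => // _.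
by rewrite hh5 blit_in.
Qed.

End Setup.

(** * One residue class *)

(** The whole input is scanned anew for each class: b scans of n <= u + 1 elements fit the budget.
    The sum of the two truncated differences is 0 exactly for equal residues. *)
Definition COLLECT :=
  29 ::= Cst 0 ;;;
  For 35 (Var 18) (
    36 ::= Deref (Var 24 +e Var 35) ;;;
    37 ::= Var 36 %e Var 19 ;;;
    If ((Var 37 -e Var 28) +e (Var 28 -e Var 37)) Skip
      (Sto (Var 27 +e Var 29) (Var 36 /e Var 19 +e Var 21) ;;;
       29 ::= Var 29 +e Cst 1)).

(** [Var 29 +e (Cst 1 -e Var 29)] is the maximum of the class size and 1, so an empty class still
    gets one leaf. Every leaf contains code 0, the empty set. *)
Definition BLOCKS :=
  POW2 30 (Var 29 +e (Cst 1 -e Var 29)) ;;;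
  31 ::= Var 21 *e Cst 2 *e Var 30 ;;;
  ZERO (Var 31) (Var 25) ;;;
  For 35 (Var 30) (Sto (Var 25 +e Var 35 *e (Var 21 *e Cst 2)) (Cst 1)) ;;;
  For 35 (Var 29) (Sto (Var 25 +e Var 35 *e (Var 21 *e Cst 2) +e Deref (Var 27 +e Var 35)) (Cst 1)).

(** Two neighbouring blocks are the two halves of a block of the next level, so each merge is a
    convolution in place and the total length is the same at all levels. *)
Definition LEVELS :=
  32 ::= Var 21 *e Cst 4 ;;;
  While (Var 31 +e Cst 1 -e Var 32) (
    33 ::= Cst 0 ;;;
    While (Var 31 -e Var 33) (
      12 ::= Var 25 +e Var 33 ;;; 13 ::= Var 32 ;;;
      14 ::= Var 21 ;;; 15 ::= Var 20 ;;; CONV ;;;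
      33 ::= Var 33 +e Var 32) ;;;
    32 ::= Var 32 *e Cst 2).

Definition SCATTER :=
  ZERO (Var 22) (Var 26 +e Var 22) ;;;
  For 35 (Var 31) (
    If (Deref (Var 25 +e Var 35))
      (36 ::= Var 35 %e Var 21 *e Var 19 +e Var 35 /e Var 21 *e Var 28 ;;;
       If (Var 17 +e Cst 1 -e Var 36) (Sto (Var 26 +e Var 22 +e Var 36) (Cst 1)) Skip)
      Skip).

(** The modulus equals the length of the block, so the test of [CONV] on the index modulo register
    14 becomes a plain comparison with u. *)
Definition MERGE :=
  12 ::= Var 26 ;;; 13 ::= Var 22 *e Cst 2 ;;; 14 ::= Var 22 *e Cst 2 ;;; 15 ::= Var 17 ;;; CONV.

(** The gap leaves out registers 12 to 15, the arguments of [CONV]. *)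
Definition esame k (s s' : store) := forall y, (1 < y < 12) || (15 < y < k) -> s' y = s y.

Lemma esame_trans k s1 s2 s3 : esame k s1 s2 -> esame k s2 s3 -> esame k s1 s3.
Proof. by move=> h1 h2 y Hy; rewrite h2 // h1. Qed.

Lemma esame_le k k' s s' : k <= k' -> esame k' s s' -> esame k s s'.
Proof. by move=> kk h y Hy; apply: h; lia. Qed.

Lemma esame_upd k s s' x v : esame k s s' -> (11 < x) && ((x < 16) || (k <= x)) -> esame k s (upd s' x v).
Proof. by move=> h Hx y Hy; rewrite upd_neq ?h //; lia. Qed.

(** * Correctness of the step for one class *)

Section ClassStep.
Variables (u n B l : nat) (lst : seq nat).
Hypotheses (u2 : 2 <= u) (n2 : 2 <= n) (nu : n <= u.+1) (szl : size lst = n) (lu : all (leq^~ u) lst).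
Local Notation L := (trunc_log 2 n).
Local Notation b := (par_b n).
Local Notation q := (par_q u n).
Local Notation Q := (2 ^ par_kQ u n).
Local Notation U := (2 ^ par_kU u).
Local Notation K := (par_K u n).
Local Notation N := (2 ^ K).
Local Notation M0 := (encM (fft_D K) (fft_Hd K)).
Hypothesis BM : 4 * M0 < B.
Hypothesis lb : l < b.
Local Notation genv := (genv u n).
Local Notation hinv := (hinv u n lst).

Lemma genv_esame s s' : esame 28 s s' -> genv s -> genv s'.
Proof. by move=> h; apply: genv_gsame => y Hy; apply: h. Qed.

(** The three ranges are the copy of the input, the tables of roots and the accumulated set of
    sums. *)
Definition keep (h h' : store) := forall a,
  [|| N <= a < 2 * N, 4 * N <= a < 6 * N | 7 * N <= a < 7 * N + U] -> h' a = h a.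

Lemma keep_trans h1 h2 h3 : keep h1 h2 -> keep h2 h3 -> keep h1 h3.
Proof. by move=> k1 k2 a Ha; rewrite k2 ?k1. Qed.

Lemma n_le_N : [/\ n <= N, u < N, 100 * N <= B & 2 * U <= N].
Proof.
have [_ _ hB _] := big_B u2 n2 nu szl lu BM; have Ng := N_ge u n; have ub := ub_ge u2 n2 nu.
by split=> //; [lia|lia|have [] := sizes_le u2 n2 nu (leq0n _)].
Qed.

Lemma keep_hinv h h' : keep h h' -> hinv h -> hinv h'.
Proof.
have [nN _ _ _] := n_le_N.
move=> kp [tb hin]; split=> j jN; last by rewrite kp ?hin //; apply/orP; left; lia.
by have [t1 t2] := tb j jN; split; rewrite kp ?t1 ?t2 //; apply/orP; right; lia.
Qed.

Let ys := quots lst b l.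
Let cnt := size ys.
Let kg := up_log 2 (maxn cnt 1).
Let g := 2 ^ kg.
Let T := Q * 2 * g.

Lemma cnt_le : cnt <= n.
Proof. by rewrite /cnt size_quots -szl count_size. Qed.

Lemma g_bounds : [/\ cnt <= g, g <= 2 * cnt + 1, g <= 2 * n & kg <= L.+1].
Proof.
have c0 : 0 < maxn cnt 1 by rewrite leq_max orbT.
have h1 := up_logP (maxn cnt 1) (isT : 1 < 2); have h2 := up_log_lt c0; have h3 := cnt_le.
rewrite -/kg -/g in h1 h2; split; try lia.
apply: up_log_min => //; apply: leq_trans (_ : n <= _); first by lia.
by apply: ltnW; apply: trunc_log_ltn.
Qed.

Lemma T_le : T <= N.
Proof.
by have [_ _ h _] := g_bounds; have [] := sizes_le u2 n2 nu h; rewrite /T mulnC mulnCA mulnA; lia.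
Qed.

Lemma quots_take_S i : i < n -> quots (take i.+1 lst) b l =
  if nth 0 lst i %% b == l then rcons (quots (take i lst) b l) (nth 0 lst i %/ b)
  else quots (take i lst) b l.
Proof.
move=> iln; rewrite /quots (take_nth 0) ?szl // filter_rcons.
by case: ifP => _ //; rewrite map_rcons.
Qed.

Lemma collect_ok s h : genv s -> hinv h -> s 28 = l ->
  wp B COLLECT (n * 7 + 3) (fun s' h' => [/\ esame 29 s s', s' 29 = cnt,
     (forall r, r < cnt -> h' (8 * N + r) = nth 0 ys r + Q) & keep h h']) s h.
Proof.
move=> ge hi e28; have [[[e16 e17 e18 e19] [e20 e21 e22]] _ [e24 _ _ e27]] := ge.
have [nN uN hB U2] := n_le_N; have ql : q <= u by apply: leq_div.
have [QN _] : Q <= N /\ True.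
  by split=> //; have := T_le; have : 0 < g by [rewrite expn_gt0]; rewrite /T; nia.
have xle j : nth 0 lst j <= u by apply: nth_le lu _.
pose I i (s' h' : store) := [/\ esame 29 s s', s' 29 = size (quots (take i lst) b l),
  (forall r, r < s' 29 -> h' (8 * N + r) = nth 0 (quots (take i lst) b l) r + Q) & keep h h'].
rewrite addnS; apply: wp_seq_asn => /=; first by lia.
move=> v0 E0; apply: (@wp_for_unif B 35 (Var 18) _ n 5 I) => //; first by lia.
- split=> //.
  + by apply: esame_upd => //; apply: esame_upd.
  + by rewrite take0 /upd /= E0.
  + by move=> r; rewrite /upd /= E0.
- by move=> i s' h' _ [sm _ _ _] _; rewrite /= sm.
- move=> i s' h' iln [sm e29 hs kp] e35.
  have ge' : genv s' by apply: genv_esame ge; apply: esame_le sm.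
  have [_ hin'] := keep_hinv kp hi.
  have sz : size (quots (take i lst) b l) <= i.
    by rewrite size_quots; apply: leq_trans (count_size _ _) _; rewrite size_take; case: ltnP => //; lia.
  have x' : h' (N + i) = nth 0 lst i by apply: hin'.
  apply: wp_seq_asn; rewrite /= sm // e24 e35 x'; first by have := xle i; lia.
  move=> v36 E36; apply: wp_seq_asn; rewrite /= /upd /= sm // e19 E36.
    by apply: leq_ltn_trans (leq_mod _ _) _; have := xle i; lia.
  move=> v37 E37; apply: wp_if; rewrite /= /upd /= sm // e28 E37 => cnd.
    apply: wp_skip; rewrite /I e35 quots_take_S // ifF; last by apply/negbTE/eqP => eq; rewrite eq subnn in cnd.
    split=> //; split=> //=.
    by move=> y Hy; rewrite !ifF ?sm //; lia.
  have cl : nth 0 lst i %% b == l by move: cnd; move: (_ %% _) => z cnd; apply/eqP; lia.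
  have xq : nth 0 lst i %/ b <= u by apply: leq_trans (leq_div _ _) (xle i).
  apply: (@wp_seq _ _ _ 1 1) => //; apply: wp_sto; rewrite /= /upd /= ?(sm 27) // ?(sm 19) // ?(sm 21) // ?e27 ?e19 ?e21 ?E36 ?e29.
  + by lia.
  + by move: xq; move: (_ %/ _) => z; lia.
  apply: wp_asn; rewrite /= /upd /= ?e29; first by lia.
  move=> v29 ->; rewrite e35; split=> //; rewrite /I quots_take_S // cl size_rcons; split=> /=.
  + by move=> y Hy; rewrite !ifF ?sm //; lia.
  + by rewrite addn1.
  + move=> r; rewrite addn1 ltnS leq_eqVlt eqn_add2l nth_rcons => /orP[/eqP ->|rl].
      by rewrite eqxx ltnn.
    by rewrite ltn_eqF // rl hs // e29.
  + by move=> a Ha; rewrite ifF ?kp //; apply/negbTE/eqP; lia.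
by move=> s' h' [sm e29 hs kp]; rewrite take_oversize ?szl // in e29 hs; split=> // r rc; apply: hs; rewrite e29.
Qed.

Lemma addr_eq a w r x i y : x < w -> y < w ->
  (a + r * w + x == a + i * w + y) = (r == i) && (x == y).
Proof.
move=> xw yw; rewrite -!addnA eqn_add2l; apply/eqP/andP => [e|[/eqP -> /eqP ->] //].
have e1 : r = i.
  have := congr1 (divn^~ w) e; rewrite !divnMDl ?(leq_ltn_trans _ xw) //.
  by rewrite !divn_small // !addn0.
by rewrite e1 in e *; move/eqP: e; rewrite eqn_add2l.
Qed.

Lemma ys_le : all (leq^~ q) ys.
Proof.
apply/allP => x /mapP[y]; rewrite mem_filter => /andP[_ /(allP lu) yu] ->.
by rewrite leq_div2r.
Qed.

Lemma slot_lt r : slot Q ys r < Q * 2.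
Proof.
have qQ := Q_gt u2 n2 nu; rewrite /slot; case: (ltnP r (size ys)) => rs; last by lia.
have h : nth 0 ys r <= q by apply: (allP ys_le); apply: mem_nth.
by lia.
Qed.

Definition outer (h h' : store) := forall a, 7 * N <= a -> h' a = h a.

Lemma blocks_ok s h : genv s -> s 29 = cnt -> (forall r, r < cnt -> h (8 * N + r) = nth 0 ys r + Q) ->
  wp B BLOCKS (2 * maxn cnt 1 + T * 3 + g * 3 + cnt * 3 + 9) (fun s' h' => [/\ esame 29 s s', s' 31 = T,
    (forall r x, r < g -> x < Q * 2 -> h' (6 * N + r * (Q * 2) + x) = blk Q q ys 0 r x) & keep h h']) s h.
Proof.
move=> ge e29 hs; have [[[e16 e17 e18 e19] [e20 e21 e22]] _ [e24 e25 _ e27]] := ge.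
have [nN uN hB U2] := n_le_N; have [cg g2c g2n kgL] := g_bounds; have TN := T_le; have cn := cnt_le.
have Q0 : 0 < Q by rewrite expn_gt0.
have Q20 : 0 < Q * 2 by lia.
have g0 : 0 < g by rewrite expn_gt0.
have Tg : T = g * (Q * 2) by rewrite /T mulnC.
have gT : g <= T by rewrite Tg leq_pmulr.
have QT : Q * 2 <= T by rewrite Tg leq_pmull.
apply: (wp_time (t := (2 * maxn cnt 1 + 2) + ((T * 3 + 2) + ((g * 3 + 2) + (cnt * 3 + 2))).+1)); last by lia.
apply: (@wp_seq _ _ _ _ _ _ _ _ _ _ (leqnn _)).
apply: (wp_conseq (@pow2_ok B 30 (Var 29 +e (Cst 1 -e Var 29)) (maxn cnt 1) s h _ _ _)) => //; try lia.
  by move=> s' sm /=; rewrite sm // e29; lia.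
move=> s1 h1 [sm1 e30 ->].
have S1 : esame 30 s s1 by move=> y Hy; apply: sm1; rewrite inE; lia.
rewrite -/kg -/g in e30.
apply: wp_seq_asn; rewrite /= S1 // e21 e30; first by rewrite -/T; lia.
rewrite -/T => v31 E31; set s2 := upd _ 31 _.
have S2 : esame 30 s s2 by apply: esame_upd.
have e31 : s2 31 = T by rewrite /s2 /upd /=.
have e30b : s2 30 = g by rewrite /s2 /upd /=.
apply: (@wp_seq _ _ _ _ _ _ _ _ _ _ (leqnn _)).
apply: (wp_conseq (@zero_ok B (Var 31) (Var 25) (6 * N) T s2 h _ _ _)) => //; try lia.
  by move=> s' sm h' /=; rewrite !sm // e31 S2.
move=> s3 h3 [sm3 hh3].
have S3 : esame 30 s s3.
  by apply: esame_trans S2 _ => y Hy; apply: sm3; rewrite inE; lia.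
have e31b : s3 31 = T by rewrite sm3.
have e30c : s3 30 = g by rewrite sm3.
have dcw r x : r < g -> x < Q * 2 -> r * (Q * 2) + x < T.
  by move=> rg xQ; rewrite Tg; apply: leq_trans (_ : r.+1 * (Q * 2) <= _); [rewrite mulSn; lia|rewrite leq_mul2r rg orbT].
apply: (@wp_seq _ _ _ (g * 3 + 2) _ _ _ _ _ _ (leqnn _)).
pose I i (s' h' : store) := [/\ esame 30 s s', s' 31 = T /\ s' 30 = g,
  (forall r x, r < g -> x < Q * 2 -> h' (6 * N + r * (Q * 2) + x) = (r < i) && (x == 0)),
  keep h h' & outer h h'].
apply: (@wp_for_unif B 35 (Var 30) _ g 1 I) => //; first by lia.
- split=> //.
  + by apply: esame_upd.
  + by move=> r x rg xQ; have := dcw r x rg xQ; move=> rx; rewrite hh3 -addnA blit_in.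
  + by move=> a Ha; rewrite hh3 blit_out //; lia.
  + by move=> a Ha; rewrite hh3 blit_out //; lia.
- by move=> i s' h' _ [_ [_ e] _ _ _] _; rewrite /= e.
- move=> i s' h' ig [sm [e31c e30d] hd kp ou] e35.
  have iT := dcw i 0 ig Q20; rewrite addn0 in iT.
  apply: wp_sto; rewrite /= ?(sm 25) // ?e25 ?(sm 21) // ?e21 ?e35; [lia|lia|].
  split=> //; split=> //; first by apply: esame_upd.
  + move=> r x rg xQ; rewrite /upd -[X in _ == X]addn0 addr_eq //.
    case: eqP => [->|ri]; rewrite /= ?hd // ?ltnS ?leqnn.
      by case: eqP => //= _; rewrite ltnn.
    by congr (nat_of_bool (_ && _)); lia.
  + by move=> a Ha; rewrite upd_neq ?kp //; apply/eqP; lia.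
  + by move=> a Ha; rewrite upd_neq ?ou //; apply/eqP; lia.
move=> s4 h4 [S4 [e31d e30d] hd4 kp4 ou4].
pose J i (s' h' : store) := [/\ esame 30 s s', s' 31 = T,
  (forall r x, r < g -> x < Q * 2 ->
     h' (6 * N + r * (Q * 2) + x) = (x == 0) || ((r < i) && (x == slot Q ys r))),
  keep h h' & outer h h'].
apply: (@wp_for_unif B 35 (Var 29) _ cnt 1 J) => //; first by lia.
- split=> //; first by apply: esame_upd.
  by move=> r x rg xQ; rewrite hd4 // rg /= orbF.
- by move=> i s' h' _ [sm _ _ _ _] _; rewrite /= sm.
- move=> i s' h' ig [sm e31c hd kp ou] e35.
  have ig' : i < g by lia.
  have sl : h' (8 * N + i) = slot Q ys i by rewrite ou ?hs //; [rewrite /slot ig; lia|lia].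
  have slQ := slot_lt i; have iT := dcw i _ ig' slQ.
  apply: wp_sto; rewrite /= ?(sm 25) // ?e25 ?(sm 21) // ?e21 ?e35 ?(sm 27) // ?e27 ?sl; [lia|lia|].
  split=> //; split=> //; first by apply: esame_upd.
  + move=> r x rg xQ; rewrite /upd addr_eq //.
    case: (r =P i) => [->|ri] /=; last by rewrite hd // (_ : (r < i.+1) = (r < i)) //; lia.
    by case: eqP => [->|ne]; rewrite ?hd // ltnSn /= ?orbT // ltnn /= orbF.
  + by move=> a Ha; rewrite upd_neq ?kp //; apply/eqP; lia.
  + by move=> a Ha; rewrite upd_neq ?ou //; apply/eqP; lia.
move=> s5 h5 [S5 e31e hd5 kp5 ou5]; split=> //; first exact: esame_le S5.
move=> r x rg xQ; rewrite hd5 //=; case: (ltnP r cnt) => //= rc.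
by rewrite /slot ifF ?orbF ?orbb // ltnNge rc.
Qed.

Definition lvl j := Q * 2 * 2 ^ j.

Definition at_level j (h : store) := forall r x, r < 2 ^ (kg - j) -> x < lvl j ->
  h (6 * N + r * lvl j + x) = blk Q q ys j r x.

Lemma lvlS j : lvl j.+1 = lvl j + lvl j.
Proof. by rewrite /lvl expnS; lia. Qed.

Lemma lvl_pow j : lvl j = 2 ^ (par_kQ u n + j.+1).
Proof. by rewrite /lvl -expnSr -expnD; congr expn; lia. Qed.

Lemma lvl_T j r : j <= kg -> r < 2 ^ (kg - j) -> r * lvl j + lvl j <= T.
Proof.
move=> jk rk; rewrite -mulSnr (_ : T = 2 ^ (kg - j) * lvl j) ?leq_mul2r ?rk ?orbT //.
by rewrite /T /g /lvl mulnCA -expnD subnK.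
Qed.

Lemma lvl_pos j : 0 < lvl j. Proof. by rewrite /lvl !muln_gt0 !expn_gt0. Qed.

Lemma merge_step j r s h t : genv s -> hinv h -> j < kg -> r < 2 ^ (kg - j.+1) ->
  s 31 = T -> s 32 = lvl j.+1 -> s 33 = r * lvl j.+1 ->
  60 * (lvl j.+1 * K) <= t ->
  (forall x, x < lvl j -> h (6 * N + r * lvl j.+1 + x) = blk Q q ys j (r * 2) x /\
     h (6 * N + r * lvl j.+1 + lvl j + x) = blk Q q ys j (r * 2).+1 x) ->
  wp B (12 ::= Var 25 +e Var 33 ;;; 13 ::= Var 32 ;;; 14 ::= Var 21 ;;; 15 ::= Var 20 ;;; CONV ;;;
        33 ::= Var 33 +e Var 32) (t + 5) (fun s' h' => [/\ esame 33 s s', s' 33 = r.+1 * lvl j.+1,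
    (forall x, x < lvl j.+1 -> h' (6 * N + r * lvl j.+1 + x) = blk Q q ys j.+1 r x) &
    forall a, ~~ (2 * N <= a < 4 * N) -> ~~ (6 * N + r * lvl j.+1 <= a < 6 * N + r.+1 * lvl j.+1) -> h' a = h a]) s h.
Proof.
move=> ge hi jk rk e31 e32 e33 tt hb.
have [[[e16 e17 e18 e19] [e20 e21 e22]] fe [e24 e25 _ e27]] := ge.
have [nN uN hB U2] := n_le_N; have TN := T_le; have lT := lvl_T jk rk.
have l0 := lvl_pos j.+1; have K4 := K_ge4 u2 n2 nu; have qQ := Q_gt u2 n2 nu.
have qu : q <= u by apply: leq_div.
have QN : Q <= N.
  by apply: leq_trans TN; rewrite /T -mulnA leq_pmulr // muln_gt0 expn_gt0.
pose m := par_kQ u n + j.+2; have lm : lvl j.+1 = 2 ^ m := lvl_pow j.+1.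
have lm1 : lvl j = 2 ^ m.-1 by rewrite lvl_pow /m; congr expn; lia.
have m0 : 0 < m by rewrite /m; lia.
have mK : m <= K by rewrite -(leq_exp2l _ _ (isT : 1 < 2)) -lm; lia.
apply: (wp_time (t := (t + 1).+4)); last by lia.
apply: wp_seq_asn; rewrite /= e25 e33; first by lia.
move=> v12 E12; apply: wp_seq_asn; rewrite /= /upd /= e32; first by lia.
move=> v13 E13; apply: wp_seq_asn; rewrite /= /upd /= e21; first by lia.
move=> v14 E14; apply: wp_seq_asn; rewrite /= /upd /= e20; first by lia.
move=> v15 E15; set s1 := (X in wp _ _ _ _ X _).
have S1 : esame 40 s s1.
  by move=> y Hy; rewrite /s1 /= !ifF //; apply/negbTE/eqP; lia.
have ce : conv_env K (2 * N) (3 * N) (4 * N) (5 * N) m (6 * N + r * lvl j.+1) Q q s1.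
  have [_ fe1 _] := genv_esame (esame_le (isT : 28 <= 40) S1) ge.
  by split=> //; rewrite /s1 /= ?E12 ?E13 ?E14 ?E15.
have M0B : M0 < B by move: BM; clear; lia.
have br : (5 * N + N <= 6 * N + r * lvl j.+1) && (6 * N + r * lvl j.+1 + 2 ^ m <= B) by rewrite -lm; lia.
have f0 i : 2 ^ m.-1 <= i -> blk Q q ys j (r * 2) i = false /\ blk Q q ys j (r * 2).+1 i = false.
  rewrite -lm1 => li; have no x : blk Q q ys j x i = false.
    by apply/negP => /(blk_lt qQ ys_le); rewrite -/(lvl j) ltnNge li.
  by rewrite !no.
have ci : conv_in m (6 * N + r * lvl j.+1) (blk Q q ys j (r * 2)) (blk Q q ys j (r * 2).+1) h.
  by move=> p; rewrite -lm1 => pl; apply: hb.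
have Q0 : 0 < Q by rewrite expn_gt0.
have qB : q.+1 < B by lia.
have [tb _] := hi.
apply: (@wp_seq _ _ _ t 1) => //.
apply: (wp_conseq (conv_ok K4 (fft_regions u2 n2 nu szl lu BM) M0B m0 mK br f0 Q0 qB ce tb ci)).
  by apply: leq_trans tt; rewrite -lm !leq_mul2l mK orbT.
move=> s2 h2 [sm2 hh2 fr2].
have S2 : esame 40 s s2 by apply: esame_trans S1 _ => y Hy; apply: sm2; lia.
apply: wp_asn; rewrite /= !S2 // e33 e32 -mulSnr; first by rewrite mulSnr; lia.
move=> v ->; split=> //.
- by apply: esame_upd => //; apply: esame_le S2.
- by move=> x xm; rewrite hh2 // -lm.
move=> a o1 o2; apply: fr2; first by lia.
by move: o2; rewrite mulSnr -lm; lia.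
Qed.

Lemma levels_ok s h : genv s -> hinv h -> s 31 = T -> at_level 0 h ->
  wp B LEVELS (kg * (100 * (T * K)) + 2) (fun s' h' => [/\ esame 32 s s',
    (forall x, x < T -> h' (6 * N + x) = blk Q q ys kg 0 x) & keep h h']) s h.
Proof.
move=> ge hi e31 al0.
have [[[e16 e17 e18 e19] [e20 e21 e22]] fe [e24 e25 _ e27]] := ge.
have [nN uN hB U2] := n_le_N; have TN := T_le; have K4 := K_ge4 u2 n2 nu.
have T0 : 0 < T by rewrite !muln_gt0 !expn_gt0.
have Tl : lvl kg = T by [].
apply: (wp_time (t := (kg * (100 * (T * K)) + 1).+1)); last by lia.
apply: wp_seq_asn; rewrite /= e21.
  have : Q * 2 <= T by rewrite /T leq_pmulr // expn_gt0.
  by lia.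
move=> v32 E32.
have l1 : lvl 1 = v32 by rewrite E32 /lvl; lia.
pose I jm (s' h' : store) := [/\ esame 32 s s', jm <= kg, s' 32 = lvl (kg - jm).+1,
  at_level (kg - jm) h' & keep h h'].
have [TK HTK] : exists TK, TK = T * K by exists (T * K).
have TK1 : T <= TK by rewrite HTK leq_pmulr //; lia.
rewrite -HTK -(prednK (_ : 0 < 100 * TK)); last by lia.
apply: (@wp_while _ _ _ _ I).
- split=> //; rewrite ?subnn //.
  + exact: esame_upd.
- move=> jm s' h' [sm jk e32 al kp] /=; rewrite sm // e31 e32 => c0; split=> //.
  have j0 : jm = 0.
    apply/eqP; rewrite -leqn0 leqNgt; apply/negP => jp.
    have : lvl (kg - jm).+1 <= T.
      by rewrite -Tl !lvl_pow leq_exp2l // leq_add2l; lia.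
    by move: c0; lia.
  by move=> x xT; have := al 0 x; rewrite j0 subn0 subnn mul0n addn0; apply.
move=> jm s' h' [sm jk e32 al kp] /=; rewrite sm // e31 e32 => c0.
have jp : 0 < jm.
  rewrite lt0n; apply/negP => /eqP e; move: c0; rewrite e subn0 lvlS Tl.
  by apply/negP; rewrite negbK subn_eq0; lia.
exists jm.-1; first by rewrite prednK.
have [j ej] : exists j, kg - jm = j by exists (kg - jm).
have jk1 : kg - jm.-1 = j.+1 by lia.
have jlt : j < kg by lia.
rewrite ej in e32 al.
have [R HR] : exists R, R = 2 ^ (kg - j.+1) by exists (2 ^ (kg - j.+1)).
have RT : R * lvl j.+1 = T.
  by rewrite HR /T /g /lvl mulnCA -expnD subnK.
have Rp : 0 < R by rewrite HR expn_gt0.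
have R1 : R <= T by rewrite -RT leq_pmulr // lvl_pos.
have [w Hw] : exists w, w = 60 * (lvl j.+1 * K) by exists (60 * (lvl j.+1 * K)).
have Rw : R * w = 60 * TK by rewrite Hw HTK -RT; ring.
apply: (wp_time (t := (R * (w + 5).+1 + 1 + 1).+1)); last first.
  have -> : R * (w + 5).+1 = R * w + 6 * R by ring.
  by rewrite Rw; move: TK1 T0 R1; clear; lia.
apply: wp_seq_asn => /=; first by lia.
move=> v33 E33; apply: (@wp_seq _ _ _ (R * (w + 5).+1 + 1) 1) => //.
(* With [R - rm] merges done, the cells left of the cursor are already at level j + 1 and those
   right of it still at level j. *)
pose J rm (s2 h2 : store) := [/\ esame 33 s' s2, rm <= R /\ s2 33 = (R - rm) * lvl j.+1,
  (forall r x, r < R - rm -> x < lvl j.+1 -> h2 (6 * N + r * lvl j.+1 + x) = blk Q q ys j.+1 r x),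
  (forall r x, r < 2 ^ (kg - j) -> (R - rm) * 2 <= r -> x < lvl j -> h2 (6 * N + r * lvl j + x) = blk Q q ys j r x) & keep h h2].
have R2 : 2 ^ (kg - j) = R * 2 by rewrite HR -expnSr; congr expn; lia.
apply: (@wp_while _ _ _ _ J).
- split=> //; first exact: esame_upd.
  + by rewrite /upd /= E33 subnn.
  + by rewrite subnn.
  + by move=> r x rk _ xl; apply: al.
- move=> rm s2 h2 [sm2 [rR e33] hd1 hd2 kp2] /=; rewrite (sm2 31) // (sm 31) // e31 e33 => c1.
  have r0 : rm = 0.
    have : (R - rm) * lvl j.+1 >= R * lvl j.+1 by rewrite RT -subn_eq0; apply/eqP.
    have R0 := Rp.
    by rewrite leq_mul2r eqn0Ngt lvl_pos /=; move: rR R0; clear; lia.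
  apply: wp_asn; rewrite /= sm2 // e32.
    have : lvl j.+1 <= T by rewrite -RT leq_pmull.
    by move: TN hB; clear; lia.
  move=> v ->; split=> //; rewrite ?jk1 //.
  + by apply: esame_upd => //; apply: esame_trans sm (esame_le _ sm2).
  + by move: jk; clear; lia.
  + by rewrite /upd /= (lvlS j.+1) muln2 addnn.
  + by move=> r x; rewrite -HR => rR' xl; apply: hd1 => //; rewrite r0 subn0.
move=> rm s2 h2 [sm2 [rR e33] hd1 hd2 kp2] /=; rewrite (sm2 31) // (sm 31) // e31 e33 => c1.
have rp : 0 < rm.
  by rewrite lt0n; apply/eqP => e; move: c1; rewrite e subn0 RT subnn.
exists rm.-1; first by rewrite prednK.
have [r er] : exists r, R - rm = r by exists (R - rm).
have rR1 : r < R by rewrite -er; move: rp rR; clear; lia.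
have er' : R - rm.-1 = r.+1 by rewrite -er; move: rp rR; clear; lia.
rewrite er in e33 hd1 hd2.
have ge2 : genv s2.
  by apply: genv_esame ge; apply: esame_trans (esame_le _ sm) (esame_le _ sm2).
have lj : r * 2 * lvl j = r * lvl j.+1 by rewrite lvlS addnn -muln2 mulnA mulnAC.
have lj1 : (r * 2).+1 * lvl j = r * lvl j.+1 + lvl j by rewrite mulSnr lj.
have lT1 : r.+1 * lvl j.+1 <= T by rewrite -RT leq_mul2r rR1 orbT.
apply: (wp_conseq (@merge_step j r s2 h2 w ge2 (keep_hinv kp2 hi) jlt _ _ _ e33 _ _)) => //.
- by rewrite -HR.
- by rewrite sm2 // sm.
- by rewrite sm2.
- by rewrite Hw.
- move=> x xl; split.
    by have := hd2 (r * 2) x; rewrite lj; apply=> //; rewrite R2 ltn_mul2r.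
  by have := hd2 (r * 2).+1 x; rewrite lj1 addnA; apply=> //; rewrite ?R2; move: rR1; clear; lia.
move=> s3 h3 [sm3 e33' hd3 fr3].
split=> //.
- by apply: esame_trans sm2 sm3.
- by rewrite er'; split=> //; move: rR; clear; lia.
- rewrite er' => r' x; rewrite ltnS leq_eqVlt => /orP[/eqP ->|rr] xl; first exact: hd3.
  have : r'.+1 * lvl j.+1 <= r * lvl j.+1 by rewrite leq_mul2r rr orbT.
  rewrite mulSnr => h4.
  have : r'.+1 * lvl j.+1 <= T by apply: leq_trans lT1; rewrite leq_mul2r; apply/orP; right; move: rr rR1; clear; lia.
  rewrite mulSnr => h5.
  rewrite fr3 ?hd1 //; first by move: xl h5 (T_le); clear; lia.
  by move: xl h4; clear; lia.
- rewrite er' => r' x rk rr xl.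
  have h4 : r.+1 * 2 * lvl j <= r' * lvl j by rewrite leq_mul2r rr orbT.
  have h5 : r.+1 * lvl j.+1 = r.+1 * 2 * lvl j by rewrite lvlS addnn -muln2 mulnA mulnAC.
  rewrite fr3 ?hd2 //; try by move: h4 h5 xl rr; clear; lia.
  
apply: keep_trans kp2 _ => a Ha; apply: fr3; first by move: Ha; clear; lia.
by move: TN lT1 Ha; clear; lia.
Qed.

Definition code_val x := x %% Q * b + x %/ Q * l.
Definition hit (c : nat -> bool) i z := [exists x : 'I_i, c x && (code_val x == z)].

Lemma hitS c i z : hit c i.+1 z = hit c i z || c i && (code_val i == z).
Proof.
apply/existsP/orP => [[x cx]|[/existsP[x cx]|ci]]; last by exists ord_max.
  case: (ltngtP x i) => [xi|ix|xi].
  - by left; apply/existsP; exists (Ordinal xi).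
  - by have := ltn_ord x; rewrite ltnS leqNgt ix.
  - by right; rewrite -xi.
by exists (widen_ord (leqnSn i) x).
Qed.

Lemma code_val_lt x : x < T -> code_val x < B.
Proof.
move=> xT; have [nN uN hB _] := n_le_N; have TN := T_le.
have [h1 h2 _ h4] := big_B u2 n2 nu szl lu BM; have NN : N * N <= fft_D K by exact: (NN_le u2 n2 nu szl lu BM).
have xQ : x %% Q <= N.
  by apply: ltnW; apply: leq_trans (leq_ltn_trans (leq_mod _ _) (leq_trans xT TN)) _.
have xd : x %/ Q <= N by apply: leq_trans (leq_div _ _) _; apply: ltnW (leq_trans xT TN).
have bN : b <= N by exact: leq_trans (b_le_n u2 n2 nu) nN.
have lN : l <= N by apply: ltnW (leq_trans lb bN).
have s1 := leq_mul xQ bN; have s2 := leq_mul xd lN.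
have D0 : 0 < fft_D K by apply: leq_trans _ NN; rewrite muln_gt0 !expn_gt0.
set H := encH _ _ in h1 h2.
have HH : H <= H * H by rewrite leq_pmulr //; move: h1 D0; clear; lia.
rewrite /code_val; move: s1 s2 HH h1 h2 NN BM; clear.
move: (x %% Q * b) (x %/ Q * l) M0 H (H * H) (fft_D K) (N * N) => *; lia.
Qed.

Lemma scatter_ok (c : nat -> bool) (s h : store) : genv s -> s 28 = l -> s 31 = T ->
  (forall x, x < T -> h (6 * N + x) = c x) ->
  wp B SCATTER (U * 3 + 2 + (T * 6 + 2)) (fun s' h' => [/\ esame 32 s s',
    forall z, z < U -> h' (7 * N + U + z) = (hit c T z && (z <= u)) & keep h h']) s h.
Proof.
move=> ge e28 e31 hc; have [[[e16 e17 e18 e19] [e20 e21 e22]] _ [e24 e25 e26 e27]] := ge.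
have [nN uN hB U2] := n_le_N; have TN := T_le; have UU : u < U := U_gt u2 n2 nu.
apply: (@wp_seq _ _ _ _ _ _ _ _ _ _ (leqnn _)).
apply: (wp_conseq (@zero_ok B (Var 22) (Var 26 +e Var 22) (7 * N + U) U s h _ _ _)) => //.
- by move=> s' sm h' /=; rewrite !sm // e22 e26.
- by move: U2 hB uN; clear; lia.
- by move: U2 hB uN; clear; lia.
move=> s1 h1 [sm1 hh1].
pose I i (s' h' : store) := [/\ esame 32 s s',
  (forall x, x < T -> h' (6 * N + x) = c x),
  (forall z, z < U -> h' (7 * N + U + z) = (hit c i z && (z <= u))) & keep h h'].
apply: (@wp_for_unif B 35 (Var 31) _ T 4 I) => //.
- by move: TN hB uN; clear; lia.
- split.
  + by apply: esame_upd => // y Hy; apply: sm1; rewrite inE; move: Hy; clear; lia.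
  + by move=> x xT; rewrite hh1 blit_out ?hc //; move: xT TN; clear; lia.
  + move=> z zU; rewrite hh1 blit_in // (_ : hit c 0 z = false) //; by apply/existsP => -[[]].
  + by move=> a Ha; rewrite hh1 blit_out //; move: Ha U2; clear; lia.
- by move=> i s' h' _ [sm _ _ _] _; rewrite /= sm.
- move=> i s' h' iT [sm hc' hz kp] e35.
  have Se k v : 32 <= k -> esame 32 s (upd s' k v) by move=> k32; apply: esame_upd => //; rewrite k32 orbT andbT; apply: leq_trans k32.
  have Ci : ev (Deref (Var 25 +e Var 35)) s' h' = c i by rewrite /= (sm 25) // e25 e35 hc'.
  apply: wp_if => [c1|c0].
  + rewrite Ci in c1; have {}c1 : c i by case: (c i) c1.
    apply: wp_seq_asn; rewrite /= ?(sm 21) ?(sm 19) ?(sm 28) // e35 e21 e19 e28 -/(code_val i).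
      exact: code_val_lt.
    move=> v Ev; apply: wp_if; rewrite /= /upd /= (sm 17) // e17 -/(upd s' 36 v).
      move=> vu; have {}vu : v <= u by rewrite subn_eq0 -ltnNge addn1 ltnS in vu.
      apply: wp_sto; rewrite /= /upd /= ?(sm 26) ?(sm 22) // ?e26 ?e22.
      * by move: vu UU U2 hB uN; clear; lia.
      * by move: hB uN; clear; lia.
      split=> //; split.
      * by apply: esame_upd => //; apply: (Se 36 v).
      * move=> x xT; rewrite ifF ?hc' //; apply/eqP; move: xT TN; clear; lia.
      * move=> z zU; rewrite eqn_add2l hitS c1 -Ev [v == z]eq_sym.
        by case: (z =P v) => [->|_]; rewrite ?vu ?orbT ?orbF // hz.
      * move=> a Ha; rewrite ifF ?kp //; apply/eqP; move: Ha vu UU U2; clear; lia.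
    move=> /eqP; rewrite subn_eq0 addn1 => uv.
    apply: wp_skip; split; first by rewrite /upd /=.
    split=> //; first by apply: esame_upd => //; apply: (Se 36 v).
    move=> z zU; rewrite hz // hitS c1 -Ev /=; case: (z =P v) => [->|]; last by case: eqP => [->|]; rewrite ?orbF.
    by rewrite leqNgt uv /= !andbF.
  have {}c0 : c i = false by move: c0; rewrite Ci; case: (c i).
  apply: wp_skip; split=> //; split=> //; first exact: Se.
  by move=> z zU; rewrite hz // hitS c0 orbF.
by move=> s' h' [].
Qed.

Definition conv_bits (fa fb : nat -> bool) z := [exists j : 'I_z.+1, fa j && fb (z - j)] && (z <= u).

Lemma merge_ok (fa fb : nat -> bool) s h : genv s -> hinv h ->
  (forall z, u < z -> fa z = false /\ fb z = false) ->
  (forall z, z < U -> h (7 * N + z) = fa z) -> (forall z, z < U -> h (7 * N + U + z) = fb z) ->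
  wp B MERGE (4 + 120 * (U * K)) (fun s' h' => [/\ esame 32 s s',
    forall z, z < U -> h' (7 * N + z) = conv_bits fa fb z & hinv h']) s h.
Proof.
move=> ge hi f0 ha hb; have [[[e16 e17 e18 e19] [e20 e21 e22]] fe [e24 e25 e26 e27]] := ge.
have [nN uN hB U2] := n_le_N; have UU : u < U := U_gt u2 n2 nu.
have K4 := K_ge4 u2 n2 nu; have M0B : M0 < B by move: BM; clear; lia.
have Um : U * 2 = 2 ^ (par_kU u).+1 by rewrite expnSr.
apply: (wp_time (t := (60 * (2 * U * K)).+4)); last by move: (U * K) (mulnA 2 U K) => x; move: (2 * U * K); clear; lia.
apply: wp_seq_asn; rewrite /= ?e26; first by move: hB uN; clear; lia.
move=> v12 E12; apply: wp_seq_asn; rewrite /= /upd /= e22; first by move: U2 hB uN; clear; lia.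
move=> v13 E13; apply: wp_seq_asn; rewrite /= /upd /= e22; first by move: U2 hB uN; clear; lia.
move=> v14 E14; apply: wp_seq_asn; rewrite /= /upd /= e17; first by move: U2 hB uN; clear; lia.
move=> v15 E15; set s1 := (X in wp _ _ _ _ X _).
have S1 : esame 40 s s1.
  by move=> y Hy; rewrite /s1 /= !ifF //; apply/negbTE/eqP; move: Hy; clear; lia.
have ce : conv_env K (2 * N) (3 * N) (4 * N) (5 * N) (par_kU u).+1 (7 * N) (U * 2) u s1.
  have [_ fe1 _] := genv_esame (esame_le (isT : 28 <= 40) S1) ge.
  by split=> //; rewrite /s1 /= ?E12 ?E13 ?E14 ?E15.
have mK : (par_kU u).+1 <= K by rewrite -(leq_exp2l _ _ (isT : 1 < 2)) -Um mulnC.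
have br : (5 * N + N <= 7 * N) && (7 * N + 2 ^ (par_kU u).+1 <= B).
  by rewrite -Um; move: U2 hB uN; clear; lia.
have f0' i : 2 ^ (par_kU u).+1.-1 <= i -> fa i = false /\ fb i = false.
  by move=> iU; apply: f0; apply: leq_trans UU iU.
have ci : conv_in (par_kU u).+1 (7 * N) fa fb h.
  by move=> p pU; rewrite ha // hb.
have Q0 : 0 < U * 2 by rewrite muln_gt0 expn_gt0.
have qB : u.+1 < B by move: hB uN; clear; lia.
have [tb hl] := hi.
apply: (wp_conseq (conv_ok K4 (fft_regions u2 n2 nu szl lu BM) M0B (ltn0Sn _) mK br f0' Q0 qB ce tb ci)).
  by rewrite -Um [U * 2]mulnC !leq_mul2l mK orbT.
move=> s2 h2 [sm2 hh2 fr2]; split.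
- by apply: esame_trans (esame_le _ S1) _ => // y Hy; apply: sm2; move: Hy; clear; lia.
- move=> z zU; rewrite hh2; last by rewrite -Um; move: zU; clear; lia.
  by rewrite /conv_out modn_small //; move: zU; clear; lia.
have fr a : (N <= a < 2 * N) || (4 * N <= a < 6 * N) -> h2 a = h a.
  by move=> Ha; apply: fr2; move: Ha; clear; lia.
split=> j jN; last by rewrite fr ?hl //; apply/orP; left; move: jN nN; clear; lia.
by have [t1 t2] := tb j jN; split; rewrite fr ?t1 ?t2 //; apply/orP; right; move: jN; clear; lia.
Qed.

(** The cut loses nothing: a subset with sum z <= u has quotient sum at most u / b, which is [q], so
    its code survives every merge. *)
Lemma class_hit z : uniq lst -> z <= u ->
  hit (blk Q q ys kg 0) T z <-> ssum lst (fun x => x %% b == l) z.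
Proof.
move=> us zu; have b0 : 0 < b := b_ge1 u2 n2 nu; have qQ : 2 * q < Q := Q_gt u2 n2 nu.
have [cg _ _ _] := g_bounds.
have cv t : sumn t <= q -> code_val (sumn t + size t * Q) = sumn t * b + size t * l.
  move=> tq; have tQ : sumn t < Q by move: tq qQ; clear; lia.
  by rewrite /code_val [sumn t + _ * Q]addnC modnMDl modn_small // divnMDl ?expn_gt0 // divn_small // addn0.
rewrite (ssum_class us b0); split.
  move=> /existsP[x /andP[/(blk_top qQ ys_le _ cg)[t [st tq xt]] /eqP <-]].
  by exists t; split=> //; rewrite xt cv.
move=> [t [st zt]]; have tq : sumn t <= q.
  by rewrite /par_q leq_divRL //; apply: leq_trans zu; rewrite zt leq_addr.
have bx : blk Q q ys kg 0 (sumn t + size t * Q) by apply/(blk_top qQ ys_le _ cg); exists t.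
apply/existsP; exists (Ordinal (blk_lt qQ ys_le bx)) => /=.
by rewrite bx cv // zt eqxx.
Qed.

Definition acc_bits (i : nat) (fa : nat -> bool) :=
  forall z, fa z <-> z <= u /\ ssum lst (fun x => x %% b < i) z.

(** Cutting both factors at u is harmless, because each part of a sum is at most the sum. *)
Lemma acc_step fa (c : nat -> bool) : acc_bits l fa ->
  (forall z, z <= u -> c z <-> ssum lst (fun x => x %% b == l) z) ->
  acc_bits l.+1 (conv_bits fa (fun z => c z && (z <= u))).
Proof.
move=> ha hc z; rewrite ssum_split; split.
  move=> /andP[/existsP[j /and3P[/ha[ju sj] cj zj]] zu]; split=> //.
  exists j, (z - j); split=> //; last by apply/hc.
  by rewrite subnKC // -ltnS.
move=> [zu [z1 [z2 [zz s1 s2]]]]; apply/andP; split=> //.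
have z1z : z1 < z.+1 by rewrite zz; clear; lia.
apply/existsP; exists (Ordinal z1z) => /=; rewrite (_ : z - z1 = z2); last by rewrite zz addKn.
have z1u : z1 <= u by apply: leq_trans zu; rewrite zz leq_addr.
have z2u : z2 <= u by apply: leq_trans zu; rewrite zz leq_addl.
by apply/and3P; split=> //; [apply/ha|apply/hc].
Qed.

Lemma class_ok fa s h : uniq lst -> genv s -> hinv h -> s 28 = l -> acc_bits l fa ->
  (forall z, z < U -> h (7 * N + z) = fa z) ->
  wp B (COLLECT ;;; BLOCKS ;;; LEVELS ;;; SCATTER ;;; MERGE)
    (100 * ((L + 2) * (T * K)) + 400 * (u * K)) (fun s' h' => [/\ esame 29 s s', hinv h' &
    exists fa', acc_bits l.+1 fa' /\ forall z, z < U -> h' (7 * N + z) = fa' z]) s h.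
Proof.
move=> us ge hi e28 ab ha.
have K4 := K_ge4 u2 n2 nu; have [cg g2c g2n kgL] := g_bounds.
pose t1 := n * 7 + 3; pose t2 := 2 * maxn cnt 1 + T * 3 + g * 3 + cnt * 3 + 9.
pose t3 := kg * (100 * (T * K)) + 2; pose t4 := U * 3 + 2 + (T * 6 + 2).
pose t5 := 4 + 120 * (U * K).
apply: (wp_time (t := t1 + (t2 + (t3 + (t4 + t5))))); last first.
  have gT : g <= T by rewrite /T leq_pmull // muln_gt0 expn_gt0.
  have {}cg : cnt <= g by [].
  have g0 : 0 < g by rewrite expn_gt0.
  have UU : U <= 3 * u by apply: leq_trans (U_le u2 n2 nu) _; move: u2; clear; lia.
  have h1 : kg * (T * K) <= (L.+1) * (T * K) by rewrite leq_mul2r kgL orbT.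
  have h2 : T * 4 <= T * K by rewrite leq_mul2l K4 orbT.
  have h3 : U * K <= 3 * (u * K) by rewrite mulnA leq_mul2r UU orbT.
  have h4 : u * 4 <= u * K by rewrite leq_mul2l K4 orbT.
  rewrite (_ : (L + 2) * (T * K) = L.+1 * (T * K) + T * K); last by rewrite addn2 mulSnr.
  rewrite /t1 /t2 /t3 /t4 /t5 [kg * (100 * _)]mulnCA.
  move: h1 h2 h3 h4 UU cg g0 gT nu u2; clear.
  move: U cnt g T (u * K) (U * K) (T * K) (L.+1 * (T * K)) (kg * (T * K)) => *; lia.
apply: (@wp_seq _ _ _ _ _ _ _ _ _ _ (leqnn _)).
apply: (wp_conseq (collect_ok ge hi e28)) => // s1 h1 [sm1 e29 hs kp1].
have ge1 := genv_esame (esame_le (isT : 28 <= 29) sm1) ge.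
have hi1 := keep_hinv kp1 hi.
apply: (@wp_seq _ _ _ _ _ _ _ _ _ _ (leqnn _)).
apply: (wp_conseq (blocks_ok ge1 e29 hs)) => // s2 h2 [sm2 e31 hb kp2].
have ge2 := genv_esame (esame_le (isT : 28 <= 29) sm2) ge1.
have hi2 := keep_hinv kp2 hi1.
have al0 : at_level 0 h2.
  by move=> r x; rewrite subn0 -/g /lvl expn0 muln1 => rg xl; rewrite hb.
apply: (@wp_seq _ _ _ _ _ _ _ _ _ _ (leqnn _)).
apply: (wp_conseq (levels_ok ge2 hi2 e31 al0)) => // s3 h3 [sm3 hb3 kp3].
have ge3 := genv_esame (esame_le (isT : 28 <= 32) sm3) ge2.
have hi3 := keep_hinv kp3 hi2.
have e31' : s3 31 = T by rewrite sm3.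
have e28' : s3 28 = l by rewrite sm3 // sm2 // sm1.
apply: (@wp_seq _ _ _ _ _ _ _ _ _ _ (leqnn _)).
apply: (wp_conseq (scatter_ok ge3 e28' e31' hb3)) => // s4 h4 [sm4 hb4 kp4].
have ge4 := genv_esame (esame_le (isT : 28 <= 32) sm4) ge3.
have hi4 := keep_hinv kp4 hi3.
pose c := hit (blk Q q ys kg 0) T.
have f0 z : u < z -> fa z = false /\ (c z && (z <= u)) = false.
  by rewrite ltnNge => uz; split; [apply/negP => /ab[zu _]; rewrite zu in uz|rewrite (negbTE uz) andbF].
have ha4 z : z < U -> h4 (7 * N + z) = fa z.
  move=> zU; have kz : [|| N <= 7 * N + z < 2 * N, 4 * N <= 7 * N + z < 6 * N | 7 * N <= 7 * N + z < 7 * N + U].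
    by rewrite leq_addr ltn_add2l zU !orbT.
  by rewrite kp4 // kp3 // kp2 // kp1 // ha.
apply: (wp_conseq (merge_ok ge4 hi4 f0 ha4 hb4)) => // s5 h5 [sm5 hb5 hi5]; split=> //.
  apply: esame_trans sm1 _; apply: esame_trans sm2 _.
  by apply: esame_le (esame_trans sm3 (esame_trans sm4 sm5)).
exists (conv_bits fa (fun z => c z && (z <= u))); split=> //.
by apply: acc_step => // z zu; apply: class_hit.
Qed.

End ClassStep.

(** * The algorithm *)

(** The last assignment adds [hbase] = 80, turning the heap cell of the result into the machine
    address that the output convention asks for. *)
Definition MAIN :=
  SETUP ;;;
  For 28 (Var 19) (COLLECT ;;; BLOCKS ;;; LEVELS ;;; SCATTER ;;; MERGE) ;;;
  0 ::= Cst 80 +e Var 26.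

(** * Correctness and running time of the whole program *)

Section Main.
Variables (u n B : nat) (lst : seq nat).
Hypotheses (u2 : 2 <= u) (n2 : 2 <= n) (nu : n <= u.+1) (szl : size lst = n) (lu : all (leq^~ u) lst).
Local Notation L := (trunc_log 2 n).
Local Notation b := (par_b n).
Local Notation q := (par_q u n).
Local Notation Q := (2 ^ par_kQ u n).
Local Notation U := (2 ^ par_kU u).
Local Notation K := (par_K u n).
Local Notation N := (2 ^ K).
Local Notation M0 := (encM (fft_D K) (fft_Hd K)).
Hypothesis BM : 4 * M0 < B.
Hypothesis us : uniq lst.
Local Notation genv := (genv u n).
Local Notation hinv := (hinv u n lst).

Let T i := Q * 2 * 2 ^ up_log 2 (maxn (size (quots lst b i)) 1).
Let t i := 100 * ((L + 2) * (T i * K)) + 400 * (u * K).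

(** A class with n_i elements has at most 2 n_i + 1 leaves, and b <= n, so the trees have total size
    at most 6 Q n. Their L + 2 <= 3 L levels then cost O(u b K) by [QnL_le], as do the b merges of
    length O(u). *)
Lemma classes_time : \sum_(i < b) (t i + 2) + 2 <= 100 * (1000 * (u * b * K)).
Proof.
have K4 := K_ge4 u2 n2 nu; have b0 : 0 < b := b_ge1 u2 n2 nu.
have L1 : 0 < L := L_ge1 n2; have bn : b <= n := b_le_n u2 n2 nu.
have sT : \sum_(i < b) T i <= 6 * (Q * n).
  apply: (@leq_trans (\sum_(i < b) (Q * 2 * (2 * size (quots lst b i) + 1)))).
    apply: leq_sum => i _; rewrite leq_mul2l; apply/orP; right.
    have := @up_log_lt (maxn (size (quots lst b i)) 1); rewrite leq_max orbT => /(_ isT).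
    by move: (2 ^ _) => x; clear; lia.
  rewrite -big_distrr big_split /= -big_distrr /= sum_size_quots // szl sum1_card card_ord.
  rewrite [6 * _]mulnCA -[Q * 2 * _]mulnA leq_mul2l; apply/orP; right.
  by move: bn; clear; lia.
have -> : \sum_(i < b) (t i + 2) = 100 * ((L + 2) * ((\sum_(i < b) T i) * K)) + b * (400 * (u * K) + 2).
  rewrite big_distrl big_distrr big_distrr /= -[b in b * _]card_ord -sum_nat_const -big_split /=.
  by apply: eq_bigr => i _; rewrite /t addnA.
have h1 : (L + 2) * ((\sum_(i < b) T i) * K) <= 18 * (32 * (u * b) * K).
  apply: (@leq_trans (3 * L * (6 * (Q * n) * K))).
    apply: leq_mul; first by move: L1; clear; lia.
    by rewrite leq_mul2r sT orbT.
  have -> : 3 * L * (6 * (Q * n) * K) = 18 * (Q * (n * L) * K) by ring.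
  by rewrite leq_mul2l leq_mul2r (QnL_le u2 n2 nu) !orbT.
have h2 : b * (400 * (u * K) + 2) = 400 * (u * b * K) + 2 * b by ring.
have h3 : 18 * (32 * (u * b) * K) = 576 * (u * b * K) by ring.
have h4 : 1 * b * 1 <= u * b * K.
  by apply: leq_mul; [rewrite leq_mul2r; apply/orP; right; apply: ltnW|apply: leq_trans K4].
rewrite h2; rewrite h3 in h1; move: h1 h4 b0; clear.
by move: (u * b * K) ((L + 2) * _) => x y; clear; lia.
Qed.

Lemma main_ok s h : s 0 = u -> s 1 = u + n ->
  (forall j, j < n -> h (if j < 78 then 80 * (u + n) - 81 + j else j - 78) = nth 0 lst j) ->
  wp B MAIN (1000 * (1000 * (u * b * K))) (fun s' h' => s' 0 = 80 + 7 * N /\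
    forall x, x <= u -> (h' (7 * N + x) = 1 /\ in_subset_sums lst u x) \/
                        (h' (7 * N + x) = 0 /\ ~ in_subset_sums lst u x)) s h.
Proof.
move=> e0 e1 hin; have b0 : 0 < b := b_ge1 u2 n2 nu; have uU : u < U := U_gt u2 n2 nu.
have [_ _ hB N1] := big_B u2 n2 nu szl lu BM.
have bB : b < B.
  have := b_le_n u2 n2 nu; have := N_ge u n; have := ub_ge u2 n2 nu; move: hB nu N1; clear; lia.
have K4 := K_ge4 u2 n2 nu.
have ubK : 1 <= u * b * K.
  by rewrite !muln_gt0 b0 (ltnW u2) /=; apply: leq_trans K4.
have ct := classes_time.
apply: (wp_time (t := 500 * (1000 * (u * b * K)) + (100 * (1000 * (u * b * K)) + 1))); last first.
  by move: ubK; move: (u * b * K); clear; lia.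
apply: (@wp_seq _ _ _ _ _ _ _ _ _ _ (leqnn _)).
apply: (wp_conseq (setup_ok u2 n2 nu szl lu BM e0 e1 hin)) => // s1 h1 [ge1 hi1 ha1].
apply: (@wp_seq _ _ _ _ _ _ _ _ _ _ (leqnn _)); apply: wp_time ct.
pose I i (s' h' : store) := [/\ genv s', hinv h' &
  exists fa, acc_bits u n lst i fa /\ forall z, z < U -> h' (7 * N + z) = fa z].
have geu s' i : genv s' -> genv (upd s' 28 i).
  by apply: genv_gsame => y Hy; rewrite /upd ifF //; apply/eqP; move: Hy; clear; lia.
apply: (@wp_for B 28 (Var 19) _ b t I) => //.
- split=> //.
  exists (fun z => z == 0); split=> // z; rewrite ssum0.
  by split=> [/eqP ->|[_ ->]].
- by move=> i s' h' _ [[[[_ _ _ e] _] _ _] _ _] _.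
- move=> i s' h' ib [ge hi [fa [ab ha]]] e28.
  apply: (wp_conseq (class_ok u2 n2 nu szl lu BM ib us ge hi e28 ab ha)) => // s2 h2 [sm hi2 ex].
  by split; [rewrite sm|split=> //; apply: geu; apply: genv_esame ge; apply: esame_le sm].
move=> s2 h2 [[_ _ [_ _ e26 _]] _ [fa [ab ha]]].
apply: wp_asn; rewrite /= e26; first by move: hB N1; clear; lia.
move=> v ->; split=> // x xu; rewrite ha; last exact: leq_ltn_trans xu uU.
have := ab x; rewrite (ssum_all _ b0 xu).
by case: (fa x) => -[h3 h4]; [left; have [] := h3 isT|right; split=> // h5; have := h4 (conj xu h5)].
Qed.

End Main.

(** The constants of the program do not depend on the input, so checking it once by computation at
    1000 covers every larger bound. *)
Lemma okc_mono B0 B c : B0 <= B -> okc B0 c -> okc B c.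
Proof.
move=> BB.
have wf e : wfe B0 e -> wfe B e.
  by elim: e => //= [k /leq_trans ->|o e1 h1 e2 h2 /andP[/h1 -> /h2 ->]].
have ok e : oke B0 e -> oke B e by move=> /andP[/wf w l]; rewrite /oke w.
elim: c => //= [x e /andP[-> /ok ->]|e1 e2 /andP[/ok -> /ok ->]|c1 h1 c2 h2 /andP[/h1 -> /h2 ->]|
  e c1 h1 c2 h2 /and3P[/ok -> /h1 -> /h2 ->]|e c h /andP[/ok -> /h ->]] //.
Qed.

Lemma okc_MAIN : okc 1000 MAIN. Proof. by []. Qed.

(** The exponents: N <= 1024 u b <= (u + 2)^7, since 1024 = 4^5; D * Hd = N^76, so 4 [M0] + 1 is at
    most N^153; and 16 comes from the word bound B^16. *)
Lemma word_bound u n : 2 <= u -> 2 <= n -> n <= u.+1 ->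
  (4 * encM (fft_D (par_K u n)) (fft_Hd (par_K u n))).+1 ^ 16 <= (u + 2) ^ (7 * (153 * 16)).
Proof.
move=> u2 n2 nu; rewrite !expnM leq_exp2r //.
have N1 : 1024 <= 2 ^ par_K u n.
  by have := N_ge u n; have := ub_ge u2 n2 nu; move: (u * par_b n) u2; clear; lia.
have Nu : 2 ^ par_K u n <= (u + 2) ^ 7.
  apply: leq_trans (N_le u2 n2 nu) _.
  have h1 : 4 ^ 5 <= (u + 2) ^ 5 by rewrite leq_exp2r //; move: u2; clear; lia.
  have h2 : u * par_b n <= (u + 2) ^ 2.
    apply: leq_mul; first exact: leq_addr.
    by apply: leq_trans (b_le_n u2 n2 nu) (leq_trans nu _); rewrite addn2.
  by rewrite (expnD (u + 2) 5 2); apply: leq_mul h2.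
apply: leq_trans (_ : (2 ^ par_K u n) ^ 153 <= _); last by rewrite leq_exp2r.
have HN : fft_D (par_K u n) * fft_Hd (par_K u n) = (2 ^ par_K u n) ^ 76.
  by rewrite /fft_Hd /fft_D -!expnD; congr expn.
rewrite /encM /encH HN (expnS _ 152); move: N1; move: (2 ^ par_K u n) => N N1.
have -> : N ^ 152 = N ^ 76 * N ^ 76 by rewrite -expnD.
have : 0 < N ^ 76 by rewrite expn_gt0; apply/orP; left; apply: leq_trans N1.
move: (N ^ 76) => X X0.
have : 1024 * (X * X) <= N * (X * X) by rewrite leq_mul2r N1 orbT.
have : 0 < X * X by rewrite muln_gt0 X0.
have -> : 4 * X * (4 * X) = 16 * (X * X) by ring.
by move: (X * X) (N * _) => *; lia.
Qed.

(** The time is a constant times b u log u; squaring replaces b by b^2 <= n log n and avoids a real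
    square root. *)
Lemma time_bound c u n T C : 2 <= u -> 2 <= n -> n <= u.+1 ->
  T = (1000 * (1000 * (u * par_b n * par_K u n))).+1 * c -> C = 16 * (1001 * 1000) * c ->
  T * T <= C * C * (n * trunc_log 2 n) * (u * trunc_log 2 u) ^ 2.
Proof.
move=> u2 n2 nu eT eC.
have Kl := K_le_lu u2 n2 nu; have K4 := K_ge4 u2 n2 nu; have b0 := b_ge1 u2 n2 nu.
have /andP[bb _] := b_sq n.
have TC : T <= C * (par_b n * (u * trunc_log 2 u)).
  have -> : C * (par_b n * (u * trunc_log 2 u)) = 1001 * (1000 * (u * par_b n * (16 * trunc_log 2 u))) * c.
    by rewrite eC; ring.
  rewrite eT leq_mul2r; apply/orP; right.
  have h1 : u * par_b n * par_K u n <= u * par_b n * (16 * trunc_log 2 u).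
    by rewrite leq_mul2l; apply/orP; right; apply: leq_trans Kl _; rewrite leq_mul2r orbT.
  have h2 : 0 < u * par_b n * par_K u n by rewrite !muln_gt0 b0 (ltnW u2) /=; apply: leq_trans K4.
  by move: h1 h2; move: (u * par_b n * par_K u n) (_ * (16 * _)); clear; lia.
apply: leq_trans (leq_mul TC TC) _.
have -> : C * (par_b n * (u * trunc_log 2 u)) * (C * (par_b n * (u * trunc_log 2 u))) =
    C * C * (par_b n * par_b n) * (u * trunc_log 2 u) ^ 2 by rewrite expnS expn1; ring.
by rewrite leq_mul2r leq_mul2l bb !orbT.
Qed.

(* There is a fixed word-RAM program P and constants C, K such that for every
   u >= 2 and every set S (duplicate-free list s) of n >= 2 elements of [u],
   P halts on the encoding of (u, S), using words < (u+2)^K, after T steps with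
   T <= C * sqrt(n log n) * u * log u (stated squared to stay in nat), and
   outputs the characteristic vector of S_u(S) at cells M[0]+0 .. M[0]+u. *)
Theorem theorem3p4 :
  exists (P : seq instr) (C K : nat),
    forall (u : nat) (s : seq nat),
      2 <= u -> uniq s -> all (fun x => x <= u) s -> 2 <= size s ->
      exists (T : nat) (m' : memory),
        T * T <= C * C * (size s * trunc_log 2 (size s))
                       * (u * trunc_log 2 u) ^ 2 /\
        run P ((u + 2) ^ K) T 0 (init_mem u s) = Some m' /\
        forall x, x <= u ->
          (m' (m' 0 + x) = 1 /\ in_subset_sums s u x) \/
          (m' (m' 0 + x) = 0 /\ ~ in_subset_sums s u x).
Proof.
have [P [c run_P]] := compile_run MAIN.
exists P, (16 * (1001 * 1000) * c), (7 * (153 * 16)) => u s u2 us su n2.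
have nu : size s <= u.+1.
  have sub : {subset s <= iota 0 u.+1} by move=> x /(allP su) xu; rewrite mem_iota.
  by have := uniq_leq_size us sub; rewrite size_iota.
have BM : 4 * encM (fft_D (par_K u (size s))) (fft_Hd (par_K u (size s))) <
    (4 * encM (fft_D (par_K u (size s))) (fft_Hd (par_K u (size s)))).+1 by [].
have [_ _ hB N1] := big_B u2 n2 nu erefl su BM.
have Nu : 512 * u <= 2 ^ par_K u (size s).
  by apply: leq_trans (N_ge _ _); rewrite leq_mul2l (ub_ge u2 n2 nu) orbT.
have [||m' [s' [h' [rn [e0 out] em eh]]]] := run_P _ _ u s _ _ _ _ (word_bound u2 n2 nu) u2 n2 nu su
  (fun s0 h0 => @main_ok u (size s) _ s u2 n2 nu erefl su BM us s0 h0).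
- by apply: okc_mono okc_MAIN; move: hB N1; clear; lia.
- by move: hB Nu N1; clear; lia.
exists ((1000 * (1000 * (u * par_b (size s) * par_K u (size s)))).+1 * c), m'; split.
  exact: time_bound.
split=> // x xu; rewrite em e0 -addnA eh; exact: out.
Qed.
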